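(* Let $\Omega\subseteq\mathbb{R}^n$ be open and let $R$ be an operator with generalized kernel $k_R\in\mathcal{G}(\Omega\times\Omega)$. (i) $R$ maps $\mathcal{L}_{\mathrm{b}}(\mathcal{G}(\Omega),\widetilde{\mathbb{C}})$ into $\mathcal{G}(\Omega)$ with continuity. (ii) If $R$ is properly supported then it is a continuous map from $\mathcal{L}_{\mathrm{b}}(\mathcal{G}(\Omega),\widetilde{\mathbb{C}})$ to $\mathcal{G}_c(\Omega)$ and from $\mathcal{L}_{\mathrm{b}}(\mathcal{G}_c(\Omega),\widetilde{\mathbb{C}})$ to $\mathcal{G}(\Omega)$. (iii) If $k_R\in\mathcal{G}^\infty(\Omega\times\Omega)$ then (i) and (ii) hold for the same spaces of functionals and with $\mathcal{G}^\infty_c(\Omega)$ and $\mathcal{G}^\infty(\Omega)$ in place of $\mathcal{G}_c(\Omega)$ and $\mathcal{G}(\Omega)$ respectively.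
   Context: **Colombeau spaces.** Nets are indexed by $\varepsilon\in(0,1]$; $[(\cdot)_\varepsilon]$ denotes the class of a net; $O$-estimates are as $\varepsilon\to 0$; $K\Subset\Omega$ means $K$ is a compact subset of $\Omega$. $\widetilde{\mathbb{C}}$ is the ring of nets in $\mathbb{C}$ that are $O(\varepsilon^{-N})$ for some $N\in\mathbb{N}$, modulo nets that are $O(\varepsilon^q)$ for all $q\in\mathbb{N}$; $|z|_{\mathrm{e}}:=e^{-\mathrm{v}(z)}$ with $\mathrm{v}(z)=\sup\{b\in\mathbb{R}:|z_\varepsilon|=O(\varepsilon^b)\}$. An ultra-pseudo-seminorm on a $\widetilde{\mathbb{C}}$-module is a map $P$ into $[0,\infty)$ with $P(0)=0$, $P(\lambda u)\le|\lambda|_{\mathrm{e}}P(u)$, $P(u+v)\le\max(P(u),P(v))$; families of these define the locally convex $\widetilde{\mathbb{C}}$-linear topologies; a set is bounded if every defining ultra-pseudo-seminorm (every continuous one) is bounded on it. $\mathcal{G}(\Omega)$: nets $(u_\varepsilon)_\varepsilon$ in $\mathcal{C}^\infty(\Omega)$ with $\forall K\Subset\Omega\,\forall\alpha\,\exists N$: $\sup_K|\partial^\alpha u_\varepsilon|=O(\varepsilon^{-N})$, modulo those with $\forall K\,\forall\alpha\,\forall q$: $\sup_K|\partial^\alpha u_\varepsilon|=O(\varepsilon^q)$; topologized by $\mathcal{P}_{K,i}(u)=\exp(-\sup\{b:\sup_{x\in K,|\alpha|\le i}|\partial^\alpha u_\varepsilon(x)|=O(\varepsilon^b)\})$. $\mathcal{G}^\infty(\Omega)$: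 those $u\in\mathcal{G}(\Omega)$ having a representative with $\forall K\,\exists N\,\forall\alpha$: $\sup_K|\partial^\alpha u_\varepsilon|=O(\varepsilon^{-N})$; topologized by $\mathcal{P}_{\mathcal{G}^\infty(K)}(u)=\exp(-\sup\{b:\forall\alpha\ \sup_K|\partial^\alpha u_\varepsilon|=O(\varepsilon^b)\})$, $K\Subset\Omega$. $\mathcal{G}_c(\Omega)$: compactly supported elements of $\mathcal{G}(\Omega)$ (with representatives supported in a common compact set); $\mathcal{G}^\infty_c(\Omega)=\mathcal{G}^\infty(\Omega)\cap\mathcal{G}_c(\Omega)$. For $K\Subset\Omega$, $\mathcal{G}_K(\Omega)$ and $\mathcal{G}^\infty_K(\Omega)$ are the elements of $\mathcal{G}_c(\Omega)$, $\mathcal{G}^\infty_c(\Omega)$ with support in $K$, topologized respectively by $\mathcal{P}_{K',i}$ ($i\in\mathbb{N}$) and by $\mathcal{P}_{\mathcal{G}^\infty(K')}$, $K'\Subset\Omega$ any compact set containing $K$ in its interior; $\mathcal{G}_c(\Omega)$ and $\mathcal{G}^\infty_c(\Omega)$ carry the corresponding strict inductive limit topologies (finest locally convex $\widetilde{\mathbb{C}}$-linear topology making the inclusions continuous). **Duals.** $\mathcal{L}(\cdot,\widetilde{\mathbb{C}})$ is the set of continuous $\widetilde{\mathbb{C}}$-linear functionals, with the topology of uniform convergence on bounded subsets, i.e. given by $\mathcal{P}_B(T)=\sup_{u\in B}|Tu|_{\mathrm{e}}$, $B$ bounded. $\mathcal{G}(\Omega)\subseteq\mathcal{L}(\mathcal{G}_c(\Omega),\widetilde{\mathbb{C}})$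 and $\mathcal{G}_c(\Omega)\subseteq\mathcal{L}(\mathcal{G}(\Omega),\widetilde{\mathbb{C}})$ via $u\mapsto(v\mapsto\int_\Omega uv\,dx)$. $\mathcal{L}_{\mathrm{b}}$ denotes the subspace of basic functionals with the induced topology: $T\in\mathcal{L}(\mathcal{G}(\Omega),\widetilde{\mathbb{C}})$ is basic if $Tu=[(T_\varepsilon u_\varepsilon)_\varepsilon]$ with $T_\varepsilon\in\mathcal{E}'(\Omega)$ and $\exists K\Subset\Omega\,\exists j,N\in\mathbb{N}\,\exists\eta\in(0,1]\,\forall u\in\mathcal{C}^\infty(\Omega)\,\forall\varepsilon\in(0,\eta]$: $|T_\varepsilon(u)|\le\varepsilon^{-N}\sup_{x\in K,|\alpha|\le j}|\partial^\alpha u(x)|$. $T\in\mathcal{L}(\mathcal{G}_c(\Omega),\widetilde{\mathbb{C}})$ is basic if $Tu=[(T_\varepsilon u_\varepsilon)_\varepsilon]$ with $T_\varepsilon\in\mathcal{D}'(\Omega)$ and $\forall K\Subset\Omega\,\exists j,N\,\exists\eta\,\forall u\in\mathcal{D}_K(\Omega)\,\forall\varepsilon\in(0,\eta]$: the same estimate. **Operators with generalized kernel.** $R:\mathcal{G}_c(\Omega)\to\mathcal{G}(\Omega)$ is an operator with generalized kernel $k_R\in\mathcal{G}(\Omega\times\Omega)$ if $Ru(x)=\int_\Omega k_R(x,y)u(y)\,dy$; its transpose is ${}^tRu(y)=\int_\Omega k_R(x,y)u(x)\,dx$. $R$ acts on $T\in\mathcal{L}(\mathcal{G}(\Omega),\widetilde{\mathbb{C}})$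 by $RT(u):=T({}^tRu)$, $u\in\mathcal{G}_c(\Omega)$. $R$ is properly supported if $V=\mathrm{supp}\,k_R$ is a proper subset of $\Omega\times\Omega$, i.e. for all compact $K$ both $\pi_2(V\cap\pi_1^{-1}(K))$ and $\pi_1(V\cap\pi_2^{-1}(K))$ are relatively compact in $\Omega$ ($\pi_1,\pi_2$ the two projections); in this case ${}^tR$ maps $\mathcal{G}_c(\Omega)$ continuously into itself (and extends continuously to $\mathcal{G}(\Omega)\to\mathcal{G}(\Omega)$), and $R$ acts on $T\in\mathcal{L}(\mathcal{G}_c(\Omega),\widetilde{\mathbb{C}})$ by the same formula $RT(u)=T({}^tRu)$. *)

(* Defs.v *)
From HB Require Import structures.
From mathcomp Require Import all_boot all_order all_algebra.
From mathcomp Require Import generic_quotient ring_quotient complex.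
From mathcomp Require Import all_classical all_reals all_analysis.
Import Order.TTheory GRing.Theory Num.Theory numFieldNormedType.Exports.
Import ComplexField.Normc.

Set Implicit Arguments.
Unset Strict Implicit.
Unset Printing Implicit Defensive.

Local Open Scope classical_set_scope.
Local Open Scope ring_scope.
Local Open Scope quotient_scope.
Local Open Scope complex_scope.

(* A net is a function of e : R; only its values for 0 < e <= 1 matter.
   O-estimates as e -> 0 are taken along the filter 0^'+. *)

Section Estimates.
Variable R : realType.
Implicit Types (z : R -> \bar R) (b C : R).

(* Supremum of a set of nonnegative quantities; the supremum of the empty set
   is 0 (and not -oo as with ereal_sup). *)
Definition nnsup (A : set (\bar R)) : \bar R := ereal_sup (0%E |` A).

(* z_e = O(e^b), for a net z of nonnegative extended reals *)
Definition bigOpow z b : Prop :=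
  exists C, \forall e \near 0^'+, (z e <= (C * e `^ b)%:E)%E.

Definition valuation z : \bar R :=
  ereal_sup [set b%:E | b in [set b | bigOpow z b]].

Lemma near_unit : \forall e \near (0:R)^'+, 0 < e <= 1.
Proof.
near=> e; apply/andP; split; near: e; first exact: nbhs_right_gt.
exact: nbhs_right_le.
Unshelve. all: by end_near. Qed.

Lemma nnsup_le (A : set (\bar R)) (x : \bar R) :
  (0 <= x)%E -> (forall y, A y -> (y <= x)%E) -> (nnsup A <= x)%E.
Proof. by move=> x0 Ax; apply: ge_ereal_sup => y [->//|/Ax]. Qed.

Lemma nnsup_ub (A : set (\bar R)) (x : \bar R) : A x -> (x <= nnsup A)%E.
Proof. by move=> Ax; apply: ereal_sup_ubound; right. Qed.

Lemma nnsup_ge0 (A : set (\bar R)) : (0 <= nnsup A)%E.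
Proof. by apply: ereal_sup_ubound; left. Qed.

Lemma bigOpow_pos z b : bigOpow z b ->
  exists2 C, 0 <= C & \forall e \near 0^'+, (z e <= (C * e `^ b)%:E)%E.
Proof.
case=> C h; exists `|C| => //; near=> e.
have : (z e <= (C * e `^ b)%:E)%E by near: e.
move=> /le_trans; apply; rewrite lee_fin ler_wpM2r ?powR_ge0 //.
exact: ler_norm.
Unshelve. all: by end_near. Qed.

Lemma bigOpow_le z1 z2 b :
  (\forall e \near 0^'+, (z1 e <= z2 e)%E) -> bigOpow z2 b -> bigOpow z1 b.
Proof.
move=> h [C hC]; exists C; near=> e.
by apply: (@le_trans _ _ (z2 e)); near: e.
Unshelve. all: by end_near. Qed.

Lemma bigOpow_weak z b b' : b' <= b -> bigOpow z b -> bigOpow z b'.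
Proof.
move=> bb' /bigOpow_pos [C C0 hC]; exists C; near=> e.
apply: (@le_trans _ _ (C * e `^ b)%:E); first by near: e.
rewrite lee_fin ler_wpM2l // ger_powR //.
by near: e; exact: near_unit.
Unshelve. all: by end_near. Qed.

Lemma bigOpowD z z1 z2 b : bigOpow z1 b -> bigOpow z2 b ->
  (\forall e \near 0^'+, (z e <= z1 e + z2 e)%E) -> bigOpow z b.
Proof.
move=> [C1 h1] [C2 h2] h; exists (C1 + C2); near=> e.
apply: (@le_trans _ _ (z1 e + z2 e)%E); first by near: e.
rewrite mulrDl EFinD leeD //; by near: e.
Unshelve. all: by end_near. Qed.

Lemma bigOpowM z (c : R -> R) z2 b1 b2 :
  bigOpow (EFin \o c) b1 -> bigOpow z2 b2 -> (forall e, 0 <= c e) ->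
  (\forall e \near 0^'+, (z e <= (c e)%:E * z2 e)%E) -> bigOpow z (b1 + b2).
Proof.
move=> /bigOpow_pos [C1 C10 h1] /bigOpow_pos [C2 C20 h2] c0 h.
exists (C1 * C2); near=> e.
apply: (@le_trans _ _ ((c e)%:E * z2 e)%E); first by near: e.
have z2e : (z2 e <= (C2 * e `^ b2)%:E)%E by near: e.
have ce : (c e <= C1 * e `^ b1)%R by rewrite -lee_fin; near: e.
apply: (@le_trans _ _ ((c e)%:E * (C2 * e `^ b2)%:E)%E).
  by rewrite lee_wpmul2l // lee_fin.
have e0 : e != 0 by apply: lt0r_neq0; near: e; exact: nbhs_right_gt.
rewrite -EFinM lee_fin powRD ?e0 ?implybT// mulrACA ler_wpM2r //.
by rewrite mulr_ge0 ?powR_ge0.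
Unshelve. all: by end_near. Qed.

End Estimates.

Section GeneralizedNumbers.
Variable R : realType.
Implicit Types z : R -> R[i].

Definition Cmoderate z : Prop :=
  exists N : nat, bigOpow (fun e => (normc (z e))%:E) (- N%:R).

Definition Cnegligible z : Prop :=
  forall q : nat, bigOpow (fun e => (normc (z e))%:E) q%:R.

Definition Cmoderate_pred : {pred R -> R[i]} := fun z => `[< Cmoderate z >].

Lemma normc_ge0 (x : R[i]) : 0 <= normc x.
Proof. by case: x => a b; exact: sqrtr_ge0. Qed.

Fact Cmoderate_subring : subring_closed Cmoderate_pred.
Proof.
split.
- apply/asboolP; exists 0%N; exists 1; near=> e.
  by rewrite oppr0 powRr0 mulr1 normc1.
- move=> x y /asboolP[N1 h1] /asboolP[N2 h2]; apply/asboolP; exists (N1 + N2)%N.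
  apply: (@bigOpowD _ _ (fun e => (normc (x e))%:E) (fun e => (normc (y e))%:E)).
  + by apply: bigOpow_weak h1; rewrite lerN2 ler_nat leq_addr.
  + by apply: bigOpow_weak h2; rewrite lerN2 ler_nat leq_addl.
  + by near=> e; rewrite -EFinD lee_fin (le_trans (le_normcD _ _)) // normcN.
- move=> x y /asboolP[N1 h1] /asboolP[N2 h2]; apply/asboolP; exists (N1 + N2)%N.
  rewrite natrD opprD; apply: bigOpowM h1 h2 _ _; first by move=> e; exact: normc_ge0.
  by near=> e; rewrite normcM.
Unshelve. all: by end_near. Qed.

HB.instance Definition _ :=
  GRing.isSubringClosed.Build (R -> R[i]) Cmoderate_pred Cmoderate_subring.

Record Cnet := MkCnet { Cnet_val :> R -> R[i]; _ : Cnet_val \in Cmoderate_pred }.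
HB.instance Definition _ := [isSub for Cnet_val].
HB.instance Definition _ := [Choice of Cnet by <:].
HB.instance Definition _ := [SubChoice_isSubComNzRing of Cnet by <:].

Definition Cnegligible_pred : {pred Cnet} := fun x => `[< Cnegligible x >].

Fact Cnegligible_ideal : idealr_closed Cnegligible_pred.
Proof.
split.
- apply/asboolP => q; exists 0; near=> e.
  by rewrite mul0r normc0.
- apply/asboolP => /(_ 1%N) /bigOpow_pos [C C0 hC].
  near (0:R)^'+ => e.
  have e0 : 0 < e by near: e; exact: nbhs_right_gt.
  have : ((normc (1 : R[i]))%:E <= (C * e `^ 1%:R)%:E)%E by near: e.
  have : e <= (C + 2)^-1.
    by near: e; apply: nbhs_right_le; rewrite invr_gt0 ltr_wpDl.
  rewrite normc1 lee_fin powRr1 ?(ltW e0) // => he.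
  apply/negP; rewrite -ltNge (le_lt_trans (ler_wpM2l C0 he)) //.
  by rewrite ltr_pdivrMr ?ltr_wpDl // mul1r ltrDl.
- move=> a x y /asboolP hx /asboolP hy; apply/asboolP => q.
  have [N hN] : Cmoderate a by case: a => a /= /asboolP.
  apply: (@bigOpowD _ _ (fun e => (normc (a e * x e))%:E) (fun e => (normc (y e))%:E)) => //.
  + have -> : q%:R = - N%:R + (N + q)%:R :> R by rewrite natrD addKr.
    apply: bigOpowM hN (hx _) _ _; first by move=> e; exact: normc_ge0.
    by near=> e; rewrite normcM EFinM.
  + by near=> e; rewrite -EFinD lee_fin; exact: le_normcD.
Unshelve. all: by end_near. Qed.

HB.instance Definition _ := isIdealr.Build Cnet Cnegligible_pred Cnegligible_ideal.

(* The ring of Colombeau generalized complex numbers *)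
Definition Cgen := {ideal_quot Cnegligible_pred}.
HB.instance Definition _ := GRing.ComNzRing.on Cgen.

Definition Cclass (z : R -> R[i]) : Cgen := \pi_Cgen (insubd (0 : Cnet) z).

Definition Crepr (x : Cgen) : R -> R[i] := (repr x : Cnet).

Lemma CreprK x : Cclass (Crepr x) = x.
Proof. by rewrite /Cclass /Crepr valKd reprK. Qed.

Lemma Cmoderate_repr x : Cmoderate (Crepr x).
Proof. by rewrite /Crepr; case: (repr x : Cnet) => z /= /asboolP. Qed.

Lemma CclassP z : Cmoderate z -> Cnegligible (fun e => Crepr (Cclass z) e - z e).
Proof.
move=> mz; have : Cclass (Crepr (Cclass z)) = Cclass z by rewrite CreprK.
move=> /eqP; rewrite -Quotient.idealrBE => /asboolP.
congr Cnegligible.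
by rewrite /= !insubdK //; apply/asboolP => //; exact: Cmoderate_repr.
Qed.

Lemma CclassD z w : Cmoderate z -> Cmoderate w ->
  Cclass (fun e => z e + w e) = Cclass z + Cclass w.
Proof.
move=> mz mw; rewrite /Cclass -rmorphD; congr (\pi_Cgen _); apply/val_inj.
have zm : z \in @Cmoderate_pred by apply/asboolP.
have wm : w \in @Cmoderate_pred by apply/asboolP.
by rewrite /= !insubdK //; exact: (rpredD zm wm).
Qed.

Lemma CclassM z w : Cmoderate z -> Cmoderate w ->
  Cclass (fun e => z e * w e) = Cclass z * Cclass w.
Proof.
move=> mz mw; rewrite /Cclass -rmorphM; congr (\pi_Cgen _); apply/val_inj.
have zm : z \in @Cmoderate_pred by apply/asboolP.
have wm : w \in @Cmoderate_pred by apply/asboolP.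
by rewrite /= !insubdK //; exact: (rpredM zm wm).
Qed.

Lemma Cclass1 : Cclass (fun=> 1) = 1.
Proof.
rewrite /Cclass -(rmorph1 \pi_Cgen); congr (\pi_Cgen _); apply/val_inj.
by rewrite /= insubdK //; exact: (rpred1 (@Cmoderate_pred)).
Qed.


(* |x|_e = e^{-v(x)} *)
Definition Cabs (x : Cgen) : \bar R :=
  expeR (- valuation (fun e => (normc (Crepr x e))%:E)).

End GeneralizedNumbers.

Section SmoothFunctions.
Variables (R : realType) (n : nat).

Fixpoint Dseq (s : seq 'I_n) (f : 'rV[R]_n -> R) : 'rV[R]_n -> R :=
  if s is i :: s' then derive (Dseq s' f) ^~ (delta_mx 0 i) else f.

Definition smoothR (Om : set 'rV[R]_n) (f : 'rV[R]_n -> R) : Prop :=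
  forall s x, Om x -> {for x, continuous (Dseq s f)} /\
    forall i, derivable (Dseq s f) x (delta_mx 0 i).

(* C^oo(Om), for Om open; the values of f off Om are irrelevant *)
Definition smooth (Om : set 'rV[R]_n) (f : 'rV[R]_n -> R[i]) : Prop :=
  smoothR Om (@complex.Re R \o f) /\ smoothR Om (@complex.Im R \o f).

Definition mdeg (a : {ffun 'I_n -> nat}) : nat := (\sum_i a i)%N.

Definition mseq (a : {ffun 'I_n -> nat}) : seq 'I_n :=
  flatten [seq nseq (a i) i | i <- enum 'I_n].

Definition pderiv (a : {ffun 'I_n -> nat}) (f : 'rV[R]_n -> R[i])
    (x : 'rV[R]_n) : R[i] :=
  Dseq (mseq a) (@complex.Re R \o f) x +i* Dseq (mseq a) (@complex.Im R \o f) x.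

(* sup_{x in K} |d^a f(x)| *)
Definition supD (K : set 'rV[R]_n) (a : {ffun 'I_n -> nat})
    (f : 'rV[R]_n -> R[i]) : \bar R :=
  nnsup [set (normc (pderiv a f x))%:E | x in K].

(* sup_{x in K, |a| <= j} |d^a f(x)| *)
Definition supDle (K : set 'rV[R]_n) (j : nat) (f : 'rV[R]_n -> R[i]) : \bar R :=
  nnsup [set (normc (pderiv xa.2 f xa.1))%:E |
         xa in K `*` [set a | (mdeg a <= j)%N]].

Lemma Dseq_lin (Om : set 'rV[R]_n) (f g : 'rV[R]_n -> R) (c d : R) s x :
  open Om -> smoothR Om f -> smoothR Om g -> Om x ->
  Dseq s (fun y => c * f y + d * g y) x = c * Dseq s f x + d * Dseq s g x.
Proof.
move=> oOm sf sg; elim: s x => [//|i s IH] x Ox /=.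
have -> : 'D_(delta_mx 0 i) (Dseq s (fun y => c * f y + d * g y)) x =
  'D_(delta_mx 0 i) (c \*: (Dseq s f : 'rV[R]_n -> R^o) +
                     d \*: (Dseq s g : 'rV[R]_n -> R^o)) x.
  apply: near_eq_derive; near=> y; apply: IH; near: y.
  exact: open_nbhs_nbhs.
have [_ /(_ i) df] := sf s x Ox; have [_ /(_ i) dg] := sg s x Ox.
by rewrite deriveD ?deriveZ //; exact: derivableZ.
Unshelve. all: by end_near. Qed.

Lemma smoothR_lin (Om : set 'rV[R]_n) (f g : 'rV[R]_n -> R) (c d : R) :
  open Om -> smoothR Om f -> smoothR Om g ->
  smoothR Om (fun y => c * f y + d * g y).
Proof.
move=> oOm sf sg s x Ox.
have [cf df] := sf s x Ox; have [cg dg] := sg s x Ox.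
have nOx : \forall y \near x, Om y by exact: open_nbhs_nbhs.
split=> [|i].
- have h : {for x, continuous (fun y => c * Dseq s f y + d * Dseq s g y)}.
    by apply: continuousD; apply: continuousM => //; exact: cst_continuous.
  change (Dseq s (fun y => c * f y + d * g y) @ x -->
          Dseq s (fun y => c * f y + d * g y) x).
  rewrite (Dseq_lin c d s oOm sf sg Ox).
  have e : {near x, (fun y => c * Dseq s f y + d * Dseq s g y) =1
                    Dseq s (fun y => c * f y + d * g y)}.
    near=> y; rewrite (Dseq_lin c d s oOm sf sg) //; by near: y.
  exact: cvg_trans (near_eq_cvg e) h.
- have h : derivable (c \*: (Dseq s f : 'rV[R]_n -> R^o) +
                     d \*: (Dseq s g : 'rV[R]_n -> R^o)) x (delta_mx 0 i).
    by apply: derivableD; apply: derivableZ.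
  apply: near_eq_derivable h; near=> y.
  by rewrite (Dseq_lin c d s oOm sf sg) //; near: y.
Unshelve. all: by end_near. Qed.

Lemma linRe (c : R[i]) (f g : 'rV[R]_n -> R[i]) :
  @complex.Re R \o (fun y => c * f y + g y) =
  (fun y => 1 * (complex.Re c * (@complex.Re R \o f) y +
    - complex.Im c * (@complex.Im R \o f) y) + 1 * (@complex.Re R \o g) y).
Proof.
apply/funext => y /=; rewrite !mul1r mulNr.
by case: c (f y) (g y) => [c1 c2] [f1 f2] [g1 g2].
Qed.

Lemma linIm (c : R[i]) (f g : 'rV[R]_n -> R[i]) :
  @complex.Im R \o (fun y => c * f y + g y) =
  (fun y => 1 * (complex.Re c * (@complex.Im R \o f) y +
    complex.Im c * (@complex.Re R \o f) y) + 1 * (@complex.Im R \o g) y).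
Proof.
apply/funext => y /=; rewrite !mul1r.
by case: c (f y) (g y) => [c1 c2] [f1 f2] [g1 g2].
Qed.

Lemma smooth_lin (Om : set 'rV[R]_n) (f g : 'rV[R]_n -> R[i]) (c : R[i]) :
  open Om -> smooth Om f -> smooth Om g -> smooth Om (fun y => c * f y + g y).
Proof.
move=> oOm [f1 f2] [g1 g2]; split.
  by rewrite linRe; apply: smoothR_lin => //; exact: smoothR_lin.
by rewrite linIm; apply: smoothR_lin => //; exact: smoothR_lin.
Qed.

Lemma pderiv_lin (Om : set 'rV[R]_n) (f g : 'rV[R]_n -> R[i]) (c : R[i]) a x :
  open Om -> smooth Om f -> smooth Om g -> Om x ->
  pderiv a (fun y => c * f y + g y) x = c * pderiv a f x + pderiv a g x.
Proof.
move=> oOm [f1 f2] [g1 g2] Ox; rewrite /pderiv linRe linIm.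
have h1 := smoothR_lin (complex.Re c) (- complex.Im c) oOm f1 f2.
have h2 := smoothR_lin (complex.Re c) (complex.Im c) oOm f2 f1.
rewrite (Dseq_lin 1 1 _ oOm h1 g1 Ox) (Dseq_lin 1 1 _ oOm h2 g2 Ox).
rewrite (Dseq_lin _ _ _ oOm f1 f2 Ox) (Dseq_lin _ _ _ oOm f2 f1 Ox) !mul1r mulNr.
by case: c {h1 h2}.
Qed.

Lemma supD_lin (Om K : set 'rV[R]_n) (f g : 'rV[R]_n -> R[i]) (c : R[i]) a :
  open Om -> K `<=` Om -> smooth Om f -> smooth Om g ->
  (supD K a (fun y => c * f y + g y)%R
    <= (normc c)%:E * supD K a f + supD K a g)%E.
Proof.
move=> oOm KOm sf sg; apply: nnsup_le => [|_ [x Kx <-]].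
  by rewrite adde_ge0 ?mule_ge0 ?nnsup_ge0 // lee_fin; exact: normc_ge0.
rewrite (pderiv_lin c a oOm sf sg (KOm _ Kx)).
apply: (@le_trans _ _ ((normc c)%:E * (normc (pderiv a f x))%:E +
                       (normc (pderiv a g x))%:E)%E).
  by rewrite -EFinM -EFinD lee_fin -normcM; exact: le_normcD.
apply: leeD; last by apply: nnsup_ub; exists x.
apply: lee_wpmul2l; first by rewrite lee_fin; exact: normc_ge0.
by apply: nnsup_ub; exists x.
Qed.

Lemma smooth0 (Om : set 'rV[R]_n) : open Om -> smooth Om (fun=> 0).
Proof.
move=> oOm.
have h : smoothR Om (fun=> 0 : R).
  have D0 s : Dseq s (fun=> 0 : R) = fun=> 0.
    elim: s => //= i s ->; apply/funext => x; exact: derive_cst.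
  move=> s x Ox; rewrite D0; split; first exact: cst_continuous.
  by move=> i; exact: derivable_cst.
by split.
Qed.

Lemma supD0 (Om K : set 'rV[R]_n) a : open Om -> K `<=` Om ->
  supD K a (fun=> 0) = 0%E.
Proof.
move=> oOm KOm; apply/eqP; rewrite eq_le nnsup_ge0 andbT.
apply: nnsup_le => // _ [x Kx <-].
pose o : 'rV[R]_n -> R[i] := fun=> 0.
have oE : (fun y => -1 * o y + o y) = o.
  by apply/funext => y; rewrite mulN1r addNr.
have h : pderiv a (fun y => -1 * o y + o y) x = -1 * pderiv a o x + pderiv a o x.
  exact: pderiv_lin oOm (smooth0 oOm) (smooth0 oOm) (KOm _ Kx).
by rewrite oE mulN1r addNr in h; rewrite h normc0.
Qed.

End SmoothFunctions.

Record openset (R : realType) (n : nat) := OpenSet {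
  openset_val :> set 'rV[R]_n;
  opensetP : open openset_val }.
Arguments opensetP [R n] o : rename.

Section GeneralizedFunctions.
Variables (R : realType) (n : nat) (Om : openset R n).
Implicit Types (v : R -> 'rV[R]_n -> R[i]).

Definition Gmoderate v : Prop :=
  (forall e, 0 < e <= 1 -> smooth Om (v e)) /\
  forall K, compact K -> K `<=` Om -> forall a, exists N : nat,
    bigOpow (fun e => supD K a (v e)) (- N%:R).

Definition Gnegligible (U : set 'rV[R]_n) v : Prop :=
  forall K, compact K -> K `<=` U -> forall a (q : nat),
    bigOpow (fun e => supD K a (v e)) q%:R.

Definition Gmoderate_pred : {pred R -> 'rV[R]_n -> R[i]} :=
  fun v => `[< Gmoderate v >].

Lemma Gmoderate_lin z v w : Cmoderate z -> Gmoderate v -> Gmoderate w ->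
  Gmoderate (fun e x => z e * v e x + w e x).
Proof.
have oOm := opensetP Om.
move=> [N hN] [sv hv] [sw hw]; split => [e e01|K cK KOm a].
  by apply: smooth_lin => //; [exact: sv | exact: sw].
have [N1 h1] := hv K cK KOm a; have [N2 h2] := hw K cK KOm a.
exists (N + N1 + N2)%N.
apply: (@bigOpowD _ _ (fun e => (normc (z e))%:E * supD K a (v e))%E
                      (fun e => supD K a (w e))).
- have h : bigOpow (fun e => (normc (z e))%:E * supD K a (v e))%E (- N%:R - N1%:R).
    apply: bigOpowM hN h1 _ _; first by move=> e; exact: normc_ge0.
    by near=> e.
  by apply: bigOpow_weak h; rewrite -opprD lerN2 -natrD ler_nat leq_addr.
- by apply: bigOpow_weak h2; rewrite lerN2 ler_nat leq_addl.
- near=> e; have e01 : 0 < e <= 1 by near: e; exact: near_unit.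
  by apply: supD_lin oOm KOm (sv _ e01) (sw _ e01).
Unshelve. all: by end_near. Qed.

Lemma Gnegligible_lin z v w : Cmoderate z -> Gmoderate v -> Gmoderate w ->
  Gnegligible Om v -> Gnegligible Om w ->
  Gnegligible Om (fun e x => z e * v e x + w e x).
Proof.
have oOm := opensetP Om.
move=> [N hN] [sv _] [sw _] nv nw K cK KOm a q.
apply: (@bigOpowD _ _ (fun e => (normc (z e))%:E * supD K a (v e))%E
                      (fun e => supD K a (w e))).
- have -> : q%:R = - N%:R + (N + q)%:R :> R by rewrite natrD addKr.
  apply: bigOpowM hN (nv K cK KOm a _) _ _; first by move=> e; exact: normc_ge0.
  by near=> e.
- exact: nw.
- near=> e; have e01 : 0 < e <= 1 by near: e; exact: near_unit.
  by apply: supD_lin oOm KOm (sv _ e01) (sw _ e01).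
Unshelve. all: by end_near. Qed.

Lemma Gnegligible_scale z v : Cnegligible z -> Gmoderate v ->
  Gnegligible Om (fun e x => z e * v e x).
Proof.
have oOm := opensetP Om.
move=> nz [sv hv] K cK KOm a q; have [N hN] := hv K cK KOm a.
have -> : q%:R = (N + q)%:R - N%:R :> R by rewrite natrD addrAC subrr add0r.
apply: bigOpowM (nz _) hN _ _; first by move=> e; exact: normc_ge0.
near=> e; have e01 : 0 < e <= 1 by near: e; exact: near_unit.
have := supD_lin (z e) a oOm KOm (sv _ e01) (smooth0 oOm).
rewrite (supD0 a oOm KOm) adde0; congr (_ <= _)%E; congr (supD _ _ _).
by apply/funext => x; rewrite addr0.
Unshelve. all: by end_near. Qed.

Lemma Gmoderate0 : Gmoderate 0.
Proof.
have oOm := opensetP Om.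
split=> [e _|K cK KOm a]; first exact: smooth0.
by exists 0%N; exists 0; near=> e; rewrite (supD0 a oOm KOm) mul0r.
Unshelve. all: by end_near. Qed.

Lemma Gnegligible0 : Gnegligible Om 0.
Proof.
move=> K cK KOm a q; exists 0; near=> e.
by rewrite (supD0 a (opensetP Om) KOm) mul0r.
Unshelve. all: by end_near. Qed.

Lemma CmoderateN1 : Cmoderate (fun=> -1 : R[i]).
Proof.
have : (-1 : R -> R[i]) \in @Cmoderate_pred R by rewrite rpredN1.
by move=> /asboolP.
Qed.

Fact Gmoderate_zmod : zmod_closed Gmoderate_pred.
Proof.
split; first by apply/asboolP; exact: Gmoderate0.
move=> v w /asboolP mv /asboolP mw; apply/asboolP.
have := Gmoderate_lin CmoderateN1 mw mv; congr Gmoderate.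
by apply/funext => e; apply/funext => x; rewrite mulN1r addrC.
Qed.

HB.instance Definition _ := GRing.isZmodClosed.Build
  (R -> 'rV[R]_n -> R[i]) Gmoderate_pred Gmoderate_zmod.

Record Gnet := MkGnet {
  Gnet_val :> R -> 'rV[R]_n -> R[i]; _ : Gnet_val \in Gmoderate_pred }.
HB.instance Definition _ := [isSub for Gnet_val].
HB.instance Definition _ := [Choice of Gnet by <:].
HB.instance Definition _ := [SubChoice_isSubZmodule of Gnet by <:].

Definition Gnegligible_pred : {pred Gnet} := fun f => `[< Gnegligible Om f >].

Lemma GnetP (f : Gnet) : Gmoderate f.
Proof. by case: f => f /= /asboolP. Qed.

Fact Gnegligible_zmod : zmod_closed Gnegligible_pred.
Proof.
split; first by apply/asboolP; exact: Gnegligible0.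
move=> v w /asboolP nv /asboolP nw; apply/asboolP.
have := Gnegligible_lin CmoderateN1 (GnetP w) (GnetP v) nw nv.
congr Gnegligible.
by apply/funext => e; apply/funext => x; rewrite mulN1r addrC.
Qed.

HB.instance Definition _ :=
  GRing.isZmodClosed.Build Gnet Gnegligible_pred Gnegligible_zmod.

(* G(Om); its Cgen R-module structure is given by scaleG below *)
Definition G := Quotient.quot Gnegligible_pred.
HB.instance Definition _ := GRing.Zmodule.on G.

Definition Gclass v : G := \pi_G (insubd (0 : Gnet) v).

Definition Grepr (u : G) : R -> 'rV[R]_n -> R[i] := (repr u : Gnet).

Lemma GreprK u : Gclass (Grepr u) = u.
Proof. by rewrite /Gclass /Grepr valKd reprK. Qed.

Lemma Gmoderate_repr u : Gmoderate (Grepr u). Proof. exact: GnetP. Qed.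

Lemma Gclass_eq v w : Gmoderate v -> Gmoderate w ->
  Gnegligible Om (fun e x => v e x - w e x) -> Gclass v = Gclass w.
Proof.
move=> mv mw nvw; rewrite /Gclass; apply/eqP; rewrite -Quotient.idealrBE.
apply/asboolP; move: nvw; congr Gnegligible.
by rewrite /= !insubdK //; apply/asboolP.
Qed.

Lemma Gclass_inj v w : Gmoderate v -> Gmoderate w -> Gclass v = Gclass w ->
  Gnegligible Om (fun e x => v e x - w e x).
Proof.
move=> mv mw /eqP; rewrite -Quotient.idealrBE => /asboolP.
congr Gnegligible.
by rewrite /= !insubdK //; apply/asboolP.
Qed.

Lemma GclassP v : Gmoderate v ->
  Gnegligible Om (fun e x => Grepr (Gclass v) e x - v e x).
Proof.
move=> mv; apply: Gclass_inj => //; first exact: Gmoderate_repr.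
by rewrite GreprK.
Qed.

Lemma GclassD v w : Gmoderate v -> Gmoderate w ->
  Gclass (fun e x => v e x + w e x) = Gclass v + Gclass w.
Proof.
move=> mv mw; rewrite /Gclass -raddfD; congr (\pi_G _); apply/val_inj.
have vm : v \in Gmoderate_pred by apply/asboolP.
have wm : w \in Gmoderate_pred by apply/asboolP.
by rewrite /= !insubdK //; exact: (rpredD vm wm).
Qed.

Lemma Gmoderate_scale z v : Cmoderate z -> Gmoderate v ->
  Gmoderate (fun e x => z e * v e x).
Proof.
move=> mz mv; have := Gmoderate_lin mz mv Gmoderate0; congr Gmoderate.
by apply/funext => e; apply/funext => x; rewrite addr0.
Qed.

Definition scaleG (c : Cgen R) (u : G) : G :=
  Gclass (fun e x => Crepr c e * Grepr u e x).

Lemma scaleGE z v : Cmoderate z -> Gmoderate v ->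
  scaleG (Cclass z) (Gclass v) = Gclass (fun e x => z e * v e x).
Proof.
move=> mz mv; apply: Gclass_eq.
- by apply: Gmoderate_scale; [exact: Cmoderate_repr | exact: Gmoderate_repr].
- exact: Gmoderate_scale.
have mv' := Gmoderate_repr (Gclass v).
have mz' := Cmoderate_repr (Cclass z).
have nv := GclassP mv; have nz := CclassP mz.
have mdv := Gmoderate_lin CmoderateN1 mv mv'.
have mdz : Cmoderate (fun e => Crepr (Cclass z) e - z e).
  have zm : z \in @Cmoderate_pred R by apply/asboolP.
  have zm' : Crepr (Cclass z) \in @Cmoderate_pred R by apply/asboolP.
  by have /asboolP := rpredB zm' zm.
have dvE : (fun e x => -1 * v e x + Grepr (Gclass v) e x) =
    (fun e x => Grepr (Gclass v) e x - v e x).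
  by apply/funext => e; apply/funext => x; rewrite mulN1r addrC.
rewrite dvE in mdv.
have := Gnegligible_lin mz mdv (Gmoderate_scale mdz mv') nv
  (Gnegligible_scale nz mv').
congr Gnegligible; apply/funext => e; apply/funext => x.
by rewrite mulrBr mulrBl addrC addrA subrK.
Qed.

Fact scaleGA a b u : scaleG a (scaleG b u) = scaleG (a * b) u.
Proof.
rewrite -(CreprK a) -(CreprK b) -(GreprK u).
have ma := Cmoderate_repr a; have mb := Cmoderate_repr b.
have mu := Gmoderate_repr u.
rewrite (scaleGE mb mu) (scaleGE ma (Gmoderate_scale mb mu)) -CclassM //.
rewrite scaleGE //; last first.
  have am : Crepr a \in @Cmoderate_pred R by apply/asboolP.
  have bm : Crepr b \in @Cmoderate_pred R by apply/asboolP.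
  by have /asboolP := rpredM am bm.
by congr Gclass; apply/funext => e; apply/funext => x; rewrite mulrA.
Qed.

Fact scale1G : left_id 1 scaleG.
Proof.
move=> u; rewrite -(GreprK u) -Cclass1 scaleGE //.
- by congr Gclass; apply/funext => e; apply/funext => x; rewrite mul1r.
- have /asboolP : (1 : R -> R[i]) \in @Cmoderate_pred R by rewrite rpred1.
  by [].
- exact: Gmoderate_repr.
Qed.

Fact scaleGDr : right_distributive scaleG +%R.
Proof.
move=> a u w; rewrite -(CreprK a) -(GreprK u) -(GreprK w).
have ma := Cmoderate_repr a; have mu := Gmoderate_repr u.
have mw := Gmoderate_repr w.
have muw : Gmoderate (fun e x => Grepr u e x + Grepr w e x).
  have um : Grepr u \in Gmoderate_pred by apply/asboolP.
  have wm : Grepr w \in Gmoderate_pred by apply/asboolP.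
  by have /asboolP := rpredD um wm.
rewrite -GclassD // !scaleGE // -GclassD; try exact: Gmoderate_scale.
by congr Gclass; apply/funext => e; apply/funext => x; rewrite mulrDr.
Qed.

Fact scaleGDl u : {morph scaleG^~ u : a b / a + b}.
Proof.
move=> a b; rewrite -(CreprK a) -(CreprK b) -(GreprK u).
have ma := Cmoderate_repr a; have mb := Cmoderate_repr b.
have mu := Gmoderate_repr u.
rewrite -CclassD // !scaleGE //; last first.
  have am : Crepr a \in @Cmoderate_pred R by apply/asboolP.
  have bm : Crepr b \in @Cmoderate_pred R by apply/asboolP.
  by have /asboolP := rpredD am bm.
rewrite -GclassD; try exact: Gmoderate_scale.
by congr Gclass; apply/funext => e; apply/funext => x; rewrite mulrDl.
Qed.

HB.instance Definition _ := GRing.Zmodule_isLmodule.Build (Cgen R) G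
  scaleGA scale1G scaleGDr scaleGDl.

End GeneralizedFunctions.

Section LocallyConvex.
Variable R : realType.

(* A locally convex topology on the subset lcs_set of M, given by a defining
   family of ultra-pseudo-seminorms, of which only the values on lcs_set
   matter. *)
Record lcs (M : zmodType) := Lcs {
  lcs_set : set M;
  lcs_fam : set (M -> \bar R) }.

(* The filter of neighbourhoods of u in the topology induced by E *)
Definition lcs_nbhs (M : zmodType) (E : lcs M) (u : M) : set_system M :=
  [set A | exists (s : seq (M -> \bar R)) (r : R),
    [/\ {in s, forall P, lcs_fam E P}, 0 < r &
        [set v | lcs_set E v /\ {in s, forall P, (P (v - u)%R < r%:E)%E}]
          `<=` A]].

Definition lcs_continuous (M M' : zmodType) (E : lcs M) (E' : lcs M')
    (f : M -> M') : Prop :=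
  (forall u, lcs_set E u -> lcs_set E' (f u)) /\
  forall u, lcs_set E u -> fmap f (lcs_nbhs E u) `=>` lcs_nbhs E' (f u).

Definition lcs_bounded (M : zmodType) (E : lcs M) (B : set M) : Prop :=
  B `<=` lcs_set E /\
  forall P, lcs_fam E P -> exists C : R, forall u, B u -> (P u <= C%:E)%E.

Definition ultra_pseudo_seminorm (M : lmodType (Cgen R)) (S : set M)
    (P : M -> \bar R) : Prop :=
  [/\ P 0 = 0%E,
      forall u, S u -> (0 <= P u < +oo)%E,
      forall c u, S u -> (P (c *: u)%R <= Cabs c * P u)%E &
      forall u v, S u -> S v -> (P (u + v)%R <= maxe (P u) (P v))%E].

(* The finest locally convex topology on S making the inclusions of the E i,
   i in D, continuous: it is defined by all the ultra-pseudo-seminorms that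
   generate, each on its own, a topology with this property (see
   lcs_indlim_incl and lcs_indlim_finest). *)
Definition lcs_indlim (M : lmodType (Cgen R)) (S : set M)
    (I : Type) (D : set I) (E : I -> lcs M) : lcs M :=
  Lcs S [set P | ultra_pseudo_seminorm S P /\
    forall i, D i -> lcs_continuous (E i) (Lcs S [set P]) id].

Lemma lcs_continuous_sup (M M' : zmodType) (E : lcs M) (S : set M')
    (F : set (M' -> \bar R)) (f : M -> M') :
  (forall u, lcs_set E u -> S (f u)) ->
  (forall P, F P -> lcs_continuous E (Lcs S [set P]) f) ->
  lcs_continuous E (Lcs S F) f.
Proof.
move=> fS cf; split=> // u Eu A [s [r [sF r0 sA]]].
elim: s A sF sA => [|P s IH] A sF sA.
  exists [::], 1; split=> // v [Ev _]; apply: sA; split=> //; exact: fS.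
have [s1 [r1 [s1E r10 s1A]]] := IH
  [set v | S v /\ {in s, forall Q, (Q (v - f u)%R < r%:E)%E}]
  (fun Q Qs => sF Q (mem_behead (s := P :: s) Qs)) (fun v => id).
have : lcs_nbhs (Lcs S [set P]) (f u) [set v | S v /\ (P (v - f u)%R < r%:E)%E].
  exists [:: P], r; split=> // [Q|v [Sv /(_ P (mem_head _ _))]] //.
  by rewrite inE => /eqP ->.
move=> /((cf P (sF P (mem_head _ _))).2 u Eu) [s2 [r2 [s2E r20 s2A]]].
exists (s1 ++ s2), (Num.min r1 r2); split.
- by move=> Q; rewrite mem_cat => /orP[/s1E|/s2E].
- by rewrite lt_min r10 r20.
- move=> v [Ev vlt].
  have [Sv h1] : [set v | S v /\ {in s, forall Q, (Q (v - f u)%R < r%:E)%E}] (f v).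
    apply: s1A; split=> // Q Qs; have := vlt Q.
    rewrite mem_cat Qs => /(_ isT) /lt_le_trans; apply.
    by rewrite lee_fin ge_min lexx.
  have [_ h2] : [set v | S v /\ (P (v - f u)%R < r%:E)%E] (f v).
    apply: s2A; split=> // Q Qs; have := vlt Q.
    rewrite mem_cat Qs orbT => /(_ isT) /lt_le_trans; apply.
    by rewrite lee_fin ge_min lexx orbT.
  by apply: sA; split=> // Q; rewrite inE => /orP[/eqP ->|/h1].
Qed.

Lemma lcs_indlim_incl (M : lmodType (Cgen R)) (S : set M) (I : Type)
    (D : set I) (E : I -> lcs M) i :
  (forall i, D i -> lcs_set (E i) `<=` S) -> D i ->
  lcs_continuous (E i) (lcs_indlim S D E) id.
Proof.
move=> ES Di; apply: lcs_continuous_sup => [u|P [_]]; first exact: ES.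
exact.
Qed.

Lemma lcs_indlim_finest (M : lmodType (Cgen R)) (S : set M) (I : Type)
    (D : set I) (E : I -> lcs M) (F : set (M -> \bar R)) :
  (forall P, F P -> ultra_pseudo_seminorm S P) ->
  (forall i, D i -> lcs_continuous (E i) (Lcs S F) id) ->
  lcs_continuous (lcs_indlim S D E) (Lcs S F) id.
Proof.
move=> FS cF; apply: lcs_continuous_sup => // P FP.
apply: (@lcs_continuous_sup _ _ (lcs_indlim S D E) S [set P] id) => // Q ->.
split=> // u Su A [s [r [sF r0 sA]]]; exists s, r; split=> //.
move=> Q' /sF ->; split; first exact: FS.
move=> i Di; have [h1 h2] := cF i Di; split=> // v Ev B [s' [r' [s'F r'0 s'B]]].
apply: h2 => //; exists s', r'; split=> // Q'' /s'F ->.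
exact: FP.
Qed.

End LocallyConvex.

Section Spaces.
Variables (R : realType) (n : nat) (Om : openset R n).
Implicit Types (u : G Om) (K L : set 'rV[R]_n) (v : R -> 'rV[R]_n -> R[i]).

Definition Gsupp u : set 'rV[R]_n :=
  [set x | openset_val Om x /\
    ~ exists U, [/\ open U, U x, U `<=` Om & Gnegligible U (Grepr u)]].

Definition Gseminorm K (j : nat) u : \bar R :=
  expeR (- valuation (fun e => supDle K j (Grepr u e))).

Definition Ginf_seminorm K u : \bar R :=
  expeR (- ereal_sup [set b%:E | b in
    [set b | forall a, bigOpow (fun e => supD K a (Grepr u e)) b]]).

Definition lcs_G : lcs R (G Om) :=
  Lcs setT [set P | exists K j,
    [/\ compact K, K `<=` Om & P = Gseminorm K j]].

Definition Ginf : set (G Om) :=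
  [set u | exists v, [/\ Gmoderate Om v, Gclass Om v = u &
    forall K, compact K -> K `<=` Om -> exists N : nat, forall a,
      bigOpow (fun e => supD K a (v e)) (- N%:R)]].

Definition lcs_Ginf : lcs R (G Om) :=
  Lcs Ginf [set P | exists K,
    [/\ compact K, K `<=` Om & P = Ginf_seminorm K]].

(* v is a representative of u whose components vanish off a common compact *)
Definition Gc_repr u v : Prop :=
  [/\ Gmoderate Om v, Gclass Om v = u &
    exists K, [/\ compact K, K `<=` Om &
      forall e x, 0 < e <= 1 -> openset_val Om x -> ~ K x -> v e x = 0]].

Definition Gc : set (G Om) := [set u | exists v, Gc_repr u v].

Definition Ginfc : set (G Om) := Ginf `&` Gc.

Definition lcs_GK K : lcs R (G Om) :=
  Lcs [set u | Gc u /\ Gsupp u `<=` K]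
      [set P | exists K' j, [/\ compact K', K' `<=` Om, K `<=` interior K' &
                                P = Gseminorm K' j]].

Definition lcs_GinfK K : lcs R (G Om) :=
  Lcs [set u | Ginfc u /\ Gsupp u `<=` K]
      [set P | exists K', [/\ compact K', K' `<=` Om, K `<=` interior K' &
                              P = Ginf_seminorm K']].

Definition lcs_Gc : lcs R (G Om) :=
  lcs_indlim Gc [set K | compact K /\ K `<=` Om] lcs_GK.

Definition lcs_Ginfc : lcs R (G Om) :=
  lcs_indlim Ginfc [set K | compact K /\ K `<=` Om] lcs_GinfK.

End Spaces.

Section Duals.
Variables (R : realType) (n : nat) (Om : openset R n).
Local Notation functional := (G Om -> Cgen R).
Implicit Types (T : functional) (K : set 'rV[R]_n).

Definition lcs_C : lcs R (Cgen R) := Lcs setT [set (@Cabs R)].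

(* Functionals on the space E are maps on the whole of G(Om), of which only
   the values on lcs_set E matter. *)
Definition dual (E : lcs R (G Om)) : set functional :=
  [set T | (forall c u v, lcs_set E u -> lcs_set E v ->
              T (c *: u + v) = c * T u + T v) /\
           lcs_continuous E lcs_C T].

(* The subspace S of functionals on E, with the topology of uniform
   convergence on the bounded subsets of E *)
Definition lcs_dual (E : lcs R (G Om)) (S : set functional) :
    lcs R (functional : zmodType) :=
  Lcs S [set P | exists B, lcs_bounded E B /\
                           P = fun T => nnsup [set Cabs (T u) | u in B]].

Local Notation test := ('rV[R]_n -> R[i]).

(* D_K(Om), as functions on Om *)
Definition testK K (f : test) : Prop :=
  smooth Om f /\ forall x, openset_val Om x -> ~ K x -> f x = 0.

Definition distr_compact (T : test -> R[i]) : Prop :=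
  (forall c f g, smooth Om f -> smooth Om g ->
     T (fun x => c * f x + g x) = c * T f + T g) /\
  exists K j C, [/\ compact K, K `<=` Om & forall f, smooth Om f ->
    ((normc (T f))%:E <= C%:E * supDle K j f)%E].

Definition distr (T : test -> R[i]) : Prop :=
  forall K, compact K -> K `<=` Om ->
    (forall c f g, testK K f -> testK K g ->
       T (fun x => c * f x + g x) = c * T f + T g) /\
    exists j C, forall f, testK K f ->
      ((normc (T f))%:E <= C%:E * supDle K j f)%E.

Definition basic_G : set functional :=
  [set T | dual (lcs_G Om) T /\
    exists Te : R -> test -> R[i],
    [/\ forall e, 0 < e <= 1 -> distr_compact (Te e),
        exists K (j N : nat) (eta : R),
          [/\ compact K, K `<=` Om, 0 < eta <= 1 &
              forall f e, smooth Om f -> 0 < e <= eta ->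
              ((normc (Te e f))%:E <= (e `^ (- N%:R))%:E * supDle K j f)%E] &
        forall v, Gmoderate Om v ->
          T (Gclass Om v) = Cclass (fun e => Te e (v e))]].

Definition basic_Gc : set functional :=
  [set T | dual (lcs_Gc Om) T /\
    exists Te : R -> test -> R[i],
    [/\ forall e, 0 < e <= 1 -> distr (Te e),
        forall K, compact K -> K `<=` Om -> exists (j N : nat) (eta : R),
          0 < eta <= 1 /\
          forall f e, testK K f -> 0 < e <= eta ->
            ((normc (Te e f))%:E <= (e `^ (- N%:R))%:E * supDle K j f)%E &
        forall u v, Gc_repr u v -> T u = Cclass (fun e => Te e (v e))]].

Definition Lb_G := lcs_dual (lcs_G Om) basic_G.
Definition Lb_Gc := lcs_dual (lcs_Gc Om) basic_Gc.

End Duals.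

Section Integration.
Variable R : realType.

(* The integral over R^n, as an iterated Lebesgue integral; it is only applied
   to functions which are C^oo_c once extended by 0. *)
Fixpoint integralRn (n : nat) : ('rV[R]_n -> R) -> R :=
  match n with
  | 0 => fun f => f 0
  | m.+1 => fun f => (\int[@lebesgue_measure R]_t
      integralRn (fun y : 'rV[R]_m => f (row_mx (t%:M : 'rV[R]_1) y)))%R
  end.

Definition integral_on (n : nat) (Om : set 'rV[R]_n) (f : 'rV[R]_n -> R[i]) :
    R[i] :=
  let g := patch (fun=> 0) Om f in
  integralRn (@complex.Re R \o g) +i* integralRn (@complex.Im R \o g).

End Integration.

Section Operators.
Variables (R : realType) (n : nat) (Om : openset R n).

Fact open_prod : open [set z : 'rV[R]_(n + n) | openset_val Om (lsubmx z) /\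
                                       openset_val Om (rsubmx z)].
Proof.
apply: openI.
  by apply: open_comp (opensetP Om) => z _; exact: continuous_lsubmx.
by apply: open_comp (opensetP Om) => z _; exact: continuous_rsubmx.
Qed.

(* Om x Om, with (x, y) encoded as row_mx x y *)
Definition Omsq : openset R (n + n) := OpenSet open_prod.

(* Some representative of u in G_c(Om) vanishing off a common compact *)
Definition Gc_choose (u : G Om) : R -> 'rV[R]_n -> R[i] := xget 0 (Gc_repr u).

(* [(int_Om w_e(x) u_e(x) dx)_e], for w in G(Om) and u in G_c(Om) *)
Definition pairing (w u : G Om) : Cgen R :=
  Cclass (fun e => integral_on Om (fun x => Grepr w e x * Gc_choose u e x)).

Definition kernel_action (k : G Omsq) (u : G Om) : G Om :=
  Gclass Om (fun e x =>
    integral_on Om (fun y => Grepr k e (row_mx x y) * Gc_choose u e y)).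

Definition kernel_transpose (k : G Omsq) (u : G Om) : G Om :=
  Gclass Om (fun e y =>
    integral_on Om (fun x => Grepr k e (row_mx x y) * Gc_choose u e x)).

(* Operators G_c(Om) -> G(Om) with generalized kernel; only the values of
   op_fun on G_c(Om) matter. *)
Record kernel_operator := KernelOperator {
  op_fun :> G Om -> G Om;
  op_kernel : G Omsq;
  op_funE : forall u, Gc u -> op_fun u = kernel_action op_kernel u }.

Definition op_transpose (A : kernel_operator) : G Om -> G Om :=
  kernel_transpose (op_kernel A).

(* The action of A on functionals; A T is a functional on G_c(Om) *)
Definition op_dual (A : kernel_operator) (T : G Om -> Cgen R) : G Om -> Cgen R :=
  fun u => T (op_transpose A u).

Definition proper_subset (V : set 'rV[R]_(n + n)) : Prop :=
  forall K, compact K -> K `<=` Om ->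
    (exists L, [/\ compact L, L `<=` Om &
       rsubmx @` (V `&` [set z | K (lsubmx z)]) `<=` L]) /\
    (exists L, [/\ compact L, L `<=` Om &
       lsubmx @` (V `&` [set z | K (rsubmx z)]) `<=` L]).

Definition properly_supported (A : kernel_operator) : Prop :=
  proper_subset (Gsupp (op_kernel A)).

(* A maps the space D of functionals into the space F of generalized functions
   with continuity: A T is the functional u |-> int w u dx given by an element
   w = Phi T of F, and Phi is continuous. *)
Definition maps_dual_continuously (A : kernel_operator)
    (D : lcs R (G Om -> Cgen R : zmodType)) (F : lcs R (G Om)) : Prop :=
  exists Phi : (G Om -> Cgen R) -> G Om,
    (forall T, lcs_set D T -> forall u, Gc u ->
       op_dual A T u = pairing (Phi T) u) /\
    lcs_continuous D F Phi.

End Operators.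

(* Main.v *)
(* Let kap be a net representing the kernel and let the net (T_e) represent the
   basic functional T. The net w_e(x) = T_e(kap_e(x, .)) is smooth in x, with
   derivatives T_e(d_x^s kap_e(x, .)), and Fubini's theorem gives
   T(tR u) = [int w_e u_e dx], so that RT is the class of w. The supremum over K
   of |d^s w_e| is, up to a factor 2, attained at some x_e in K, that is, it is
   the value of T on the net d_x^s kap_e(x_e, .). Such slices of the kernel form
   bounded sets, hence the seminorms of RT are bounded by those of T.
   If the kernel is properly supported, multiplying kap by a proper cutoff
   function equal to 1 near its support makes every slice compactly supported,
   which gives the results for functionals on G_c. For the continuity into the
   inductive limit G_c one decomposes w along a partition of unity (chi_m). Since
   only finitely many of the kernels chi_m(x) kap(x, y) are nonzero for y in a
   given compact set, the union over m of suitable multiples of their slices is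
   still bounded in G. *)

From mathcomp Require Import all_boot all_order all_algebra.
From mathcomp Require Import ring_quotient complex.
From mathcomp Require Import all_classical all_reals all_analysis.
From mathcomp Require Import ring lra.
Require Import Defs.
Import Order.TTheory GRing.Theory Num.Theory numFieldNormedType.Exports.
Import ComplexField.Normc.

Set Implicit Arguments.
Unset Strict Implicit.
Unset Printing Implicit Defensive.

Local Open Scope classical_set_scope.
Local Open Scope ring_scope.
Local Open Scope complex_scope.

(** * Mixed partial derivatives *)

(** Every functional enters the analysis only through [bounded_functional]: linearity and one
    estimate of finite order. Integrals over segments and boxes satisfy it too, so a single theorem
    on differentiation under a functional serves the kernels, the iterated integrals and Fubini's
    theorem. The obstacle is the inductive limit topology of G_c, which is known only through
    arbitrary ultra-pseudo-seminorms P. On elements supported in a fixed compact set, P is small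
    once finitely many explicit seminorms lie below some radius, but this radius varies with the
    compact set without any uniformity. Hence the multiples of slices: the slices of the m-th kernel
    are rescaled by a power of the parameter chosen from the m-th radius. The pieces of w need not
    be summable, because P is ultrametric: a common strict bound on all pieces is a bound on their
    finite sum. The sum is finite because a functional on G is carried by a compact set and the
    kernel is proper. *)

Section DirectionalCalculus.
Variables (R : realType) (V : normedModType R).
Implicit Types (f g : V -> R) (v w x : V) (h t : R).

Lemma is_derive_line f v x t : derivable f (x + t *: v) v ->
  is_derive t 1 (fun s : R => f (x + s *: v)) ('D_v f (x + t *: v)).
Proof.
move=> df.
have E : (fun s : R => s^-1 *: ((fun s : R => f (x + s *: v)) (s *: 1 + t) - f (x + t *: v)))
  = (fun s : R => s^-1 *: (f (s *: v + (x + t *: v)) - f (x + t *: v))).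
  apply/funext => s /=; congr (_ *: (f _ - _)).
  by rewrite [_ *: 1]mulr1 scalerDl addrCA.
by apply: DeriveDef; rewrite /derivable/derive E.
Qed.

Lemma mvt_line f v x h : 0 <= h ->
  (forall t, 0 <= t <= h -> derivable f (x + t *: v) v) ->
  exists2 t, 0 <= t <= h & f (x + h *: v) - f x = h * 'D_v f (x + t *: v).
Proof.
move=> h0 df.
have dl s : s \in `]0, h[ ->
    is_derive s 1 (fun s : R => f (x + s *: v)) ('D_v f (x + s *: v)).
  by move=> sh; apply/is_derive_line/df; rewrite !ltW ?(itvP sh).
have [|t th E] := MVT_segment h0 dl; last first.
  exists t; first by rewrite !(itvP th).
  by move: E; rewrite scale0r addr0 subr0 mulrC.
apply: derivable_within_continuous => s; rewrite in_itv /= => sh.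
by have /is_derive_line [] := df s sh.
Qed.

Lemma mvt_line_norm f v x h :
  (forall t, `|t| <= `|h| -> derivable f (x + t *: v) v) ->
  exists2 t, `|t| <= `|h| & f (x + h *: v) - f x = h * 'D_v f (x + t *: v).
Proof.
move=> df; have [h0|h0] := leP 0 h.
  have [|t th E] := @mvt_line f v x h h0.
    by move=> t /andP[t0 th]; apply: df; rewrite !ger0_norm.
  by exists t => //; case/andP: th => t0 th; rewrite !ger0_norm.
have h0' : 0 <= - h by lra.
(* For h < 0, start from the other end point and move forward by - h. *)
have [|t th E] := @mvt_line f v (x + h *: v) (- h) h0'.
  move=> t th; rewrite -addrA -scalerDl; apply: df.
  rewrite (ltr0_norm h0) ler_norml; lra.
exists (h + t); first by rewrite (ltr0_norm h0) ler_norml; lra.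
move: E; rewrite scaleNr addrK -[x + h *: v + t *: v]addrA -scalerDl => E.
by rewrite -[LHS]opprB E mulNr opprK.
Qed.

Lemma ball_close (g1 g2 : V -> R) (U : set V) x (e : R) : open U -> U x ->
  {for x, continuous g1} -> {for x, continuous g2} -> 0 < e ->
  exists2 r : R, 0 < r & forall y, ball x r y ->
    [/\ U y, `|g1 x - g1 y| <= e & `|g2 x - g2 y| <= e].
Proof.
move=> oU Ux c1 c2 e0.
have /cvgr_dist_le /(_ _ e0) n1 := c1.
have /cvgr_dist_le /(_ _ e0) n2 := c2.
have nU : \forall y \near x, U y by exact: open_nbhs_nbhs.
have /nbhs_ballP [r /= r0 hr] : nbhs x (U `&`
  ([set t | `|g1 x - g1 t| <= e] `&` [set t | `|g2 x - g2 t| <= e])).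
  by apply: filterI => //; exact: filterI.
by exists r => // y /hr [? [? ?]].
Qed.

(** Two mean value theorems: along v for the increment y |-> f (y + h w) - f y, then along w for the
    derivative [fv]. *)
Lemma mixed_difference f (fv fvw : V -> R) v w x h : 0 <= h ->
  (forall s t : R, 0 <= s <= h -> 0 <= t <= h ->
     is_derive (x + s *: v + t *: w) v f (fv (x + s *: v + t *: w)) /\
     is_derive (x + s *: v + t *: w) w fv (fvw (x + s *: v + t *: w))) ->
  exists s t : R, [/\ 0 <= s <= h, 0 <= t <= h &
    f (x + h *: v + h *: w) - f (x + h *: v) - f (x + h *: w) + f x =
    h * (h * fvw (x + s *: v + t *: w))].
Proof.
move=> h0 df.
have hh : 0 <= h <= h by rewrite lexx h0.
have oh : 0 <= (0:R) <= h by rewrite lexx h0.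
pose g y := f (y + h *: w) - f y.
have dg (s : R) : 0 <= s <= h -> is_derive (x + s *: v) v g
    (fv (x + s *: v + h *: w) - fv (x + s *: v)).
  move=> sh; apply: is_deriveB; last first.
    by have := (df s 0 sh oh).1; rewrite scale0r addr0.
  have [d1 d2] := (df s h sh hh).1.
  have E : (fun r : R => r^-1 *: ((fun y => f (y + h *: w)) (r *: v + (x + s *: v))
        - f (x + s *: v + h *: w)))
    = (fun r : R => r^-1 *: (f (r *: v + (x + s *: v + h *: w)) - f (x + s *: v + h *: w))).
    by apply/funext => r; rewrite !addrA.
  by apply: DeriveDef; rewrite /derivable/derive E.
have [|s sh E] := @mvt_line g v x h h0.
  by move=> s /dg [].
have [|t th E2] := @mvt_line fv w (x + s *: v) h h0.
  by move=> t th; have [] := (df s t sh th).2.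
exists s, t; split => //.
have [_ <-] := (df s t sh th).2; rewrite -E2; have [_ <-] := dg s sh.
by rewrite -E /g; ring.
Qed.

(** The second difference over a small parallelogram is symmetric in v and w. By [mixed_difference]
    it is h^2 times a value of [fvw], and also h^2 times a value of [fwv], both near x; continuity
    at x concludes. *)
Lemma schwarz f (fv fw fvw fwv : V -> R) v w x (U : set V) : open U -> U x ->
  (forall y, U y -> is_derive y v f (fv y)) ->
  (forall y, U y -> is_derive y w f (fw y)) ->
  (forall y, U y -> is_derive y w fv (fvw y)) ->
  (forall y, U y -> is_derive y v fw (fwv y)) ->
  {for x, continuous fvw} -> {for x, continuous fwv} ->
  fvw x = fwv x.
Proof.
move=> oU Ux d1 d2 d3 d4 c1 c2; apply/eqP; rewrite -subr_eq0 -normr_eq0.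
apply/eqP/le_anti; rewrite normr_ge0 andbT.
suff H (e : R) : 0 < e -> `|fvw x - fwv x| <= e.
  by apply/ler_addgt0Pr => e; rewrite add0r; exact: H.
move=> e0.
have e20 : 0 < e / 2 by rewrite divr_gt0.
have [r r0 hr] := ball_close oU Ux c1 c2 e20.
(* Since h N = r / 2, the parallelogram with sides h v and h w stays inside the ball of radius r. *)
pose N : R := `|v| + `|w| + 1.
have N0 : 0 < N by rewrite ltr_wpDl.
pose h : R := r / 2 / N.
have h0 : 0 < h by rewrite !divr_gt0.
have hb (s t : R) : 0 <= s <= h -> 0 <= t <= h -> ball x r (x + s *: v + t *: w).
  move=> /andP[s0 sh] /andP[t0 th].
  rewrite -ball_normE /ball_ /= -addrA opprD addrA subrr add0r normrN.
  apply: (@le_lt_trans _ _ (h * N)).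
    rewrite (le_trans (ler_normD _ _)) // !normrZ !ger0_norm //.
    have := ler_wpM2r (normr_ge0 v) sh; have := ler_wpM2r (normr_ge0 w) th.
    rewrite /N; nra.
  rewrite /h divfK ?gt_eqF //; lra.
have [|s [t [sh th E1]]] := @mixed_difference f fv fvw v w x h (ltW h0).
  by move=> s t sh th; have [Uy _ _] := hr _ (hb _ _ sh th); split; [exact: d1 | exact: d3].
have hb' (a b : R) : 0 <= a <= h -> 0 <= b <= h -> ball x r (x + a *: w + b *: v).
  by move=> ah bh; rewrite -addrA [a *: w + _]addrC addrA; exact: hb.
have [|s' [t' [sh' th' E2]]] := @mixed_difference f fw fwv w v x h (ltW h0).
  by move=> s' t' sh' th'; have [Uy _ _] := hr _ (hb' _ _ sh' th'); split; [exact: d2 | exact: d4].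
have [_ b1 _] := hr _ (hb _ _ sh th).
have [_ _ b2] := hr _ (hb' _ _ sh' th').
have E : fvw (x + s *: v + t *: w) = fwv (x + s' *: w + t' *: v).
  have hne : h != 0 by rewrite gt_eqF.
  apply: (mulfI hne); apply: (mulfI hne); rewrite -E1 -E2.
  by rewrite -[x + h *: w + h *: v]addrA [h *: w + _]addrC addrA; ring.
rewrite E in b1.
apply: (le_trans (ler_distD (fwv (x + s' *: w + t' *: v)) _ _)).
by rewrite [e]splitr lerD // distrC.
Qed.

End DirectionalCalculus.

(** * Smooth functions *)

Lemma near_eq_continuous (T U : topologicalType) (f g : T -> U) (x : T) :
  {near x, f =1 g} -> {for x, continuous f} -> {for x, continuous g}.
Proof.
move=> fg cf; rewrite /prop_for /continuous_at -(nbhs_singleton fg).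
exact: cvg_trans (near_eq_cvg fg) cf.
Qed.

Section RealSmooth.
Variables (R : realType) (n : nat).
Implicit Types (Om U W : set 'rV[R]_n) (f g : 'rV[R]_n -> R) (s : seq 'I_n).

Local Notation ee i := (delta_mx 0 i : 'rV[R]_n).

Lemma Dseq_cat s1 s2 f : Dseq (s1 ++ s2) f = Dseq s1 (Dseq s2 f).
Proof. by elim: s1 => //= i s1 ->. Qed.

Lemma smoothR_Dseq Om f s : smoothR Om f -> smoothR Om (Dseq s f).
Proof. by move=> sf s' x Ox; rewrite -Dseq_cat; exact: sf. Qed.

Lemma smoothR_sub Om U f : U `<=` Om -> smoothR Om f -> smoothR U f.
Proof. by move=> UOm sf s x /UOm; exact: sf. Qed.

Lemma smoothR_is_derive Om f s i x : smoothR Om f -> Om x ->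
  is_derive x (ee i) (Dseq s f) (Dseq (i :: s) f x).
Proof. by move=> sf Ox; apply: derivableP; exact: (sf s x Ox).2. Qed.

Lemma smoothR_continuous Om f s x : smoothR Om f -> Om x ->
  {for x, continuous (Dseq s f)}.
Proof. by move=> sf Ox; exact: (sf s x Ox).1. Qed.

(** The standard way to smoothness below: guess all iterated derivatives at once. The guess agrees
    with [Dseq] on Om by induction on s, since derivatives are local and Om is open. *)
Lemma smoothR_family Om (D : seq 'I_n -> 'rV[R]_n -> R) : open Om ->
  (forall s x, Om x -> {for x, continuous (D s)}) ->
  (forall s i x, Om x -> is_derive x (ee i) (D s) (D (i :: s) x)) ->
  smoothR Om (D [::]) /\ forall s x, Om x -> Dseq s (D [::]) x = D s x.
Proof.
move=> oOm cD dD.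
have E s x : Om x -> Dseq s (D [::]) x = D s x.
  elim: s x => [//|i s IH] x Ox /=.
  rewrite (@near_eq_derive _ _ _ _ (D s) x (ee i)).
    by have [_ ->] := dD s i x Ox.
  near=> y; apply: IH; near: y; exact: open_nbhs_nbhs.
split=> // s x Ox.
have nE : {near x, D s =1 Dseq s (D [::])}.
  near=> y; rewrite E //; near: y; exact: open_nbhs_nbhs.
split=> [|i].
  exact: near_eq_continuous nE (cD s x Ox).
by apply: near_eq_derivable nE _; have [] := dD s i x Ox.
Unshelve. all: by end_near. Qed.

(** Functions are total, with irrelevant values off Om. The family used differs from the derivatives
    of f only at the empty sequence, where it is g. *)
Lemma smoothR_congr Om f g : open Om -> (forall x, Om x -> f x = g x) ->
  smoothR Om f -> smoothR Om g /\ forall s x, Om x -> Dseq s g x = Dseq s f x.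
Proof.
move=> oOm fg sf.
pose D s x := if s is [::] then g x else Dseq s f x.
have DE s x : Om x -> D s x = Dseq s f x by case: s => //= /fg.
have nE s x : Om x -> {near x, Dseq s f =1 D s}.
  move=> Ox; near=> y; rewrite DE //; near: y; exact: open_nbhs_nbhs.
have [|s i x Ox|sg Dg] := @smoothR_family Om D oOm.
- move=> s x Ox.
  exact: near_eq_continuous (nE s x Ox) (smoothR_continuous sf Ox).
- apply: near_eq_is_derive (nE s x Ox) _.
  exact: smoothR_is_derive sf Ox.
- by split=> // s x Ox; rewrite Dg // DE.
Unshelve. all: by end_near. Qed.

Lemma smoothR_local W f :
  (forall x, W x -> exists U, exists2 g, [/\ open U, U x & smoothR U g] &
     forall y, U y -> f y = g y) -> smoothR W f.
Proof.
move=> H s x /H [U [g [oU Ux sg] fg]].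
by have [sf _] := smoothR_congr oU (fun y Uy => esym (fg y Uy)) sg; exact: sf.
Qed.

Lemma smoothR0 Om : open Om -> smoothR Om (fun=> 0) /\ 
  forall s x, Om x -> Dseq s (fun=> 0 : R) x = 0.
Proof.
move=> oOm.
apply: (@smoothR_family Om (fun _ _ => 0)) => // s x Ox.
exact: cst_continuous.
Qed.

Lemma Dseq_eq0 Om f s x : open Om -> (forall y, Om y -> f y = 0) -> Om x ->
  Dseq s f x = 0.
Proof.
move=> oOm f0 Ox; have [s0 D0] := smoothR0 oOm.
have [_ ->] // := smoothR_congr oOm (fun y Oy => esym (f0 y Oy)) s0.
exact: D0.
Qed.

Lemma Dseq_swap Om f x i j s : open Om -> smoothR Om f -> Om x ->
  Dseq (i :: j :: s) f x = Dseq (j :: i :: s) f x.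
Proof.
move=> oOm sf Ox.
apply: (@schwarz R 'rV[R]_n (Dseq s f) (Dseq (j :: s) f) (Dseq (i :: s) f)
   _ _ (ee j) (ee i) x Om) => //.
- by move=> y Oy; exact: smoothR_is_derive sf Oy.
- by move=> y Oy; exact: smoothR_is_derive sf Oy.
- by move=> y Oy; exact: smoothR_is_derive sf Oy.
- by move=> y Oy; exact: smoothR_is_derive sf Oy.
- exact: smoothR_continuous sf Ox.
- exact: smoothR_continuous sf Ox.
Qed.

Lemma Dseq_cons_congr Om f g i s s' x : open Om ->
  (forall y, Om y -> Dseq s f y = Dseq s' g y) ->
  Om x -> Dseq (i :: s) f x = Dseq (i :: s') g x.
Proof.
move=> oOm fg Ox; apply: near_eq_derive; near=> y; apply: fg.
by near: y; exact: open_nbhs_nbhs.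
Unshelve. all: by end_near. Qed.

Lemma Dseq_perm Om f s s' x : open Om -> smoothR Om f -> perm_eq s s' ->
  Om x -> Dseq s f x = Dseq s' f x.
Proof.
move=> oOm sf.
(* Adjacent transpositions, given by [Dseq_swap], bring i to the front. *)
have front i a b y : Om y -> Dseq (a ++ i :: b) f y = Dseq (i :: a ++ b) f y.
  elim: a y => [//|j a IH] y Oy; rewrite cat_cons.
  transitivity (Dseq (j :: i :: a ++ b) f y).
    exact: (Dseq_cons_congr _ oOm IH Oy).
  exact: (Dseq_swap _ _ _ oOm sf Oy).
elim: s s' x => [|i s IH] s' x ss' Ox.
  by rewrite perm_sym in ss'; rewrite (perm_nilP ss').
have s'i : i \in s' by rewrite -(perm_mem ss') mem_head.
case/splitPr: s'i ss' => a b ss'.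
rewrite front //; apply: (Dseq_cons_congr _ oOm) => // y Oy; apply: IH => //.
by move: ss'; rewrite perm_sym perm_catC /= perm_cons perm_catC perm_sym.
Qed.

End RealSmooth.

Section ComplexNorm.
Variable R : realType.
Implicit Types z w : R[i].

Lemma normc_Re z : `|complex.Re z| <= normc z.
Proof. case: z => a b /=; rewrite -[`|a|]sqrtr_sqr; apply: ler_wsqrtr.
by rewrite lerDl sqr_ge0. Qed.

Lemma normc_Im z : `|complex.Im z| <= normc z.
Proof.
case: z => a b /=; rewrite -[`|b|]sqrtr_sqr; apply: ler_wsqrtr.
by rewrite lerDr sqr_ge0.
Qed.

Lemma normc_le_ReIm z : normc z <= `|complex.Re z| + `|complex.Im z|.
Proof.
case: z => a b /=; rewrite -[leRHS]ger0_norm ?addr_ge0 // -sqrtr_sqr.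
apply: ler_wsqrtr; rewrite sqrrD !real_normK ?num_real //.
by rewrite lerD2r lerDl mulrn_wge0 ?mulr_ge0.
Qed.

Lemma normcB z w : normc (z - w) = normc (w - z).
Proof. by rewrite -normcN opprB. Qed.

Lemma normc_sum (I : Type) (r : seq I) (F : I -> R[i]) :
  normc (\sum_(i <- r) F i) <= \sum_(i <- r) normc (F i).
Proof.
elim: r => [|i r IH]; first by rewrite !big_nil normc0.
by rewrite !big_cons (le_trans (le_normcD _ _)) // lerD2l.
Qed.

Lemma Re_add z w : complex.Re (z + w) = complex.Re z + complex.Re w.
Proof. by case: z w => [a b] [c d]. Qed.
Lemma Im_add z w : complex.Im (z + w) = complex.Im z + complex.Im w.
Proof. by case: z w => [a b] [c d]. Qed.
Lemma Re_opp z : complex.Re (- z) = - complex.Re z.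
Proof. by case: z. Qed.
Lemma Im_opp z : complex.Im (- z) = - complex.Im z.
Proof. by case: z. Qed.
Lemma Re_mul z w : complex.Re (z * w) =
  complex.Re z * complex.Re w - complex.Im z * complex.Im w.
Proof. by case: z w => [a b] [c d]. Qed.
Lemma Im_mul z w : complex.Im (z * w) =
  complex.Re z * complex.Im w + complex.Im z * complex.Re w.
Proof. by case: z w => [a b] [c d]. Qed.
Lemma complex_eta z : z = complex.Re z +i* complex.Im z.
Proof. by case: z. Qed.

Lemma Re_sum (I : Type) (r : seq I) (F : I -> R[i]) :
  complex.Re (\sum_(i <- r) F i) = \sum_(i <- r) complex.Re (F i).
Proof.
by elim: r => [|i r IH]; rewrite ?big_nil ?big_cons // Re_add IH.
Qed.
Lemma Im_sum (I : Type) (r : seq I) (F : I -> R[i]) :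
  complex.Im (\sum_(i <- r) F i) = \sum_(i <- r) complex.Im (F i).
Proof.
by elim: r => [|i r IH]; rewrite ?big_nil ?big_cons // Im_add IH.
Qed.

End ComplexNorm.

(** * Leibniz's rule *)

Section Leibniz.
Variables (R : realType) (n : nat).
Implicit Types (Om U W : set 'rV[R]_n) (f g : 'rV[R]_n -> R) (s : seq 'I_n).

Lemma is_derive_bigsum (V : normedModType R) (I : Type) (r : seq I)
    (F : I -> V -> R) (dF : I -> R) x v :
  (forall i, is_derive x v (F i) (dF i)) ->
  is_derive x v (fun y => \sum_(i <- r) F i y) (\sum_(i <- r) dF i).
Proof.
move=> dFi; elim: r => [|i r IH].
  rewrite big_nil (_ : (fun y => _) = cst 0); first exact: is_derive_cst.
  by apply/funext => y; rewrite big_nil.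
rewrite big_cons (_ : (fun y => _) = F i + (fun y => \sum_(j <- r) F j y)).
  exact: is_deriveD.
by apply/funext => y; rewrite big_cons.
Qed.

Lemma continuous_bigsum (T : topologicalType) (I : Type) (r : seq I)
    (F : I -> T -> R) x :
  (forall i, {for x, continuous (F i)}) ->
  {for x, continuous (fun y => \sum_(i <- r) F i y)}.
Proof.
move=> cF; elim: r => [|i r IH].
  rewrite (_ : (fun y => _) = cst 0); first exact: cst_continuous.
  by apply/funext => y; rewrite big_nil.
rewrite (_ : (fun y => _) = F i + (fun y => \sum_(j <- r) F j y)).
  exact: continuousD.
by apply/funext => y; rewrite big_cons.
Qed.

(* All the ways of distributing the derivations of s over two factors. *)
Fixpoint splits s : seq (seq 'I_n * seq 'I_n) :=
  if s is i :: s' then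
    [seq (i :: p.1, p.2) | p <- splits s'] ++ [seq (p.1, i :: p.2) | p <- splits s']
  else [:: ([::], [::])].

Lemma size_splits s p : p \in splits s -> (size p.1 + size p.2 = size s)%N.
Proof.
elim: s p => [|i s IH] p /=; first by rewrite inE => /eqP ->.
rewrite mem_cat => /orP[] /mapP [q /IH <- ->] /=; first by rewrite addSn.
by rewrite addnS.
Qed.

Lemma smoothRM Om f g : open Om -> smoothR Om f -> smoothR Om g ->
  smoothR Om (fun x => f x * g x) /\
  forall s x, Om x -> Dseq s (fun x => f x * g x) x =
    \sum_(p <- splits s) Dseq p.1 f x * Dseq p.2 g x.
Proof.
move=> oOm sf sg.
have := @smoothR_family R n Om
  (fun s x => \sum_(p <- splits s) Dseq p.1 f x * Dseq p.2 g x) oOm.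
have -> : (fun x => \sum_(p <- splits [::]) Dseq p.1 f x * Dseq p.2 g x) =
   (fun x => f x * g x) by apply/funext => x; rewrite big_seq1.
apply.
  move=> s x Ox; apply: continuous_bigsum => p.
  by apply: continuousM; [exact: smoothR_continuous sf Ox|exact: smoothR_continuous sg Ox].
move=> s i x Ox; rewrite /= big_cat !big_map /= -big_split /=.
apply: is_derive_bigsum => p.
have d1 := smoothR_is_derive p.1 i sf Ox.
have d2 := smoothR_is_derive p.2 i sg Ox.
apply: (is_derive_eq (is_deriveM d1 d2)).
by rewrite addrC /GRing.scale /= [Dseq p.2 g x * _]mulrC.
Qed.

End Leibniz.

(** * Complex-valued smooth functions *)

Section ComplexSmooth.
Variables (R : realType) (n : nat).
Implicit Types (Om U W K : set 'rV[R]_n) (f g : 'rV[R]_n -> R[i]) (s : seq 'I_n).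

Local Notation ee i := (delta_mx 0 i : 'rV[R]_n).
Local Notation Re := (@complex.Re R).
Local Notation Im := (@complex.Im R).

(** Sequences replace multi-indices so that derivatives can be taken one at a time and split between
    variables by concatenation; [DseqC_pderiv] returns to multi-indices. *)
Definition DseqC s f (x : 'rV[R]_n) : R[i] :=
  Dseq s (Re \o f) x +i* Dseq s (Im \o f) x.

Lemma DseqC_nil f x : DseqC [::] f x = f x.
Proof. by rewrite /DseqC /=; case: (f x). Qed.

Lemma smooth_sub Om U f : U `<=` Om -> smooth Om f -> smooth U f.
Proof. by move=> UOm [s1 s2]; split; exact: smoothR_sub UOm _. Qed.

Lemma smooth_DseqC Om f s : smooth Om f -> smooth Om (DseqC s f).
Proof. by move=> [s1 s2]; split; exact: smoothR_Dseq. Qed.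

Lemma smooth_congr Om f g : open Om -> (forall x, Om x -> f x = g x) ->
  smooth Om f -> smooth Om g /\ forall s x, Om x -> DseqC s g x = DseqC s f x.
Proof.
move=> oOm fg [s1 s2].
have [s1' E1] := smoothR_congr oOm
  (fun x Ox => congr1 Re (fg x Ox) : (Re \o f) x = (Re \o g) x) s1.
have [s2' E2] := smoothR_congr oOm
  (fun x Ox => congr1 Im (fg x Ox) : (Im \o f) x = (Im \o g) x) s2.
by split=> // s x Ox; rewrite /DseqC E1 // E2.
Qed.

Lemma smooth_local W f :
  (forall x, W x -> exists U, exists2 g, [/\ open U, U x & smooth U g] &
     forall y, U y -> f y = g y) -> smooth W f.
Proof.
move=> H; split; apply: smoothR_local => x /H [U [g [oU Ux [s1 s2]] fg]];
  exists U.
- by exists (Re \o g) => // y /fg /= ->.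
- by exists (Im \o g) => // y /fg /= ->.
Qed.

Lemma DseqC_eq0 Om f s x : open Om -> (forall y, Om y -> f y = 0) -> Om x ->
  DseqC s f x = 0.
Proof.
by move=> oOm f0 Ox; rewrite /DseqC !(@Dseq_eq0 _ _ Om) // => y Oy /=; rewrite f0.
Qed.

Lemma DseqC_perm Om f s s' x : open Om -> smooth Om f -> perm_eq s s' ->
  Om x -> DseqC s f x = DseqC s' f x.
Proof.
move=> oOm [s1 s2] ss' Ox.
by rewrite /DseqC (Dseq_perm oOm s1 ss' Ox) (Dseq_perm oOm s2 ss' Ox).
Qed.

Lemma DseqC_lin Om f g (c : R[i]) s x : open Om -> smooth Om f ->
  smooth Om g -> Om x ->
  DseqC s (fun y => c * f y + g y) x = c * DseqC s f x + DseqC s g x.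
Proof.
move=> oOm [f1 f2] [g1 g2] Ox; rewrite /DseqC linRe linIm.
have h1 := smoothR_lin (Re c) (- Im c) oOm f1 f2.
have h2 := smoothR_lin (Re c) (Im c) oOm f2 f1.
rewrite (Dseq_lin 1 1 _ oOm h1 g1 Ox) (Dseq_lin 1 1 _ oOm h2 g2 Ox).
rewrite (Dseq_lin _ _ _ oOm f1 f2 Ox) (Dseq_lin _ _ _ oOm f2 f1 Ox) !mul1r mulNr.
by case: c {h1 h2}.
Qed.

Lemma smoothM Om f g : open Om -> smooth Om f -> smooth Om g ->
  smooth Om (fun x => f x * g x) /\
  forall s x, Om x -> DseqC s (fun x => f x * g x) x =
    \sum_(p <- splits s) DseqC p.1 f x * DseqC p.2 g x.
Proof.
move=> oOm [f1 f2] [g1 g2].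
have [a1 b1] := smoothRM oOm f1 g1; have [a2 b2] := smoothRM oOm f2 g2.
have [a3 b3] := smoothRM oOm f1 g2; have [a4 b4] := smoothRM oOm f2 g1.
have ReE : Re \o (fun x => f x * g x) =
  (fun x => 1 * (Re (f x) * Re (g x)) + (-1) * (Im (f x) * Im (g x))).
  by apply/funext => x /=; rewrite Re_mul mul1r mulN1r.
have ImE : Im \o (fun x => f x * g x) =
  (fun x => 1 * (Re (f x) * Im (g x)) + 1 * (Im (f x) * Re (g x))).
  by apply/funext => x /=; rewrite Im_mul !mul1r.
split.
  split; first by rewrite ReE; exact: (smoothR_lin 1 (-1) oOm a1 a2).
  by rewrite ImE; exact: (smoothR_lin 1 1 oOm a3 a4).
move=> s x Ox; rewrite [LHS]/DseqC ReE ImE.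
rewrite (Dseq_lin _ _ _ oOm a1 a2) // (Dseq_lin _ _ _ oOm a3 a4) //.
rewrite b1 // b2 // b3 // b4 // [RHS]complex_eta Re_sum Im_sum.
by congr (_ +i* _); rewrite !mul1r ?mulN1r -?sumrN -big_split /=.
Qed.

Lemma smooth_family Om (D : seq 'I_n -> 'rV[R]_n -> R[i]) : open Om ->
  (forall s x, Om x -> {for x, continuous (Re \o D s)} /\
     {for x, continuous (Im \o D s)}) ->
  (forall s i x, Om x -> is_derive x (ee i) (Re \o D s) (Re (D (i :: s) x)) /\
     is_derive x (ee i) (Im \o D s) (Im (D (i :: s) x))) ->
  smooth Om (D [::]) /\ forall s x, Om x -> DseqC s (D [::]) x = D s x.
Proof.
move=> oOm cD dD.
have [a1 b1] := @smoothR_family R n Om (fun s => Re \o D s) oOm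
  (fun s x Ox => (cD s x Ox).1) (fun s i x Ox => (dD s i x Ox).1).
have [a2 b2] := @smoothR_family R n Om (fun s => Im \o D s) oOm
  (fun s x Ox => (cD s x Ox).2) (fun s i x Ox => (dD s i x Ox).2).
split; first by split.
by move=> s x Ox; rewrite /DseqC b1 // b2 //= -complex_eta.
Qed.

Definition mcount s : {ffun 'I_n -> nat} := [ffun i => count_mem i s].

Lemma size_mseq (a : {ffun 'I_n -> nat}) : size (mseq a) = mdeg a.
Proof.
rewrite /mseq /mdeg size_flatten /shape -map_comp sumnE big_map big_enum /=.
by apply: eq_bigr => i _; rewrite size_nseq.
Qed.

Lemma perm_mseq s : perm_eq s (mseq (mcount s)).
Proof.
apply/allP => i _ /=; apply/eqP.
rewrite /mseq count_flatten -map_comp sumnE big_map big_enum /=.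
rewrite (bigD1 i) //= big1 ?addn0 => [|j ji].
  by rewrite count_nseq /= eqxx mul1n ffunE.
by rewrite count_nseq /= (negbTE ji).
Qed.

Lemma mdeg_mcount s : mdeg (mcount s) = size s.
Proof. by rewrite -size_mseq -(perm_size (perm_mseq s)). Qed.

Lemma DseqC_pderiv Om f s x : open Om -> smooth Om f -> Om x ->
  DseqC s f x = pderiv (mcount s) f x.
Proof. by move=> oOm sf Ox; exact: (DseqC_perm oOm sf (perm_mseq s) Ox). Qed.

Lemma supDle_le K j f (M : R) : 0 <= M ->
  (forall x s, K x -> (size s <= j)%N -> normc (DseqC s f x) <= M) ->
  (supDle K j f <= M%:E)%E.
Proof.
move=> M0 H; apply: nnsup_le => [|_ [[x a] [/= Kx aj] <-]]; first by rewrite lee_fin.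
by rewrite lee_fin; apply: H => //; rewrite size_mseq.
Qed.

Lemma supDle_ub Om K j f x s : open Om -> K `<=` Om -> smooth Om f -> K x ->
  (size s <= j)%N -> ((normc (DseqC s f x))%:E <= supDle K j f)%E.
Proof.
move=> oOm KOm sf Kx sj; apply: nnsup_ub; exists (x, mcount s).
  by split => //=; rewrite mdeg_mcount.
by rewrite (DseqC_pderiv s oOm sf (KOm _ Kx)).
Qed.

End ComplexSmooth.

(** * Functionals of functions depending on a parameter *)

Lemma continuous_pair (T U V : topologicalType) (f : T -> U) (g : T -> V) x :
  {for x, continuous f} -> {for x, continuous g} ->
  {for x, continuous (fun z => (f z, g z))}.
Proof. by move=> cf cg A; apply: cvg_pair. Qed.

Section Families.
Variable R : realType.

(** Differentiability as an error bound relative to |h|, free of quotients: the form in which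
    estimates through a functional arrive. *)
Lemma is_derive_approx (V : normedModType R) (g : V -> R) (x v : V) (d : R) :
  (forall eps : R, 0 < eps -> \forall h \near (0 : R),
     `|g (x + h *: v) - g x - h * d| <= eps * `|h|) ->
  is_derive x v g d.
Proof.
move=> H.
suff C : (fun h : R => h^-1 *: (g (h *: v + x) - g x)) @ 0^' --> d.
  apply: DeriveDef; last exact: cvg_lim C.
  by apply/cvg_ex; exists d.
apply/cvgrPdist_le => eps e0.
have := H eps e0; rewrite near_withinE => H1.
near=> h => h0; rewrite distrC.
have Hh : `|g (x + h *: v) - g x - h * d| <= eps * `|h| by near: h.
have -> : h^-1 *: (g (h *: v + x) - g x) - d = h^-1 * (g (x + h *: v) - g x - h * d).
  by rewrite [h *: v + x]addrC /GRing.scale /=; field.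
rewrite normrM normfV mulrC ler_pdivrMr ?normr_gt0 //.
Unshelve. all: by end_near. Qed.

(** The sequences of length at most j over a finite alphabet are finite in number, so finitely many
    neighbourhoods are intersected. *)
Lemma near_seqs (T : Type) (F : set_system T) (n j : nat)
    (P : seq 'I_n -> T -> Prop) : Filter F ->
  (forall b, \forall x \near F, P b x) ->
  \forall x \near F, forall b, (size b <= j)%N -> P b x.
Proof.
move=> FF; elim: j P => [|j IH] P HP.
  by apply: filterS (HP [::]) => x Px [].
have H1 : \forall x \near F, forall i b, (size b <= j)%N -> P (i :: b) x.
  by apply: filter_forall => i; apply: (IH (fun b => P (i :: b))) => b; exact: HP.
apply: filterS2 (HP [::]) H1 => x P0 PS [//|i b] sb; exact: PS.
Qed.

Variables p n N : nat.
Variables (iota : 'rV[R]_p -> 'rV[R]_n -> 'rV[R]_N)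
  (s1 : 'I_p -> 'I_N) (s2 : 'I_n -> 'I_N).

(* [iota x y] is the point whose [s1]-coordinates are those of [x] and whose
   [s2]-coordinates are those of [y]. *)
Definition coord_pairing : Prop :=
  [/\ continuous (fun z : 'rV[R]_p * 'rV[R]_n => iota z.1 z.2),
    forall x y i (h : R),
      iota (x + h *: delta_mx 0 i) y = iota x y + h *: delta_mx 0 (s1 i) &
    forall x y i (h : R),
      iota x (y + h *: delta_mx 0 i) = iota x y + h *: delta_mx 0 (s2 i)].

Hypothesis Hiota : coord_pairing.

Lemma is_derive_left (g : 'rV[R]_N -> R) x y i d :
  is_derive (iota x y) (delta_mx 0 (s1 i)) g d ->
  is_derive x (delta_mx 0 i) (fun x => g (iota x y)) d.
Proof.
have [_ E _] := Hiota; move=> [d1 d2].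
have Q : (fun h : R => h^-1 *: (g (iota (h *: delta_mx 0 i + x) y) - g (iota x y)))
  = (fun h : R => h^-1 *: (g (h *: delta_mx 0 (s1 i) + iota x y) - g (iota x y))).
  by apply/funext => h; rewrite [_ + x]addrC E [_ + iota x y]addrC.
by apply: DeriveDef; rewrite /derivable /derive Q.
Qed.

Lemma is_derive_right (g : 'rV[R]_N -> R) x y i d :
  is_derive (iota x y) (delta_mx 0 (s2 i)) g d ->
  is_derive y (delta_mx 0 i) (fun y => g (iota x y)) d.
Proof.
have [_ _ E] := Hiota; move=> [d1 d2].
have Q : (fun h : R => h^-1 *: (g (iota x (h *: delta_mx 0 i + y)) - g (iota x y)))
  = (fun h : R => h^-1 *: (g (h *: delta_mx 0 (s2 i) + iota x y) - g (iota x y))).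
  by apply/funext => h; rewrite [_ + y]addrC E [_ + iota x y]addrC.
by apply: DeriveDef; rewrite /derivable /derive Q.
Qed.

Lemma continuous_left (g : 'rV[R]_N -> R) x y :
  {for iota x y, continuous g} -> {for x, continuous (fun x => g (iota x y))}.
Proof.
have [cI _ _] := Hiota; move=> cg.
apply: (@continuous_comp _ _ _ (fun x => iota x y) g x _ cg).
apply: (@continuous_comp _ _ _ (fun x => (x, y)) (fun z => iota z.1 z.2) x).
  by apply: continuous_pair; [exact: cvg_id | exact: cst_continuous].
exact: cI.
Qed.

Lemma continuous_right (g : 'rV[R]_N -> R) x y :
  {for iota x y, continuous g} -> {for y, continuous (fun y => g (iota x y))}.
Proof.
have [cI _ _] := Hiota; move=> cg.
apply: (@continuous_comp _ _ _ (fun y => iota x y) g y _ cg).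
apply: (@continuous_comp _ _ _ (fun y => (x, y)) (fun z => iota z.1 z.2) y).
  by apply: continuous_pair; [exact: cst_continuous | exact: cvg_id].
exact: cI.
Qed.

(** A tube lemma: near each y0 in K, both values are within e / 2 of the value at (x, y0), and
    compactness of K makes the neighbourhood of x uniform. *)
Lemma compact_uniform (g : 'rV[R]_N -> R) x (K : set 'rV[R]_n) (e : R) :
  0 < e -> compact K -> (forall y, K y -> {for iota x y, continuous g}) ->
  \forall x' \near x, forall y, K y -> `|g (iota x' y) - g (iota x y)| <= e.
Proof.
move=> e0 /compact_near_coveringP cK cg.
have [cI _ _] := Hiota.
apply: (cK _ (nbhs x) (fun x' y => `|g (iota x' y) - g (iota x y)| <= e)) => y0 Ky0.
have e20 : 0 < e / 2 by rewrite divr_gt0.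
have C : (fun z : 'rV[R]_n * 'rV[R]_p => g (iota z.2 z.1)) @ (y0, x) --> g (iota x y0).
  apply: (@continuous_comp _ _ _ (fun z : 'rV[R]_n * 'rV[R]_p => iota z.2 z.1) g (y0, x)); last exact: cg.
  apply: (@continuous_comp _ _ _ (fun z : 'rV[R]_n * 'rV[R]_p => (z.2, z.1))
    (fun z : 'rV[R]_p * 'rV[R]_n => iota z.1 z.2) (y0, x)); last exact: cI.
  by apply: continuous_pair; [exact: cvg_snd | exact: cvg_fst].
have /cvgr_dist_le /(_ _ e20) [[A B] /= [nA nB] AB] := C.
exists (A, B) => //= -[y x'] /= [Ay Bx'].
have h1 := AB (y, x') (conj Ay Bx').
have h2 := AB (y, x) (conj Ay (nbhs_singleton nB)).
rewrite /= distrC in h1.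
rewrite (le_trans (ler_distD (g (iota x y0)) _ _)) // [e]splitr lerD //.
Qed.

End Families.

Lemma continuous_approx (R : realType) (T : topologicalType) (g : T -> R) x :
  (forall e : R, 0 < e -> \forall y \near x, `|g y - g x| <= e) ->
  {for x, continuous g}.
Proof.
move=> H; rewrite /prop_for /continuous_at; apply/cvgrPdist_le => e e0.
by apply: filterS (H e e0) => y; rewrite distrC.
Qed.

Section FunctionalBounds.
Variables (R : realType) (n : nat) (V : openset R n).
Implicit Types (K L : set 'rV[R]_n) (T : ('rV[R]_n -> R[i]) -> R[i]).

(** L restricts the test functions, while the estimate looks at K. Keeping them apart covers
    compactly supported distributions (L = V) and general ones (L compact). *)
Definition bounded_functional L K (j : nat) (C : R) T : Prop :=
  (forall c f g, testK V L f -> testK V L g ->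
     T (fun x => c * f x + g x) = c * T f + T g) /\
  forall f, testK V L f -> ((normc (T f))%:E <= C%:E * supDle K j f)%E.

Lemma testK_lin L (c : R[i]) f g : testK V L f -> testK V L g ->
  testK V L (fun x => c * f x + g x).
Proof.
move=> [sf f0] [sg g0]; split; first exact: smooth_lin (opensetP V) sf sg.
by move=> x Vx Lx; rewrite f0 // g0 // mulr0 addr0.
Qed.

Lemma bounded_functional_le L K j C T f (M : R) :
  bounded_functional L K j C T -> testK V L f -> 0 <= M ->
  (forall x s, K x -> (size s <= j)%N -> normc (DseqC s f x) <= M) ->
  normc (T f) <= `|C| * M.
Proof.
move=> [_ bT] tf M0 H; rewrite -lee_fin (le_trans (bT f tf)) //.
apply: (@le_trans _ _ (`|C|%:E * supDle K j f)%E).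
  by apply: lee_wpmul2r; [exact: nnsup_ge0 | rewrite lee_fin ler_norm].
by rewrite EFinM lee_wpmul2l ?lee_fin //; exact: supDle_le.
Qed.

Lemma bounded_functionalB L K j C T f g :
  bounded_functional L K j C T -> testK V L f -> testK V L g ->
  T (fun x => f x - g x) = T f - T g.
Proof.
move=> [lT _] tf tg; have := lT (-1) g f tg tf.
rewrite mulN1r addrC => <-; congr T; apply/funext => x.
by rewrite mulN1r addrC.
Qed.

End FunctionalBounds.

(** * Differentiation under a functional *)

Section ParameterSmooth.
Variables (R : realType) (p n N : nat).
Variables (iota : 'rV[R]_p -> 'rV[R]_n -> 'rV[R]_N)
  (s1 : 'I_p -> 'I_N) (s2 : 'I_n -> 'I_N).
Hypothesis Hiota : coord_pairing iota s1 s2.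
Variables (U : set 'rV[R]_p) (V : openset R n) (W : set 'rV[R]_N)
  (L K : set 'rV[R]_n) (f : 'rV[R]_N -> R[i]).
Hypotheses (oU : open U) (oW : open W) (UVW : forall x y, U x -> openset_val V y -> W (iota x y)).
Hypotheses (sf : smooth W f)
  (f0 : forall x y, U x -> openset_val V y -> ~ L y -> f (iota x y) = 0).
Local Notation Re := (@complex.Re R).
Local Notation Im := (@complex.Im R).

Let G s x := fun y => DseqC (map s1 s) f (iota x y).

Lemma DseqC_right s b x : U x -> smooth V (G s x) /\ forall y, openset_val V y ->
  DseqC b (G s x) y = DseqC (map s2 b ++ map s1 s) f (iota x y).
Proof.
move=> Ux.
have [||H1 H2] := @smooth_family R n V
  (fun b y => DseqC (map s2 b ++ map s1 s) f (iota x y)) (opensetP V).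
- move=> c y Vy; have Wxy := UVW Ux Vy; split.
    exact: (continuous_right Hiota (smoothR_continuous sf.1 Wxy)).
  exact: (continuous_right Hiota (smoothR_continuous sf.2 Wxy)).
- move=> c i y Vy; have Wxy := UVW Ux Vy; split.
    by apply: (is_derive_right Hiota); apply: (smoothR_is_derive _ _ sf.1 Wxy).
  by apply: (is_derive_right Hiota); apply: (smoothR_is_derive _ _ sf.2 Wxy).
- by split=> // y Vy; exact: H2.
Qed.

Lemma DseqC_left s x y : U x -> openset_val V y ->
  DseqC s (fun x => f (iota x y)) x = DseqC (map s1 s) f (iota x y).
Proof.
move=> Ux Vy.
have [||H1 H2] := @smooth_family R p U
  (fun b x => DseqC (map s1 b) f (iota x y)) oU.
- move=> c x' Ux'; have Wxy := UVW Ux' Vy; split.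
    exact: (continuous_left Hiota (smoothR_continuous sf.1 Wxy)).
  exact: (continuous_left Hiota (smoothR_continuous sf.2 Wxy)).
- move=> c i x' Ux'; have Wxy := UVW Ux' Vy; split.
    by apply: (is_derive_left Hiota); apply: (smoothR_is_derive _ _ sf.1 Wxy).
  by apply: (is_derive_left Hiota); apply: (smoothR_is_derive _ _ sf.2 Wxy).
- by rewrite -H2 //; congr (DseqC s _ x); apply/funext => x' /=; rewrite DseqC_nil.
Qed.

(** For y off L the function f (iota . y) is zero on the whole open set U, hence so are its
    derivatives in x. *)
Lemma testK_slice s x : U x -> testK V L (G s x).
Proof.
move=> Ux; split; first by have [] := DseqC_right s [::] Ux.
move=> y Vy Ly; rewrite /G -DseqC_left //.
by apply: (DseqC_eq0 _ oU) => // x' Ux'; exact: f0.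
Qed.

Hypotheses (cK : compact K) (KV : K `<=` V).

Let nearU x : U x -> \forall x' \near x, U x'.
Proof. by move=> Ux; exact: open_nbhs_nbhs. Qed.

Lemma slice_uniform (j : nat) s x (e : R) : U x -> 0 < e ->
  \forall x' \near x, forall b, (size b <= j)%N -> forall y, K y ->
    normc (DseqC (map s2 b ++ map s1 s) f (iota x' y)
          - DseqC (map s2 b ++ map s1 s) f (iota x y)) <= e.
Proof.
move=> Ux e0; have e20 : 0 < e / 2 by rewrite divr_gt0.
apply: (@near_seqs _ (nbhs x) n j (fun b x' => forall y, K y ->
  normc (DseqC (map s2 b ++ map s1 s) f (iota x' y)
        - DseqC (map s2 b ++ map s1 s) f (iota x y)) <= e)) => b.
set q := map s2 b ++ map s1 s.
have h1 := compact_uniform Hiota e20 cK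
  (fun y Ky => smoothR_continuous sf.1 (UVW Ux (KV Ky)) : {for _, continuous (Dseq q (Re \o f))}).
have h2 := compact_uniform Hiota e20 cK
  (fun y Ky => smoothR_continuous sf.2 (UVW Ux (KV Ky)) : {for _, continuous (Dseq q (Im \o f))}).
apply: filterS2 h1 h2 => x' a1 a2 y Ky.
rewrite (le_trans (normc_le_ReIm _)) // [e]splitr lerD //.
  by rewrite Re_add Re_opp; exact: a1.
by rewrite Im_add Im_opp; exact: a2.
Qed.

Variables (j : nat) (C : R) (T : ('rV[R]_n -> R[i]) -> R[i]).
Hypothesis bT : bounded_functional V L K j C T.

Lemma slice_continuous s x (e : R) : U x -> 0 < e ->
  \forall x' \near x, normc (T (G s x') - T (G s x)) <= `|C| * e.
Proof.
move=> Ux e0; have H := slice_uniform j s Ux e0.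
apply: filterS2 H (nearU Ux) => x' H Ux'.
rewrite -(bounded_functionalB bT (testK_slice s Ux') (testK_slice s Ux)).
have E : (fun y => G s x' y - G s x y) = (fun y => (-1) * G s x y + G s x' y).
  by apply/funext => y; rewrite mulN1r addrC.
apply: (bounded_functional_le bT) (ltW e0) _.
  by rewrite E; apply: testK_lin; exact: testK_slice.
move=> y b Ky bj; rewrite E.
have [sx Ex] := DseqC_right s b Ux; have [sx' Ex'] := DseqC_right s b Ux'.
rewrite (DseqC_lin _ _ (opensetP V) sx sx') ?Ex ?Ex' ?mulN1r 1?addrC; try exact: KV.
exact: H.
Qed.

(** T is applied to the first-order remainder D of the slice. By the mean value theorem, each
    y-derivative of D on K is |h| times an oscillation of the next derivative of f, which is small
    uniformly on K. *)
Lemma slice_derive s i x (e : R) : U x -> 0 < e ->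
  \forall h \near (0 : R),
    normc (T (G s (x + h *: delta_mx 0 i)) - T (G s x) - h%:C * T (G (i :: s) x))
    <= `|C| * e * `|h|.
Proof.
move=> Ux e0; have e20 : 0 < e / 2 by rewrite divr_gt0.
have line : {for (0 : R), continuous (fun h : R => x + h *: delta_mx 0 i)}.
  by apply: continuousD; [exact: cst_continuous | exact: scalel_continuous].
have nline (P : set 'rV[R]_p) : (\forall x' \near x, P x') ->
    \forall h \near (0 : R), forall t : R, `|t| <= `|h| -> P (x + t *: delta_mx 0 i).
  move=> nP; have : \forall h \near (0 : R), P (x + h *: delta_mx 0 i).
    by apply: line; rewrite /= scale0r addr0.
  move=> /nbhs_ballP [r /= r0 hr].
  apply/nbhs_ballP; exists r => //= h; rewrite -ball_normE /= sub0r normrN => hh t th.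
  by apply: hr; rewrite -ball_normE /= sub0r normrN (le_lt_trans th).
have H : \forall x' \near x, forall b, (size b <= j)%N -> forall y, K y ->
    `|Dseq (s1 i :: map s2 b ++ map s1 s) (Re \o f) (iota x' y)
      - Dseq (s1 i :: map s2 b ++ map s1 s) (Re \o f) (iota x y)| <= e / 2 /\
    `|Dseq (s1 i :: map s2 b ++ map s1 s) (Im \o f) (iota x' y)
      - Dseq (s1 i :: map s2 b ++ map s1 s) (Im \o f) (iota x y)| <= e / 2.
  apply: (@near_seqs _ (nbhs x) n j (fun b x' => forall y, K y ->
    `|Dseq (s1 i :: map s2 b ++ map s1 s) (Re \o f) (iota x' y)
      - Dseq (s1 i :: map s2 b ++ map s1 s) (Re \o f) (iota x y)| <= e / 2 /\
    `|Dseq (s1 i :: map s2 b ++ map s1 s) (Im \o f) (iota x' y)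
      - Dseq (s1 i :: map s2 b ++ map s1 s) (Im \o f) (iota x y)| <= e / 2)) => b.
  set q := s1 i :: map s2 b ++ map s1 s.
  have h1 := compact_uniform Hiota e20 cK
    (fun y Ky => smoothR_continuous sf.1 (UVW Ux (KV Ky)) : {for _, continuous (Dseq q (Re \o f))}).
  have h2 := compact_uniform Hiota e20 cK
    (fun y Ky => smoothR_continuous sf.2 (UVW Ux (KV Ky)) : {for _, continuous (Dseq q (Im \o f))}).
  by apply: filterS2 h1 h2 => x' a1 a2 y Ky; split; [exact: a1 | exact: a2].
have NU := nline _ (nearU Ux); have NH := nline _ H.
apply: filterS2 NU NH => h Uh Hh.
have Uxh : U (x + h *: delta_mx 0 i) by exact: Uh.
have t1 := testK_slice s Ux; have t2 := testK_slice s Uxh.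
have t3 := testK_slice (i :: s) Ux.
have tB : testK V L (fun y => (-1) * G s x y + G s (x + h *: delta_mx 0 i) y).
  exact: testK_lin.
pose D := fun y => (- h%:C) * G (i :: s) x y +
  ((-1) * G s x y + G s (x + h *: delta_mx 0 i) y).
have tD : testK V L D by exact: testK_lin.
have -> : T (G s (x + h *: delta_mx 0 i)) - T (G s x) - h%:C * T (G (i :: s) x) = T D.
  rewrite /D bT.1 // bT.1 // mulN1r mulNr addrC; congr (_ + _); exact: addrC.
rewrite -mulrA; apply: (bounded_functional_le bT tD).
  by rewrite mulr_ge0 // ltW.
move=> y b Ky bj; have Vy := KV Ky.
have [sx Ex] := DseqC_right s b Ux; have [sx' Ex'] := DseqC_right s b Uxh.
have [si Ei] := DseqC_right (i :: s) b Ux.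
have [sB _] := tB.
rewrite (DseqC_lin (- h%:C) b (opensetP V) si sB Vy).
rewrite (DseqC_lin (-1) b (opensetP V) sx sx' Vy) Ex // Ex' // Ei //.
(* The x-derivative in direction i must come last in time, that is, first in the sequence, for the
   mean value theorem to apply; symmetry of derivatives allows this. *)
have -> : DseqC (map s2 b ++ map s1 (i :: s)) f (iota x y) =
    DseqC (s1 i :: map s2 b ++ map s1 s) f (iota x y).
  apply: (DseqC_perm oW sf) (UVW Ux Vy).
  by rewrite perm_catC /= perm_cons perm_catC.
set q := map s2 b ++ map s1 s.
have incr (g : 'rV[R]_N -> R) : smoothR W g ->
    (forall t : R, `|t| <= `|h| ->
      `|Dseq (s1 i :: q) g (iota (x + t *: delta_mx 0 i) y)
        - Dseq (s1 i :: q) g (iota x y)| <= e / 2) ->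
    `|Dseq q g (iota (x + h *: delta_mx 0 i) y) - Dseq q g (iota x y)
      - h * Dseq (s1 i :: q) g (iota x y)| <= e / 2 * `|h|.
  move=> sg Hg.
  have dg (t : R) : `|t| <= `|h| -> is_derive (x + t *: delta_mx 0 i)
      (delta_mx 0 i) (fun x => Dseq q g (iota x y))
      (Dseq (s1 i :: q) g (iota (x + t *: delta_mx 0 i) y)).
    move=> th; apply: (is_derive_left Hiota).
    exact: (smoothR_is_derive q (s1 i) sg (UVW (Uh t th) Vy)).
  have [|t th ->] := @mvt_line_norm R _ (fun x => Dseq q g (iota x y)) (delta_mx 0 i) x h.
    by move=> t /dg [].
  have [_ ->] := dg t th.
  by rewrite -mulrBr normrM mulrC ler_wpM2r //; exact: Hg.
have i1 := incr _ sf.1 (fun t th => (Hh t th b bj y Ky).1).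
have i2 := incr _ sf.2 (fun t th => (Hh t th b bj y Ky).2).
rewrite (le_trans (normc_le_ReIm _)) // [e]splitr mulrDl lerD //.
  move: i1; congr (`|_| <= _); rewrite /DseqC !(Re_add, Re_mul, Re_opp, Im_opp) /=; ring.
move: i2; congr (`|_| <= _); rewrite /DseqC !(Im_add, Im_mul, Re_opp, Im_opp) /=; ring.
Qed.

Let w x := T (fun y => f (iota x y)).

Lemma functional_parameter_smooth :
  smooth U w /\ forall s x, U x -> DseqC s w x = T (G s x).
Proof.
have -> : w = fun x => T (G [::] x).
  apply/funext => x; congr T; apply/funext => y; by rewrite /G DseqC_nil.
(* The estimates are divided by |C| + 1 because C may be 0. *)
have C0 : 0 < `|C| + 1 by rewrite ltr_wpDl.
have Cle : `|C| / (`|C| + 1) <= 1 by rewrite ler_pdivrMr // mul1r lerDl.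
apply: (smooth_family (D := fun s x => T (G s x)) oU) => [s x Ux|s i x Ux].
  have H (e : R) : 0 < e -> \forall x' \near x, normc (T (G s x') - T (G s x)) <= e.
    move=> e0; have e1 : 0 < e / (`|C| + 1) by rewrite divr_gt0.
    apply: filterS (slice_continuous s Ux e1) => x' /le_trans; apply.
    by rewrite mulrCA ler_piMr // ltW.
  split; apply: continuous_approx => e e0; apply: filterS (H e e0) => x' He.
    by rewrite (le_trans _ He) // -Re_opp -Re_add; exact: normc_Re.
  by rewrite (le_trans _ He) // -Im_opp -Im_add; exact: normc_Im.
have H (e : R) : 0 < e -> \forall h \near (0 : R),
    normc (T (G s (x + h *: delta_mx 0 i)) - T (G s x) - h%:C * T (G (i :: s) x))
    <= e * `|h|.
  move=> e0; have e1 : 0 < e / (`|C| + 1) by rewrite divr_gt0.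
  apply: filterS (slice_derive s i Ux e1) => x' /le_trans; apply.
  by rewrite ler_wpM2r // mulrCA ler_piMr // ltW.
split; apply: is_derive_approx => e e0; apply: filterS (H e e0) => h He.
  rewrite (le_trans _ He) // (le_trans _ (normc_Re _)) //.
  by rewrite [X in _ <= `|X|]Re_add Re_add !Re_opp Re_mul [complex.Im _%:C]/= mul0r subr0.
rewrite (le_trans _ He) // (le_trans _ (normc_Im _)) //.
by rewrite [X in _ <= `|X|]Im_add Im_add !Im_opp Im_mul [complex.Im _%:C]/= mul0r addr0.
Qed.

End ParameterSmooth.

(** * Integrals and Fubini's theorem *)

Section SegmentIntegral.
Variable R : realType.
Implicit Types (a b c : R) (h k : R -> R[i]).
Local Notation Re := (@complex.Re R).
Local Notation Im := (@complex.Im R).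
Local Notation mu := (@lebesgue_measure R).

Definition ccontinuous h := continuous (Re \o h) /\ continuous (Im \o h).

Definition integral_seg a b h : R[i] :=
  (\int[mu]_(t in `[a, b]) Re (h t))%R +i* (\int[mu]_(t in `[a, b]) Im (h t))%R.

Lemma integrable_seg a b (f : R -> R) : continuous f ->
  mu.-integrable `[a, b] (EFin \o f).
Proof.
move=> cf; apply: continuous_compact_integrable; first exact: segment_compact.
exact: continuous_subspaceT.
Qed.

Lemma continuous_scale (x : R) (f : R -> R) : continuous f ->
  continuous (fun t => x * f t).
Proof. by move=> cf t; exact: (cvgM (cvg_cst x) (cf t)). Qed.

Lemma continuous_comb (x y : R) (f g e : R -> R) :
  continuous f -> continuous g -> continuous e ->
  continuous (fun t => x * f t + y * g t + e t).
Proof.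
move=> cf cg ce t; apply: cvgD (ce t).
have c1 := @continuous_scale x f cf t; have c2 := @continuous_scale y g cg t.
exact: (cvgD c1 c2).
Qed.

Lemma ccontinuous_lin (z : R[i]) h k : ccontinuous h -> ccontinuous k ->
  ccontinuous (fun t => z * h t + k t).
Proof.
move=> [h1 h2] [k1 k2]; split.
  rewrite (_ : _ \o _ = fun t => Re z * Re (h t) + (- Im z) * Im (h t) + Re (k t)).
    exact: (@continuous_comb _ _ _ _ _ h1 h2 k1).
  by apply/funext => t /=; rewrite Re_add Re_mul mulNr.
rewrite (_ : _ \o _ = fun t => Re z * Im (h t) + Im z * Re (h t) + Im (k t)).
  exact: (@continuous_comb _ _ _ _ _ h2 h1 k2).
by apply/funext => t /=; rewrite Im_add Im_mul.
Qed.

Lemma ccontinuous_cst (z : R[i]) : ccontinuous (fun=> z).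
Proof. by split; exact: cst_continuous. Qed.

Lemma Rintegral_seg_lin a b (x y : R) (f g e : R -> R) :
  continuous f -> continuous g -> continuous e ->
  (\int[mu]_(t in `[a, b]) (x * f t + y * g t + e t))%R =
  x * (\int[mu]_(t in `[a, b]) f t)%R + y * (\int[mu]_(t in `[a, b]) g t)%R +
  (\int[mu]_(t in `[a, b]) e t)%R.
Proof.
move=> cf cg ce.
have cxf := @continuous_scale x f cf; have cyg := @continuous_scale y g cg.
have cs : continuous (fun t => x * f t + y * g t).
  by move=> t; exact: (cvgD (cxf t) (cyg t)).
rewrite RintegralD //; try exact: integrable_seg.
rewrite RintegralD //; try exact: integrable_seg.
by rewrite !RintegralZl //; exact: integrable_seg.
Qed.

Lemma integral_seg_lin a b (z : R[i]) h k : ccontinuous h -> ccontinuous k ->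
  integral_seg a b (fun t => z * h t + k t) =
  z * integral_seg a b h + integral_seg a b k.
Proof.
move=> [h1 h2] [k1 k2]; rewrite [RHS]complex_eta Re_add Im_add Re_mul Im_mul /=.
rewrite -mulNr -(Rintegral_seg_lin a b _ _ h1 h2 k1).
rewrite -(Rintegral_seg_lin a b _ _ h2 h1 k2).
congr (_ +i* _); apply: eq_Rintegral => t _.
  by rewrite Re_add Re_mul mulNr.
by rewrite Im_add Im_mul.
Qed.

Lemma integral_segB a b h k : ccontinuous h -> ccontinuous k ->
  integral_seg a b (fun t => h t - k t) = integral_seg a b h - integral_seg a b k.
Proof.
move=> ch ck; rewrite addrC -mulN1r -integral_seg_lin //; congr integral_seg.
by apply/funext => t; rewrite mulN1r addrC.
Qed.

Lemma mu_seg a b : a <= b -> fine (mu (`[a, b]%classic : set R)) = b - a.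
Proof.
move=> ab; rewrite lebesgue_measure_itv /= lte_fin; case: ltgtP ab => //= -> _.
by rewrite subrr.
Qed.

Lemma integral_seg_cst a b (z : R[i]) : a <= b ->
  integral_seg a b (fun=> z) = (b - a)%:C * z.
Proof.
move=> ab; rewrite /integral_seg !Rintegral_cst // mu_seg //.
rewrite [RHS]complex_eta Re_mul Im_mul /= !mul0r subr0 addr0.
by congr (_ +i* _); exact: mulrC.
Qed.

Lemma Rintegral_seg_bound a b (f : R -> R) (B : R) : a <= b -> continuous f ->
  (forall t, a <= t <= b -> `|f t| <= B) ->
  `|(\int[mu]_(t in `[a, b]) f t)%R| <= (b - a) * B.
Proof.
move=> ab cf fB.
rewrite (le_trans (le_normr_Rintegral _ _)) //; first exact: integrable_seg.
have cnf : continuous (fun t => `|f t|).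
  by move=> t; apply: continuous_comp; [exact: cf | exact: norm_continuous].
apply: (@le_trans _ _ (\int[mu]_(t in `[a, b]) B)%R).
  apply: le_Rintegral => //; first exact: integrable_seg.
    by apply: integrable_seg; exact: cst_continuous.
by rewrite Rintegral_cst // mu_seg // mulrC.
Qed.

(** Real and imaginary parts are bounded separately, hence the factor 2 that reappears in the
    constants of later integrals. *)
Lemma integral_seg_bound a b h (B : R) : a <= b -> ccontinuous h ->
  (forall t, a <= t <= b -> normc (h t) <= B) ->
  normc (integral_seg a b h) <= 2 * (b - a) * B.
Proof.
move=> ab [c1 c2] hB; rewrite (le_trans (normc_le_ReIm _)) //=.
have -> : 2 * (b - a) * B = (b - a) * B + (b - a) * B by ring.
apply: lerD; apply: Rintegral_seg_bound => // t /hB; apply: le_trans.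
  exact: normc_Re.
exact: normc_Im.
Qed.

Lemma integral_seg_cat a b c h : a <= b -> b <= c -> ccontinuous h ->
  integral_seg a c h = integral_seg a b h + integral_seg b c h.
Proof.
move=> ab bc [c1 c2].
have cat (f : R -> R) : continuous f ->
    (\int[mu]_(t in `[a, c]) f t = \int[mu]_(t in `[a, b]) f t + \int[mu]_(t in `[b, c]) f t)%R.
  move=> cf.
  have ioc : mu.-integrable `]b, c] (EFin \o f).
    apply: integrableS (integrable_seg b c cf) => //.
    exact: subset_itv_oc_cc.
  rewrite -(Rintegral_itv_obnd_cbnd ioc).
  rewrite -(@Rintegral_itvB _ f (BLeft a) (BRight c) b) ?bnd_simp //.
    by rewrite addrC subrK.
  exact: integrable_seg.
by rewrite /integral_seg (cat _ c1) (cat _ c2).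
Qed.

Lemma Rintegral_supp a b (f : R -> R) : (forall t, ~~ (a <= t <= b) -> f t = 0) ->
  (\int[mu]_t f t = \int[mu]_(t in `[a, b]) f t)%R.
Proof.
move=> f0; rewrite [RHS]Rintegral_mkcond; apply: eq_Rintegral => t _.
rewrite /patch; case: ifPn => // /negP tab; apply: f0; apply/negP => ht.
by apply: tab; rewrite inE /= in_itv.
Qed.

End SegmentIntegral.

(** * Blocks of coordinates *)

Section Coordinates.
Variable R : realType.

Lemma continuous_rV (T : topologicalType) N (F : T -> 'rV[R]_N) t :
  (forall k, {for t, continuous (fun s => F s 0 k)}) -> {for t, continuous F}.
Proof.
move=> cF; rewrite /prop_for /continuous_at; apply/cvgrPdist_le => e e0.
have H : \forall s \near t, forall k, `|F t 0 k - F s 0 k| <= e.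
  apply: filter_forall => k.
  by have /cvgrPdist_le /(_ e e0) := cF k.
apply: filterS H => s Hs.
rewrite /Num.Def.normr /= mx_normrE (bigmax_le _ (ltW e0)) // => -[i k] _ /=.
by rewrite !mxE (ord1 i).
Qed.

Lemma delta_lshift p n (i : 'I_p) :
  delta_mx 0 (lshift n i) = row_mx (delta_mx 0 i) 0 :> 'rV[R]_(p + n).
Proof.
apply/rowP => k; case: (split_ordP k) => j ->.
  by rewrite row_mxEl !mxE eq_lshift.
by rewrite row_mxEr !mxE eq_rlshift.
Qed.

Lemma delta_rshift p n (i : 'I_n) :
  delta_mx 0 (rshift p i) = row_mx 0 (delta_mx 0 i) :> 'rV[R]_(p + n).
Proof.
apply/rowP => k; case: (split_ordP k) => j ->.
  by rewrite row_mxEl !mxE eq_lrshift.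
by rewrite row_mxEr !mxE eq_rshift.
Qed.

Lemma row_mxDl p n (x x' : 'rV[R]_p) (y : 'rV[R]_n) :
  row_mx (x + x') y = row_mx x y + row_mx x' 0.
Proof. by rewrite add_row_mx addr0. Qed.

Lemma row_mxDr p n (x : 'rV[R]_p) (y y' : 'rV[R]_n) :
  row_mx x (y + y') = row_mx x y + row_mx 0 y'.
Proof. by rewrite add_row_mx addr0. Qed.

Lemma row_mx_shiftl p n (x : 'rV[R]_p) (y : 'rV[R]_n) i (h : R) :
  row_mx (x + h *: delta_mx 0 i) y = row_mx x y + h *: delta_mx 0 (lshift n i).
Proof. by rewrite row_mxDl delta_lshift scale_row_mx scaler0. Qed.

Lemma row_mx_shiftr p n (x : 'rV[R]_p) (y : 'rV[R]_n) i (h : R) :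
  row_mx x (y + h *: delta_mx 0 i) = row_mx x y + h *: delta_mx 0 (rshift p i).
Proof. by rewrite row_mxDr delta_rshift scale_row_mx scaler0. Qed.

Lemma continuous_row_mx (T : topologicalType) p n (F : T -> 'rV[R]_p)
    (F' : T -> 'rV[R]_n) t : {for t, continuous F} -> {for t, continuous F'} ->
  {for t, continuous (fun s => row_mx (F s) (F' s))}.
Proof.
move=> cF cF'; apply: continuous_rV => k; case: (split_ordP k) => j ->.
  rewrite (_ : (fun s => _) = (fun s => F s 0 j)).
    by apply: (@continuous_comp _ _ _ F (fun v : 'rV[R]_p => v 0 j) t cF); exact: coord_continuous.
  by apply/funext => s; rewrite row_mxEl.
rewrite (_ : (fun s => _) = (fun s => F' s 0 j)).
  by apply: (@continuous_comp _ _ _ F' (fun v : 'rV[R]_n => v 0 j) t cF'); exact: coord_continuous.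
by apply/funext => s; rewrite row_mxEr.
Qed.

Lemma coord_pairing_row_mx p n :
  coord_pairing (fun (x : 'rV[R]_p) (y : 'rV[R]_n) => row_mx x y)
    (@lshift p n) (@rshift p n).
Proof.
split=> [z|x y i h|x y i h].
- by apply: continuous_row_mx; [exact: cvg_fst | exact: cvg_snd].
- exact: row_mx_shiftl.
- exact: row_mx_shiftr.
Qed.

Lemma coord_pairing_swap p n :
  coord_pairing (fun (y : 'rV[R]_n) (x : 'rV[R]_p) => row_mx x y)
    (@rshift p n) (@lshift p n).
Proof.
split=> [z|x y i h|x y i h].
- by apply: continuous_row_mx; [exact: cvg_snd | exact: cvg_fst].
- exact: row_mx_shiftr.
- exact: row_mx_shiftl.
Qed.

Definition unsplit_map p n N (f : 'I_p -> 'I_N) (g : 'I_n -> 'I_N)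
  (k : 'I_(p + n)) : 'I_N := match fintype.split k with inl i => f i | inr j => g j end.

Lemma continuous_lsub (T : topologicalType) p n (F : T -> 'rV[R]_(p + n)) t :
  {for t, continuous F} -> {for t, continuous (fun s => lsubmx (F s))}.
Proof.
by move=> cF; apply: (@continuous_comp _ _ _ F lsubmx t cF); exact: continuous_lsubmx.
Qed.

Lemma continuous_rsub (T : topologicalType) p n (F : T -> 'rV[R]_(p + n)) t :
  {for t, continuous F} -> {for t, continuous (fun s => rsubmx (F s))}.
Proof.
by move=> cF; apply: (@continuous_comp _ _ _ F rsubmx t cF); exact: continuous_rsubmx.
Qed.

Lemma lsub_shift p n (z : 'rV[R]_(p + n)) i (h : R) :
  lsubmx (z + h *: delta_mx 0 (lshift n i)) = lsubmx z + h *: delta_mx 0 i.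
Proof. by apply/rowP => k; rewrite !mxE eq_lshift. Qed.
Lemma rsub_shift p n (z : 'rV[R]_(p + n)) i (h : R) :
  rsubmx (z + h *: delta_mx 0 (rshift p i)) = rsubmx z + h *: delta_mx 0 i.
Proof. by apply/rowP => k; rewrite !mxE eq_rshift. Qed.
Lemma lsub_rshift p n (z : 'rV[R]_(p + n)) i (h : R) :
  lsubmx (z + h *: delta_mx 0 (rshift p i)) = lsubmx z.
Proof. by apply/rowP => k; rewrite !mxE eq_lrshift andbF mulr0 addr0. Qed.
Lemma rsub_lshift p n (z : 'rV[R]_(p + n)) i (h : R) :
  rsubmx (z + h *: delta_mx 0 (lshift n i)) = rsubmx z.
Proof. by apply/rowP => k; rewrite !mxE eq_rlshift andbF mulr0 addr0. Qed.

(** Reads a point (t, x, y) with parameter z = (t, y) and the middle block x as variable: the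
    reading under which x is integrated out. *)
Lemma coord_pairing_outer q m n :
  coord_pairing (fun (z : 'rV[R]_(q + n)) (x : 'rV[R]_m) =>
      row_mx (row_mx (lsubmx z) x) (rsubmx z))
    (unsplit_map (fun i => lshift n (lshift m i)) (@rshift (q + m) n))
    (fun i => lshift n (rshift q i)).
Proof.
split=> [z|x y i h|x y i h].
- apply: (@continuous_row_mx ('rV[R]_(q + n) * 'rV[R]_m)%type (q + m) n
    (fun z => row_mx (lsubmx z.1) z.2) (fun z => rsubmx z.1)); last first.
    by apply: (@continuous_rsub _ q n fst); exact: cvg_fst.
  apply: (@continuous_row_mx ('rV[R]_(q + n) * 'rV[R]_m)%type q m
    (fun z => lsubmx z.1) snd); last exact: cvg_snd.
  by apply: (@continuous_lsub _ q n fst); exact: cvg_fst.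
- case: (split_ordP i) => j ->; rewrite /unsplit_map.
    rewrite (unsplitK (inl _)) lsub_shift rsub_lshift.
    by rewrite !row_mx_shiftl.
  by rewrite (unsplitK (inr _)) lsub_rshift rsub_shift row_mx_shiftr.
- by rewrite row_mx_shiftr row_mx_shiftl.
Qed.

(** Reads a point (t, x, y) with t as parameter, so that t can be frozen. *)
Lemma coord_pairing_first q m n :
  coord_pairing (fun (t : 'rV[R]_q) (z : 'rV[R]_(m + n)) =>
      row_mx (row_mx t (lsubmx z)) (rsubmx z))
    (fun i => lshift n (lshift m i))
    (unsplit_map (fun i => lshift n (rshift q i)) (@rshift (q + m) n)).
Proof.
split=> [z|x y i h|x y i h].
- apply: (@continuous_row_mx ('rV[R]_q * 'rV[R]_(m + n))%type (q + m) n
    (fun z => row_mx z.1 (lsubmx z.2)) (fun z => rsubmx z.2)); last first.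
    by apply: (@continuous_rsub _ m n snd); exact: cvg_snd.
  apply: (@continuous_row_mx ('rV[R]_q * 'rV[R]_(m + n))%type q m
    fst (fun z => lsubmx z.2)); first exact: cvg_fst.
  by apply: (@continuous_lsub _ m n snd); exact: cvg_snd.
- by rewrite !row_mx_shiftl.
- case: (split_ordP i) => j ->; rewrite /unsplit_map.
    rewrite (unsplitK (inl _)) lsub_shift rsub_lshift.
    by rewrite row_mx_shiftr row_mx_shiftl.
  by rewrite (unsplitK (inr _)) lsub_rshift rsub_shift row_mx_shiftr.
Qed.

Lemma continuous_scalar_mx : continuous (fun t : R => t%:M : 'rV[R]_1).
Proof.
move=> t; apply: continuous_rV => k.
by rewrite (_ : (fun s => _) = id) //; apply/funext => s; rewrite mxE !ord1 eqxx mulr1n.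
Qed.

End Coordinates.

Section Boxes.
Variables (R : realType) (m : nat).

Definition whole : openset R m := OpenSet openT.

Definition box (M : R) : set 'rV[R]_m := [set x | forall i, `|x 0 i| <= M].

Lemma compact_box M : compact (box M).
Proof.
have := @rV_compact R m (fun=> `[-M, M]%classic) (fun=> @segment_compact _ _ _).
congr compact; apply/seteqP; split=> x Hx i; have := Hx i => /=.
  by rewrite in_itv /= ler_norml.
by rewrite in_itv /= ler_norml.
Qed.

End Boxes.

Section BoundedIntro.
Variables (R : realType) (n : nat) (V : openset R n).

(** Turns a bound for every real B dominating the derivatives into a bound by the supremum; when the
    supremum is infinite, C > 0 makes the right-hand side infinite. *)
Lemma bounded_functional_intro L K j (C : R) (T : (_ -> R[i]) -> R[i]) : K `<=` V -> 0 < C ->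
  (forall (c : R[i]) f g, testK V L f -> testK V L g ->
     T (fun x => c * f x + g x) = c * T f + T g) ->
  (forall f (B : R), testK V L f -> 0 <= B ->
    (forall x s, K x -> (size s <= j)%N -> normc (DseqC s f x) <= B) ->
    normc (T f) <= C * B) ->
  bounded_functional V L K j C T.
Proof.
move=> KV C0 lT bT; split=> // f tf.
have S0 : (0 <= supDle K j f)%E by exact: nnsup_ge0.
case E : (supDle K j f) => [r| |]; last by rewrite E in S0.
  rewrite -EFinM lee_fin; apply: bT => //; first by rewrite E in S0.
  move=> x s Kx sj; rewrite -lee_fin -E.
  exact: (supDle_ub (opensetP V) KV tf.1 Kx sj).
by rewrite gt0_muley ?lte_fin // leey.
Qed.

(** T receives total functions, so it might see values off V. It does not: the difference has zero
    derivatives on K, and the estimate kills it. *)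
Lemma bounded_functional_congr L K j C T f g : K `<=` V ->
  bounded_functional V L K j C T ->
  testK V L f -> testK V L g -> (forall x, openset_val V x -> f x = g x) ->
  T f = T g.
Proof.
move=> KV bT tf tg fg; apply/eqP; rewrite -subr_eq0.
have E : (fun x => f x - g x) = (fun x => (-1) * g x + f x).
  by apply/funext => x; rewrite mulN1r addrC.
rewrite -(bounded_functionalB bT tf tg); apply/eqP/eq0_normc/le_anti.
rewrite normc_ge0 andbT -[X in _ <= X](mulr0 `|C|).
have td : testK V L (fun x => f x - g x) by rewrite E; exact: testK_lin.
apply: (bounded_functional_le bT td) => // x s Kx _.
rewrite (@DseqC_eq0 _ _ V) ?normc0 //; first exact: opensetP.
  by move=> y Vy; rewrite fg // subrr.
exact: KV.
Qed.

End BoundedIntro.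

(** * Integrals as bounded functionals *)

Section IntegralFunctionals.
Variable R : realType.
Local Notation Re := (@complex.Re R).
Local Notation Im := (@complex.Im R).

Lemma smooth_line (f : 'rV[R]_1 -> R[i]) : smooth setT f ->
  ccontinuous (fun t => f t%:M).
Proof.
move=> [s1 s2]; split=> t.
  apply: (@continuous_comp _ _ _ (fun t : R => t%:M : 'rV[R]_1) (Re \o f) t).
    exact: continuous_scalar_mx.
  exact: (@smoothR_continuous _ _ _ _ [::] _ s1).
apply: (@continuous_comp _ _ _ (fun t : R => t%:M : 'rV[R]_1) (Im \o f) t).
  exact: continuous_scalar_mx.
exact: (@smoothR_continuous _ _ _ _ [::] _ s2).
Qed.

Definition seg (a b : R) : set 'rV[R]_1 := [set x | a <= x 0 0 <= b].

Lemma compact_seg a b : compact (seg a b).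
Proof.
have := @rV_compact R 1 (fun=> `[a, b]%classic) (fun=> @segment_compact _ _ _).
congr compact; apply/seteqP; split=> x Hx; first by have := Hx 0; rewrite /= in_itv.
by move=> i; rewrite (ord1 i) /= in_itv.
Qed.

(** The summand 1 keeps the constant positive when a = b. *)
Lemma bounded_integral_seg a b : a <= b ->
  bounded_functional (whole R 1) setT (seg a b) 0 (2 * (b - a) + 1)
    (fun f => integral_seg a b (fun t => f t%:M)).
Proof.
move=> ab; have ab0 : 0 <= b - a by rewrite subr_ge0.
apply: bounded_functional_intro => // [|c f g [sf _] [sg _]|f B [sf _] B0 H].
- by rewrite ltr_wpDl // mulr_ge0.
- exact: (integral_seg_lin a b c (smooth_line sf) (smooth_line sg)).
have H' t : a <= t <= b -> normc (f t%:M) <= B.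
  move=> tab; rewrite -DseqC_nil; apply: H => //.
  by rewrite /seg /= mxE eqxx mulr1n.
rewrite (le_trans (integral_seg_bound ab (smooth_line sf) H')) //.
by rewrite ler_wpM2r // lerDl.
Qed.

Definition integralC m (f : 'rV[R]_m -> R[i]) : R[i] :=
  integralRn (Re \o f) +i* integralRn (Im \o f).

Lemma integralC0 m : @integralC m (fun=> 0) = 0.
Proof.
suff E : integralRn (fun _ : 'rV[R]_m => 0 : R) = 0.
  by rewrite /integralC [X in X +i* _]E [X in _ +i* X]E.
elim: m => //= m IH; under eq_Rintegral do rewrite IH.
by rewrite Rintegral_cst // mul0r.
Qed.

Lemma box_row_mx p m (M : R) (x : 'rV[R]_p) (y : 'rV[R]_m) :
  box M (row_mx x y) <-> box M x /\ box M y.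
Proof.
split=> [H|[H1 H2] i].
  split=> i; first by have := H (lshift m i); rewrite row_mxEl.
  by have := H (rshift p i); rewrite row_mxEr.
by case: (split_ordP i) => j ->; rewrite ?row_mxEl ?row_mxEr.
Qed.

Lemma box_scalar (M t : R) : box M (t%:M : 'rV[R]_1) <-> - M <= t <= M.
Proof.
split=> [/(_ 0)|tM i]; first by rewrite mxE eqxx mulr1n ler_norml.
by rewrite (ord1 i) mxE eqxx mulr1n ler_norml.
Qed.

Lemma integralC_S m (M : R) (f : 'rV[R]_m.+1 -> R[i]) :
  (forall x, ~ box M x -> f x = 0) ->
  integralC f =
  integral_seg (- M) M (fun t => integralC (fun y : 'rV[R]_m => f (row_mx (t%:M : 'rV[R]_1) y))).
Proof.
move=> f0.
have h0 t : ~~ (- M <= t <= M) ->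
    integralC (fun y : 'rV[R]_m => f (row_mx (t%:M : 'rV[R]_1) y)) = 0.
  move=> tM; rewrite (_ : (fun y => _) = fun=> 0) ?integralC0 //.
  apply/funext => y; apply: f0 => H.
  have [/box_scalar Ht _] := (box_row_mx M (t%:M : 'rV[R]_1) y).1 H.
  by rewrite Ht in tM.
rewrite /integral_seg -!Rintegral_supp //.
- by move=> t /h0 /(congr1 Im).
- by move=> t /h0 /(congr1 Re).
Qed.

(** Induction on the dimension. The inner integral is a bounded functional, so
    [functional_parameter_smooth] makes it continuous in the first coordinate; the outer segment of
    length 2 M then contributes 2 (2 M) = 4 M. *)
Lemma bounded_integralC m (M : R) : 0 < M ->
  bounded_functional (whole R m) (box M) (box M) 0 ((4 * M) ^+ m) (@integralC m).
Proof.
move=> M0; have M40 : 0 < 4 * M by rewrite mulr_gt0.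
elim: m => [|m IH].
  have E (f : 'rV[R]_0 -> R[i]) : integralC f = f 0 by rewrite [RHS]complex_eta.
  apply: bounded_functional_intro => // [c f g tf tg|f B tf B0 H].
    by rewrite !E.
  by rewrite E expr0 mul1r -DseqC_nil; apply: H => // -[].
have slice f : testK (whole R m.+1) (box M) f ->
    (forall t : R, testK (whole R m) (box M) (fun y => f (row_mx (t%:M : 'rV[R]_1) y))) /\
    ccontinuous (fun t : R => integralC (fun y : 'rV[R]_m => f (row_mx (t%:M : 'rV[R]_1) y))).
  move=> [sf f0].
  have f0' (x : 'rV[R]_1) (y : 'rV[R]_m) : setT x -> openset_val (whole R m) y ->
      ~ box M y -> f (row_mx x y) = 0.
    move=> _ _ yM; apply: f0 => // H; apply: yM.
    by have [] := (box_row_mx M x y).1 H.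
  split=> [t|].
    have := @testK_slice R 1 m (1 + m) _ _ _ (coord_pairing_row_mx R 1 m) setT (whole R m)
      setT (box M) f openT (fun _ _ _ _ => I) sf f0' [::] t%:M I.
    congr testK; apply/funext => y; exact: DseqC_nil.
  have [sw _] := @functional_parameter_smooth R 1 m (1 + m) _ _ _
    (coord_pairing_row_mx R 1 m) setT (whole R m) setT (box M) (box M) f openT openT
    (fun _ _ _ _ => I) sf f0' (@compact_box R m M) (fun _ _ => I) _ _ _ IH.
  exact: (smooth_line sw).
apply: bounded_functional_intro => //; first by rewrite exprn_gt0.
  move=> c f g tf tg; have tfg := testK_lin c tf tg.
  have [tft cf] := slice f tf; have [tgt cg] := slice g tg.
  rewrite (integralC_S (fun x => tfg.2 x I)) (integralC_S (fun x => tf.2 x I)).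
  rewrite (integralC_S (fun x => tg.2 x I)) -integral_seg_lin //.
  congr integral_seg; apply/funext => t; exact: (IH.1 c _ _ (tft t) (tgt t)).
move=> f B tf B0 H; have [tft cf] := slice f tf.
rewrite (integralC_S (fun x => tf.2 x I)).
have hB t : - M <= t <= M ->
    normc (integralC (fun y : 'rV[R]_m => f (row_mx (t%:M : 'rV[R]_1) y))) <= (4 * M) ^+ m * B.
  move=> tM; have := bounded_functional_le IH (tft t) B0.
  have -> : `|(4 * M) ^+ m| = (4 * M) ^+ m by rewrite ger0_norm // exprn_ge0 // ltW.
  apply.
  move=> y [|//] yM _; rewrite DseqC_nil -[X in normc X]DseqC_nil; apply: H => //.
  apply: (box_row_mx M (t%:M : 'rV[R]_1) y).2; split=> //; exact/box_scalar.
have MM : - M <= M by rewrite (@le_trans _ _ 0) ?oppr_le0 ?ltW.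
rewrite (le_trans (integral_seg_bound MM cf hB)) // exprS; lra.
Qed.

End IntegralFunctionals.

(** * Fubini's theorem for a bounded functional *)

Section Fubini.
Variables (R : realType) (n : nat) (V : openset R n).
Variables (L K : set 'rV[R]_n) (j : nat) (C : R) (T : ('rV[R]_n -> R[i]) -> R[i]).
Hypotheses (cK : compact K) (KV : K `<=` V)
  (bT : bounded_functional V L K j C T).

Definition cylinder m : set 'rV[R]_(m + n) := [set z | openset_val V (rsubmx z)].
Arguments cylinder _ : clear implicits.

Lemma open_cylinder m : open (cylinder m).
Proof.
by apply: open_comp (opensetP V) => z _; exact: continuous_rsubmx.
Qed.

Lemma cylinder_row_mx m (x : 'rV[R]_m) y : openset_val V y -> cylinder m (row_mx x y).
Proof. by rewrite /cylinder /= row_mxKr. Qed.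

Section OneVariable.
Variable g : 'rV[R]_(1 + n) -> R[i].
Hypotheses (sg : smooth (cylinder 1) g)
  (g0 : forall (x : 'rV[R]_1) y, openset_val V y -> ~ L y -> g (row_mx x y) = 0).

Let rm (t : R) (y : 'rV[R]_n) : 'rV[R]_(1 + n) := row_mx (t%:M : 'rV[R]_1) y.
Let G t := fun y => g (rm t y).
Let D b t y := DseqC (map (@rshift 1 n) b) g (rm t y).
Let h c d := fun y => integral_seg c d (fun t => g (rm t y)).
Let phi t := T (G t).

Let gcyl (x : 'rV[R]_1) y : setT x -> openset_val V y -> cylinder 1 (row_mx x y).
Proof. by move=> _; exact: cylinder_row_mx. Qed.

Let D_continuous b y : openset_val V y -> ccontinuous (fun t => D b t y).
Proof.
move=> Vy.
have [s1 _] := @DseqC_right R n 1 (1 + n) _ _ _ (coord_pairing_swap R 1 n) V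
  (whole R 1) (cylinder 1) _ (fun y x Vy _ => gcyl I Vy)
  (smooth_DseqC (map (@rshift 1 n) b) sg) [::] [::] y Vy.
exact: (smooth_line s1).
Qed.

Let hP c d : c <= d -> smooth V (h c d) /\
  forall s y, openset_val V y -> DseqC s (h c d) y = integral_seg c d (fun t => D s t y).
Proof.
move=> cd.
have [a b] := (@functional_parameter_smooth R n 1 (1 + n) _ _ _ (coord_pairing_swap R 1 n)
  V (whole R 1) (cylinder 1) setT (seg c d) g (opensetP V) (@open_cylinder 1)
  (fun y x Vy _ => gcyl I Vy) sg (fun y x _ _ nI => match nI I with end)
  (@compact_seg R c d) (fun _ _ => I) _ _ _ (bounded_integral_seg cd)).
by split=> [|s y Vy]; [exact: a | exact: (b s y Vy)].
Qed.

Let testK_h c d : c <= d -> testK V L (h c d).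
Proof.
move=> cd; split=> [|y Vy Ly]; first by have [] := hP cd.
rewrite /h (_ : (fun t => _) = fun=> 0) ?integral_seg_cst ?mulr0 //.
by apply/funext => t; exact: g0.
Qed.

Let testK_G t : testK V L (G t).
Proof.
have := @testK_slice R 1 n (1 + n) _ _ _ (coord_pairing_row_mx R 1 n) setT V
  (cylinder 1) L g openT gcyl sg (fun x y _ => @g0 x y) [::] t%:M I.
by congr testK; apply/funext => y; exact: DseqC_nil.
Qed.

Let DseqC_G b t y : openset_val V y -> DseqC b (G t) y = D b t y.
Proof.
move=> Vy.
have [_ E] := @DseqC_right R 1 n (1 + n) _ _ _ (coord_pairing_row_mx R 1 n) setT V
  (cylinder 1) g gcyl sg [::] b t%:M I.
have := E y Vy; rewrite cats0 => {}E; rewrite /D -[RHS]E; congr (DseqC b _ y).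
by apply/funext => y'; rewrite DseqC_nil.
Qed.

Let phi_continuous : ccontinuous phi.
Proof.
have [s1 _] := @functional_parameter_smooth R 1 n (1 + n) _ _ _
  (coord_pairing_row_mx R 1 n) setT V (cylinder 1) L K g openT (@open_cylinder 1)
  gcyl sg (fun x y _ => @g0 x y) cK KV _ _ _ bT.
exact: (smooth_line s1).
Qed.

Let delta c d := T (h c d) - integral_seg c d phi.

Let delta_cat a c d : a <= c -> c <= d -> delta a d = delta a c + delta c d.
Proof.
move=> ac cd; have ad := le_trans ac cd.
rewrite /delta (integral_seg_cat ac cd phi_continuous).
have -> : T (h a d) = T (fun y => 1 * h a c y + h c d y).
  apply: (bounded_functional_congr KV bT (testK_h ad)).
    exact: testK_lin (testK_h ac) (testK_h cd).
  move=> y Vy; rewrite mul1r; apply: integral_seg_cat => //.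
  have := D_continuous [::] Vy; congr ccontinuous; apply/funext => t.
  exact: DseqC_nil.
rewrite bT.1; [|exact: testK_h|exact: testK_h].
by rewrite mul1r opprD addrACA.
Qed.

Let delta_bound c d s0 (e : R) : c <= d -> 0 <= e ->
  (forall t, c <= t <= d -> forall b, (size b <= j)%N -> forall y, K y ->
     normc (D b t y - D b s0 y) <= e) ->
  normc (delta c d) <= 4 * `|C| * e * (d - c).
Proof.
move=> cd e0 H; have dc0 : 0 <= d - c by rewrite subr_ge0.
(* Both terms of the defect are compared with (d - c) times the value of [phi] at the reference
   point s0; each error is at most 2 |C| e (d - c). *)
have -> : delta c d = (T (h c d) - (d - c)%:C * phi s0) -
    (integral_seg c d phi - (d - c)%:C * phi s0).
  by rewrite /delta; ring.
have b1 : normc (T (h c d) - (d - c)%:C * phi s0) <= `|C| * (2 * (d - c) * e).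
  have -> : T (h c d) - (d - c)%:C * phi s0 =
      T (fun y => (- (d - c)%:C) * G s0 y + h c d y).
    by rewrite bT.1; [rewrite mulNr addrC|exact: testK_G|exact: testK_h].
  apply: (bounded_functional_le bT).
  - by apply: testK_lin; [exact: testK_G|exact: testK_h].
  - by rewrite !mulr_ge0.
  - move=> y b Ky bj; have Vy := KV Ky; have [sh Eh] := hP cd.
    rewrite (DseqC_lin _ b (opensetP V) (testK_G s0).1 sh Vy) Eh // DseqC_G //.
    rewrite mulNr addrC -integral_seg_cst // -integral_segB; last 2 first.
    + exact: D_continuous.
    + exact: ccontinuous_cst.
    apply: integral_seg_bound => //.
      rewrite (_ : (fun t => _) = fun t => (-1) * D b s0 y + D b t y).
        by apply: ccontinuous_lin; [exact: ccontinuous_cst|exact: D_continuous].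
      by apply/funext => t; rewrite mulN1r addrC.
    by move=> t tcd; exact: H.
have b2 : normc (integral_seg c d phi - (d - c)%:C * phi s0) <= 2 * (d - c) * (`|C| * e).
  rewrite -integral_seg_cst // -integral_segB; last 2 first.
  - exact: phi_continuous.
  - exact: ccontinuous_cst.
  apply: integral_seg_bound => //.
    rewrite (_ : (fun t => _) = fun t => (-1) * phi s0 + phi t).
      by apply: ccontinuous_lin; [exact: ccontinuous_cst|exact: phi_continuous].
    by apply/funext => t; rewrite mulN1r addrC.
  move=> t tcd; rewrite /phi -(bounded_functionalB bT (testK_G t) (testK_G s0)).
  have E : (fun y => G t y - G s0 y) = (fun y => (-1) * G s0 y + G t y).
    by apply/funext => y; rewrite mulN1r addrC.
  apply: (bounded_functional_le bT) => //.
    by rewrite E; apply: testK_lin; exact: testK_G.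
  move=> y b Ky bj; have Vy := KV Ky; rewrite E.
  rewrite (DseqC_lin _ b (opensetP V) (testK_G s0).1 (testK_G t).1 Vy).
  by rewrite !DseqC_G // mulN1r addrC; exact: H.
rewrite (le_trans (le_normcD _ _)) // normcN.
have -> : 4 * `|C| * e * (d - c) = `|C| * (2 * (d - c) * e) + 2 * (d - c) * (`|C| * e).
  by ring.
exact: lerD.
Qed.

(* The defect delta is additive over adjacent intervals and, by delta_bound, of
   size o(d - c) on [c, d], hence it vanishes. *)
Lemma functional_integral_seg a b : a <= b ->
  T (h a b) = integral_seg a b phi.
Proof.
move=> ab; apply/eqP; rewrite -subr_eq0; apply/eqP; rewrite -/(delta a b).
(* Freezing [psi] to the left of a gives a function on the whole line, whose derivative is shown to
   vanish everywhere. *)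
pose psi s := delta a (Num.max a s).
have daa : delta a a = 0.
  have := delta_cat (lexx a) (lexx a) => /eqP.
  by rewrite -subr_eq0 opprD addrA subrr sub0r oppr_eq0 => /eqP.
have key s0 (e : R) : 0 < e -> \forall k \near (0 : R),
    normc (psi (s0 + k) - psi s0) <= e * `|k|.
  move=> e0; have [as0|s0a] := leP a s0; last first.
    apply/nbhs_ballP; exists (a - s0); first by rewrite /= subr_gt0.
    move=> k; rewrite -ball_normE /= sub0r normrN => kr.
    have sk : s0 + k < a by have := ler_norm k; lra.
    rewrite /psi !max_l ?(ltW s0a) ?(ltW sk) // subrr normc0.
    by rewrite mulr_ge0 // ltW.
  pose e' := e / (4 * `|C| + 1).
  have e'0 : 0 < e' by rewrite divr_gt0 // ltr_wpDl // mulr_ge0.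
  have e'e : 4 * `|C| * e' <= e.
    rewrite /e' mulrA ler_pdivrMr ?ltr_wpDl ?mulr_ge0 //.
    by rewrite mulrDr mulr1 mulrC lerDl ltW.
  have N := @slice_uniform R 1 n (1 + n) _ _ _ (coord_pairing_row_mx R 1 n) setT V
    (cylinder 1) K g gcyl sg cK KV j [::] (s0%:M) e' I e'0.
  have /nbhs_ballP [r /= r0 hr] := @continuous_scalar_mx R s0 _ N.
  apply/nbhs_ballP; exists r => //= k; rewrite -ball_normE /= sub0r normrN => kr.
  have hr' t : `|t - s0| <= `|k| -> forall b, (size b <= j)%N -> forall y, K y ->
     normc (D b t y - D b s0 y) <= e'.
    move=> tk c cj y Ky.
    have Bt : ball s0 r t by rewrite -ball_normE /= distrC (le_lt_trans tk).
    by have := hr t Bt c cj y Ky; rewrite /= cats0.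
  have klo : - `|k| <= k <= `|k| by rewrite -ler_norml.
  rewrite /psi [Num.max a s0]max_r //.
  set v := Num.max a (s0 + k).
  have av : a <= v by rewrite le_max lexx.
  have vk : `|v - s0| <= `|k|.
    rewrite /v; case: (leP a (s0 + k)) => ask.
      by rewrite addrAC subrr add0r.
    rewrite ler_norml; lra.
  move: vk; rewrite ler_norml => /andP[vk1 vk2].
  have fin c d : c <= d -> d - c <= `|k| -> - `|k| <= c - s0 -> d - s0 <= `|k| ->
      normc (delta c d) <= e * `|k|.
    move=> cd dck c1 d1.
    rewrite (le_trans (@delta_bound c d s0 e' cd (ltW e'0) _)) //.
      move=> t /andP[t1 t2]; apply: hr'; rewrite ler_norml; lra.
    by rewrite ler_pM // ?mulr_ge0 ?subr_ge0 // ltW.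
  have [s0v|vs0] := leP s0 v.
    rewrite (delta_cat as0 s0v) addrAC subrr add0r.
    by apply: fin => //; lra.
  rewrite (delta_cat av (ltW vs0)) opprD addrA subrr sub0r normcN.
  by apply: fin; lra.
have cst (p : R -> R) : (forall s0 (e : R), 0 < e -> \forall k \near (0 : R),
    `|p (s0 + k) - p s0| <= e * `|k|) -> p b = p a.
  move=> Hp; apply: is_derive_0_is_cst => s0; apply: is_derive_approx => e e0.
  apply: filterS (Hp s0 e e0) => k.
  by rewrite mulr0 subr0 [k *: 1]mulr1.
have psia : psi a = 0 by rewrite /psi maxxx daa.
have -> : delta a b = psi b by rewrite /psi max_r.
rewrite [LHS]complex_eta.
rewrite (cst (fun s => complex.Re (psi s))).
  rewrite (cst (fun s => complex.Im (psi s))) ?psia // => s0 e e0.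
  apply: filterS (key s0 e e0) => k; apply: le_trans.
  by rewrite -Im_opp -Im_add; exact: normc_Im.
move=> s0 e e0; apply: filterS (key s0 e e0) => k; apply: le_trans.
by rewrite -Re_opp -Re_add; exact: normc_Re.
Qed.

End OneVariable.

Lemma functional0 : T (fun=> 0) = 0.
Proof.
have t0 : testK V L (fun=> 0) by split=> //; exact: smooth0 (opensetP V).
by have := bounded_functionalB bT t0 t0; rewrite !subrr.
Qed.

(** Induction on m: integrating out all variables but the first one, t, leaves a function g of (t,
    y), for which T commutes with the segment integral; then the induction hypothesis is applied
    with t frozen. *)
Lemma fubini_functional m (M : R) (f : 'rV[R]_(m + n) -> R[i]) : 0 < M ->
  smooth (cylinder m) f ->
  (forall x y, ~ box M x -> f (row_mx x y) = 0) ->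
  (forall x y, openset_val V y -> ~ L y -> f (row_mx x y) = 0) ->
  T (fun y => integralC (fun x : 'rV[R]_m => f (row_mx x y))) =
  integralC (fun x : 'rV[R]_m => T (fun y => f (row_mx x y))).
Proof.
move=> M0; elim: m f => [|m IH] f sf fM fL.
  have E (g : 'rV[R]_0 -> R[i]) : integralC g = g 0 by rewrite [RHS]complex_eta.
  by rewrite E; congr T; apply/funext => y; rewrite E.
have MM : - M <= M by rewrite (@le_trans _ _ 0) ?oppr_le0 ?ltW.
have fM' (t : 'rV[R]_1) (x : 'rV[R]_m) y : ~ box M x ->
    f (row_mx (row_mx t x) y) = 0.
  by move=> xM; apply: fM => H; apply: xM; have [] := (box_row_mx M t x).1 H.
pose g (z : 'rV[R]_(1 + n)) : R[i] := integralC (fun x : 'rV[R]_m =>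
  f (row_mx (row_mx (lsubmx z) x) (rsubmx z))).
have gE (t : 'rV[R]_1) y : g (row_mx t y) =
    integralC (fun x : 'rV[R]_m => f (row_mx (row_mx t x) y)).
  by rewrite /g row_mxKl row_mxKr.
have sg : smooth (cylinder 1) g.
  have [s1 _] := @functional_parameter_smooth R (1 + n) m (1 + m + n) _ _ _
    (coord_pairing_outer R 1 m n) (cylinder 1) (whole R m) (cylinder (1 + m))
    (box M) (box M) f (@open_cylinder 1) (@open_cylinder (1 + m))
    (fun z x (Vz : cylinder 1 z) _ => cylinder_row_mx _ Vz) sf
    (fun z x _ _ xM => fM' _ _ _ xM)
    (@compact_box R m M) (fun _ _ => I) _ _ _ (bounded_integralC m M0).
  exact: s1.
have gL (t : 'rV[R]_1) y : openset_val V y -> ~ L y -> g (row_mx t y) = 0.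
  move=> Vy Ly; rewrite gE (_ : (fun x => _) = fun=> 0) ?integralC0 //.
  by apply/funext => x; exact: fL.
have -> : (fun y => integralC (fun x : 'rV[R]_m.+1 => f (row_mx x y))) =
    (fun y => integral_seg (- M) M (fun t => g (row_mx (t%:M : 'rV[R]_1) y))).
  apply/funext => y; rewrite (@integralC_S R m M) => [|x xM]; last exact: fM.
  by congr integral_seg; apply/funext => t; rewrite gE.
rewrite (functional_integral_seg sg gL MM) (@integralC_S R m M); last first.
  move=> x xM; rewrite -[RHS]functional0; congr T; apply/funext => y; exact: fM.
congr integral_seg; apply/funext => t.
pose ft (z : 'rV[R]_(m + n)) := f (row_mx (row_mx (t%:M : 'rV[R]_1) (lsubmx z)) (rsubmx z)).
have ftE (x : 'rV[R]_m) y : ft (row_mx x y) = f (row_mx (row_mx (t%:M : 'rV[R]_1) x) y).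
  by rewrite /ft row_mxKl row_mxKr.
have sft : smooth (cylinder m) ft.
  have [s1 _] := @DseqC_right R 1 (m + n) (1 + m + n) _ _ _
    (coord_pairing_first R 1 m n) setT (OpenSet (@open_cylinder m)) (cylinder (1 + m))
    f (fun _ z _ (Vz : cylinder m z) => cylinder_row_mx _ Vz) sf [::] [::] t%:M I.
  have [s2 _] := smooth_congr (@open_cylinder m) (fun z _ => DseqC_nil f _) s1.
  exact: s2.
transitivity (T (fun y => integralC (fun x : 'rV[R]_m => ft (row_mx x y)))).
  by congr T; apply/funext => y; rewrite gE; congr integralC; apply/funext => x; rewrite ftE.
rewrite IH //; first by congr integralC; apply/funext => x; congr T; apply/funext => y; rewrite ftE.
- by move=> x y xM; rewrite ftE; exact: fM'.
- by move=> x y Vy Ly; rewrite ftE; exact: fL.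
Qed.

End Fubini.

(** * Nets and their estimates *)

Section Bounds.
Variables (R : realType) (n : nat) (Om : openset R n).
Implicit Types (K U : set 'rV[R]_n) (v w : R -> 'rV[R]_n -> R[i]) (s : seq 'I_n).

Definition Obound K s v (b : R) : Prop :=
  exists C, \forall e \near (0 : R)^'+, forall x, K x ->
    normc (DseqC s (v e) x) <= C * e `^ b.

Definition smooth_net v : Prop := forall e : R, 0 < e <= 1 -> smooth Om (v e).

Lemma Obound_pos K s v b : Obound K s v b -> exists2 C, 0 <= C &
  \forall e \near (0 : R)^'+, forall x, K x ->
    normc (DseqC s (v e) x) <= C * e `^ b.
Proof.
case=> C H; exists `|C| => //; apply: filterS H => e He x Kx.
by rewrite (le_trans (He x Kx)) // ler_wpM2r ?powR_ge0 // ler_norm.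
Qed.

Lemma Obound_supD K a v b :
  bigOpow (fun e => supD K a (v e)) b <-> Obound K (mseq a) v b.
Proof.
split=> [[C H]|/Obound_pos [C C0 H]]; exists C; apply: filterS H => e He.
  by move=> x Kx; rewrite -lee_fin (le_trans _ He) //; apply: nnsup_ub; exists x.
apply: nnsup_le => [|_ [x Kx <-]]; first by rewrite lee_fin mulr_ge0 ?powR_ge0.
by rewrite lee_fin; exact: He.
Qed.

Lemma Obound_sub K K' s v b : K `<=` K' -> Obound K' s v b -> Obound K s v b.
Proof. by move=> KK' [C H]; exists C; apply: filterS H => e He x /KK'; exact: He. Qed.

Lemma Obound_weak K s v b b' : b' <= b -> Obound K s v b -> Obound K s v b'.
Proof.
move=> bb' /Obound_pos [C C0 H]; exists C.
apply: filterS2 H (near_unit R) => e He e01 x Kx.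
by rewrite (le_trans (He x Kx)) // ler_wpM2l // ger_powR.
Qed.

Lemma Obound_near K s v w b : K `<=` Om -> smooth_net v ->
  (\forall e \near (0 : R)^'+, forall x, openset_val Om x -> v e x = w e x) ->
  Obound K s v b -> Obound K s w b.
Proof.
move=> KOm sv vw [C H]; exists C.
apply: filterS3 H vw (near_unit R) => e He ve e01 x Kx.
have [_ E] := smooth_congr (opensetP Om) ve (sv e e01).
by rewrite E; [exact: He | exact: KOm].
Qed.

Lemma Obound_perm K s s' v b : K `<=` Om -> smooth_net v -> perm_eq s s' ->
  Obound K s v b -> Obound K s' v b.
Proof.
move=> KOm sv ss' [C H]; exists C.
apply: filterS2 H (near_unit R) => e He e01 x Kx.
by rewrite -(DseqC_perm (opensetP Om) (sv e e01) ss' (KOm _ Kx)); exact: He.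
Qed.

Lemma Obound_lin K s v w (c : R -> R[i]) b : K `<=` Om ->
  smooth_net v -> smooth_net w -> bigOpow (fun e => (normc (c e))%:E) 0 ->
  Obound K s v b -> Obound K s w b ->
  Obound K s (fun e x => c e * v e x + w e x) b.
Proof.
move=> KOm sv sw /bigOpow_pos [C0 C00 H0] /Obound_pos [C1 C10 H1] [C2 H2]; exists (C0 * C1 + C2).
near=> e => x Kx; have e01 : 0 < e <= 1 by near: e; exact: near_unit.
rewrite (DseqC_lin _ _ (opensetP Om) (sv e e01) (sw e e01) (KOm _ Kx)).
rewrite (le_trans (le_normcD _ _)) // normcM mulrDl lerD //; last first.
  by move: x Kx; near: e.
have h0 : normc (c e) <= C0.
  have : ((normc (c e))%:E <= (C0 * e `^ 0)%:E)%E by near: e.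
  by rewrite powRr0 mulr1 lee_fin.
have h1 : normc (DseqC s (v e) x) <= C1 * e `^ b by move: x Kx; near: e.
by rewrite -mulrA ler_pM // normc_ge0.
Unshelve. all: by end_near. Qed.

Lemma bigOpow_cst (z : R[i]) : bigOpow (fun=> (normc z)%:E) 0.
Proof. by exists (normc z); near=> e; rewrite powRr0 mulr1. Unshelve. all: by end_near. Qed.

Lemma OboundM K s v w b1 b2 : K `<=` Om -> smooth_net v -> smooth_net w ->
  (forall p, p \in splits s -> Obound K p.1 v b1) ->
  (forall p, p \in splits s -> Obound K p.2 w b2) ->
  Obound K s (fun e x => v e x * w e x) (b1 + b2).
Proof.
move=> KOm sv sw.
have H (l : seq (seq 'I_n * seq 'I_n)) :
    (forall p, p \in l -> Obound K p.1 v b1) ->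
    (forall p, p \in l -> Obound K p.2 w b2) ->
    exists C, \forall e \near (0 : R)^'+, forall x, K x ->
      \sum_(p <- l) normc (DseqC p.1 (v e) x * DseqC p.2 (w e) x) <= C * e `^ (b1 + b2).
  elim: l => [|p l IH] Hv Hw.
    by exists 0; near=> e => x _; rewrite big_nil mul0r.
  have [|C IH'] := IH (fun q ql => Hv q (mem_behead (s := p :: l) ql)).
    by move=> q ql; apply: Hw; rewrite inE ql orbT.
  have [C1 C10 H1] := Obound_pos (Hv p (mem_head _ _)).
  have [C2 C20 H2] := Obound_pos (Hw p (mem_head _ _)).
  exists (C1 * C2 + C); near=> e => x Kx.
  rewrite big_cons mulrDl lerD //; last by move: x Kx; near: e.
  have e0 : e != 0 by apply: lt0r_neq0; near: e; exact: nbhs_right_gt.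
  rewrite normcM powRD ?e0 ?implybT // mulrACA ler_pM ?normc_ge0 //.
    by move: x Kx; near: e.
  by move: x Kx; near: e.
move=> Hv Hw; have [C HC] := H _ Hv Hw; exists C.
near=> e => x Kx; have e01 : 0 < e <= 1 by near: e; exact: near_unit.
have [_ ->] := smoothM (opensetP Om) (sv e e01) (sw e e01); last exact: KOm.
by rewrite (le_trans (normc_sum _ _)) //; move: x Kx; near: e.
Unshelve. all: by end_near. Qed.

Lemma Gmoderate_smooth v : Gmoderate Om v -> smooth_net v. Proof. by case. Qed.

Lemma Gmoderate_Obound v K s : Gmoderate Om v -> compact K -> K `<=` Om ->
  exists N : nat, Obound K s v (- N%:R).
Proof.
move=> [sv H] cK KOm; have [N /Obound_supD HN] := H K cK KOm (mcount s).
exists N; apply: Obound_perm HN => //; rewrite perm_sym; exact: perm_mseq.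
Qed.

Lemma Gmoderate_intro v : smooth_net v ->
  (forall K, compact K -> K `<=` Om -> forall s, exists N : nat, Obound K s v (- N%:R)) ->
  Gmoderate Om v.
Proof.
move=> sv H; split=> // K cK KOm a; have [N HN] := H K cK KOm (mseq a).
by exists N; apply/Obound_supD.
Qed.

Lemma Gnegligible_Obound v U K s (b : R) : U `<=` Om -> smooth_net v ->
  Gnegligible U v -> compact K -> K `<=` U -> Obound K s v b.
Proof.
move=> UOm sv H cK KU.
have [q bq] : exists q : nat, b <= q%:R.
  by exists (Num.truncn `|b|).+1; rewrite (le_trans (ler_norm _)) // ltW // truncnS_gt.
have /Obound_supD Hq := H K cK KU (mcount s) q.
apply: Obound_weak bq _; apply: Obound_perm Hq => //; first exact: subset_trans UOm.
by rewrite perm_sym; exact: perm_mseq.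
Qed.

Lemma Gnegligible_intro v U :
  (forall K, compact K -> K `<=` U -> forall s (q : nat), Obound K s v q%:R) ->
  Gnegligible U v.
Proof. by move=> H K cK KU a q; apply/Obound_supD; exact: H. Qed.

Lemma Gclass_near v w : Gmoderate Om v -> Gmoderate Om w ->
  (\forall e \near (0 : R)^'+, forall x, openset_val Om x -> v e x = w e x) ->
  Gclass Om v = Gclass Om w.
Proof.
move=> mv mw vw; apply: Gclass_eq => //; apply: Gnegligible_intro => K cK KOm s q.
exists 0; near=> e => x Kx; rewrite mul0r (@DseqC_eq0 _ _ Om) ?normc0 //.
- exact: opensetP.
- suff H : forall y, openset_val Om y -> v e y = w e y.
    by move=> y /H ->; rewrite subrr.
  by near: e.
- exact: KOm.
Unshelve. all: by end_near. Qed.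

(** Two representatives differ by a negligible net, which is O(e^b) for every b. *)
Lemma Obound_rep v K s b : Gmoderate Om v -> compact K -> K `<=` Om ->
  Obound K s (Grepr (Gclass Om v)) b <-> Obound K s v b.
Proof.
move=> mv cK KOm.
have sv := Gmoderate_smooth mv.
have sr := Gmoderate_smooth (Gmoderate_repr (Gclass Om v)).
have ng := GclassP mv.
have sd : smooth_net (fun e x => Grepr (Gclass Om v) e x - v e x).
  move=> e e01; have := smooth_lin (-1) (opensetP Om) (sv e e01) (sr e e01).
  by congr smooth; apply/funext => x; rewrite mulN1r addrC.
have hd := Gnegligible_Obound s b (fun x => id) sd ng cK KOm.
split=> H.
  have := Obound_lin KOm sd sr (bigOpow_cst (-1)) hd H.
  congr Obound; apply/funext => e; apply/funext => x.
  by rewrite mulN1r opprB subrK.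
have := Obound_lin KOm sd sv (bigOpow_cst 1) hd H.
congr Obound; apply/funext => e; apply/funext => x.
by rewrite mul1r subrK.
Qed.

(* The two scales of estimates: order of growth depending on the derivative
   ([false], for G) or not ([true], for G^oo). *)
Definition moderate_on (inf : bool) K v : Prop :=
  if inf then exists N : nat, forall s, Obound K s v (- N%:R)
  else forall s, exists N : nat, Obound K s v (- N%:R).

Definition Gmod inf v : Prop := smooth_net v /\
  forall K, compact K -> K `<=` Om -> moderate_on inf K v.

Lemma Gmod_moderate inf v : Gmod inf v -> Gmoderate Om v.
Proof.
move=> [sv H]; apply: Gmoderate_intro => // K cK KOm s.
have := H K cK KOm; case: inf {H} => [[N HN]|]; first by exists N.
exact.
Qed.

Lemma Gmod_false v : Gmod false v <-> Gmoderate Om v.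
Proof.
split=> [|mv]; first exact: Gmod_moderate.
by split=> [|K cK KOm s]; [exact: Gmoderate_smooth | exact: Gmoderate_Obound].
Qed.

Lemma Ginf_Gmod u : Ginf u -> exists2 v, Gmod true v & Gclass Om v = u.
Proof.
move=> [v [mv vu H]]; exists v => //; split; first exact: Gmoderate_smooth.
move=> K cK KOm; have [N HN] := H K cK KOm; exists N => s.
have /Obound_supD Hs := HN (mcount s).
apply: Obound_perm Hs => //; first exact: Gmoderate_smooth.
by rewrite perm_sym; exact: perm_mseq.
Qed.

Lemma Gmod_Ginf v : Gmod true v -> Ginf (Gclass Om v).
Proof.
move=> mv; exists v; split=> //; first exact: Gmod_moderate mv.
move=> K cK KOm; have [N HN] := mv.2 K cK KOm; exists N => a.
by apply/Obound_supD.
Qed.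

Fixpoint seqs_upto (j : nat) : seq (seq 'I_n) :=
  if j is j'.+1 then
    [::] :: [seq i :: b | i <- enum 'I_n, b <- seqs_upto j']
  else [:: [::]].

Lemma mem_seqs_upto j s : (size s <= j)%N -> s \in seqs_upto j.
Proof.
elim: j s => [|j IH] [|i s] //= sj; rewrite inE /=.
by apply/allpairsP; exists (i, s); rewrite mem_enum; split=> //; exact: IH.
Qed.

(** The sets of derivatives that define one seminorm: bounded order for G, all derivatives at once
    for G^oo. *)
Definition admissible (inf : bool) (A : set (seq 'I_n)) : Prop :=
  if inf then A = setT else exists j, A = [set s | (size s <= j)%N].

End Bounds.

Section UniformBounds.
Variables (R : realType) (n : nat).
Implicit Types (K : set 'rV[R]_n) (v : R -> 'rV[R]_n -> R[i]).

Lemma Obound_seq (m : nat) K v (b : R) (F : seq 'I_m -> seq 'I_n) j :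
  (forall c, (size c <= j)%N -> Obound K (F c) v b) ->
  exists2 C, 0 <= C & \forall e \near (0 : R)^'+, forall c, (size c <= j)%N ->
    forall x, K x -> normc (DseqC (F c) (v e) x) <= C * e `^ b.
Proof.
move=> H.
have {}H c : exists C, (size c <= j)%N -> 0 <= C /\
    \forall e \near (0 : R)^'+, forall x, K x ->
      normc (DseqC (F c) (v e) x) <= C * e `^ b.
  have [cj|_] := boolP (size c <= j)%N; last by exists 0.
  by have [C C0 HC] := Obound_pos (H c cj); exists C.
have [C HC] := choice H.
pose D := \sum_(c <- seqs_upto m j) `|C c|.
exists D; first by apply: sumr_ge0.
have H0 : \forall e \near (0 : R)^'+, forall c, (size c <= j)%N ->
    (size c <= j)%N -> forall x, K x -> normc (DseqC (F c) (v e) x) <= D * e `^ b.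
  apply: (@near_seqs _ _ m j (fun c e => (size c <= j)%N -> forall x, K x ->
    normc (DseqC (F c) (v e) x) <= D * e `^ b)) => c.
  have [cj|cj] := boolP (size c <= j)%N; last by apply: nearW.
  have [C0 {}HC] := HC c cj.
  apply: filterS HC => e He _ x Kx; rewrite (le_trans (He x Kx)) //.
  rewrite ler_wpM2r ?powR_ge0 // /D (big_rem c) /=; last exact: mem_seqs_upto.
  by rewrite (le_trans (ler_norm _)) // lerDl; apply: sumr_ge0.
by apply: filterS H0 => e He c cj; exact: He.
Qed.

(** For G the exponent varies with the derivative, so boundedly many derivatives are allowed and
    their exponents are added up. *)
Lemma moderate_on_set inf K v (B : set (seq 'I_n)) : moderate_on inf K v ->
  (inf \/ exists m, forall s, B s -> (size s <= m)%N) ->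
  exists N : nat, forall s, B s -> Obound K s v (- N%:R).
Proof.
case: inf => [[N HN] _|H [//|[m Bm]]]; first by exists N.
have [f Hf] := choice H.
exists (\sum_(s <- seqs_upto n m) f s)%N => s Bs.
apply: Obound_weak (Hf s); rewrite lerN2 ler_nat.
rewrite (big_rem s) ?leq_addr //; apply: mem_seqs_upto; exact: Bm.
Qed.

End UniformBounds.

(** * Families obtained by applying a net of functionals to the slices of a net *)

Section ParameterFamily.
Variables (R : realType) (n N : nat).
Variables (iota : 'rV[R]_n -> 'rV[R]_n -> 'rV[R]_N) (s1 s2 : 'I_n -> 'I_N).
Hypothesis Hiota : coord_pairing iota s1 s2.
Variables (Om : openset R n) (W : openset R N).
Hypothesis iotaW : forall x y, openset_val Om x -> openset_val Om y ->
  openset_val W (iota x y).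
Implicit Types (K L U : set 'rV[R]_n) (kap : R -> 'rV[R]_N -> R[i])
  (Te : R -> ('rV[R]_n -> R[i]) -> R[i]).

(** The bound for each single e gives smoothness in the parameter; the bound for small e, with
    common K and j and a power of e, gives moderateness. *)
Definition functional_net L Te : Prop :=
  (forall e : R, 0 < e <= 1 -> exists K j C,
     [/\ compact K, K `<=` Om & bounded_functional Om L K j C (Te e)]) /\
  exists K j (M : nat), [/\ compact K, K `<=` Om &
     \forall e \near (0 : R)^'+, bounded_functional Om L K j (e `^ (- M%:R)) (Te e)].

Definition fibred kap U L : Prop := forall e x y, 0 < e <= 1 -> U x ->
  openset_val Om y -> ~ L y -> kap e (iota x y) = 0.

Definition slice kap s (x : 'rV[R]_n) (e : R) (y : 'rV[R]_n) : R[i] :=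
  DseqC (map s1 s) (kap e) (iota x y).

Definition param_family Te kap (e : R) (x : 'rV[R]_n) : R[i] :=
  Te e (fun y => kap e (iota x y)).

Lemma compact_image2 K K' : compact K -> compact K' ->
  compact [set iota p.1 p.2 | p in K `*` K'].
Proof.
move=> cK cK'; apply: continuous_compact; last exact: compact_setX.
by apply: continuous_subspaceT => z; have [cI _ _] := Hiota; exact: cI.
Qed.

Lemma image2_sub K K' : K `<=` Om -> K' `<=` Om ->
  [set iota p.1 p.2 | p in K `*` K'] `<=` W.
Proof. by move=> KOm K'Om _ [[x y] [/= Kx K'y] <-]; apply: iotaW; [exact: KOm|exact: K'Om]. Qed.

Section Fixed.
Variables (Te : R -> ('rV[R]_n -> R[i]) -> R[i]) (kap : R -> 'rV[R]_N -> R[i])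
  (U L : set 'rV[R]_n).
Hypotheses (oU : open U) (UOm : U `<=` Om) (sk : smooth_net W kap)
  (kUL : fibred kap U L) (TL : functional_net L Te).

Let UW x y : U x -> openset_val Om y -> openset_val W (iota x y).
Proof. by move=> /UOm; exact: iotaW. Qed.

Lemma family_smooth e : 0 < e <= 1 -> smooth U (param_family Te kap e) /\
  forall s x, U x -> DseqC s (param_family Te kap e) x = Te e (slice kap s x e).
Proof.
move=> e01; have [K [j [C [cK KOm bT]]]] := TL.1 e e01.
exact: (@functional_parameter_smooth R n n N iota s1 s2 Hiota U Om W L K
  (kap e) oU (opensetP W) UW (sk e01) (fun x y => kUL e01) cK KOm j C _ bT).
Qed.

Lemma slice_testK s x e : 0 < e <= 1 -> U x -> testK Om L (slice kap s x e).
Proof.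
move=> e01 Ux.
exact: (@testK_slice R n n N iota s1 s2 Hiota U Om W L (kap e) oU UW (sk e01)
  (fun x y => kUL e01) s x Ux).
Qed.

Lemma DseqC_slice s b x y e : 0 < e <= 1 -> U x -> openset_val Om y ->
  DseqC b (slice kap s x e) y = DseqC (map s2 b ++ map s1 s) (kap e) (iota x y).
Proof.
move=> e01 Ux Vy.
have [_ E] := @DseqC_right R n n N iota s1 s2 Hiota U Om W (kap e) UW (sk e01) s b x Ux.
exact: E.
Qed.

(** K2, j and the loss M depend on the functionals alone and not on the derivative s; this is what
    preserves the estimates of G^oo. *)
Lemma family_Obound : exists K2 j (M : nat), [/\ compact K2, K2 `<=` Om &
  forall K s (b : R), K `<=` U ->
  (forall c, (size c <= j)%N ->
     Obound [set iota p.1 p.2 | p in K `*` K2] (map s2 c ++ map s1 s) kap b) ->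
  Obound K s (param_family Te kap) (- M%:R + b)].
Proof.
have [K2 [j [M [cK2 K2Om nT]]]] := TL.2; exists K2, j, M; split=> // K s b KU H.
have [C C0 HC] : exists2 C, 0 <= C & \forall e \near (0 : R)^'+,
    forall c, (size c <= j)%N -> forall z, [set iota p.1 p.2 | p in K `*` K2] z ->
      normc (DseqC (map s2 c ++ map s1 s) (kap e) z) <= C * e `^ b.
  exact: Obound_seq.
exists C; near=> e => x Kx; have e01 : 0 < e <= 1 by near: e; exact: near_unit.
have [_ ->] := family_smooth e01; last exact: KU.
have bT : bounded_functional Om L K2 j (e `^ (- M%:R)) (Te e) by near: e.
have e0 : e != 0 by apply: lt0r_neq0; case/andP: e01.
rewrite powRD ?e0 ?implybT // mulrCA.
have := bounded_functional_le bT (slice_testK s e01 (KU _ Kx)).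
move=> /(_ (C * e `^ b)); rewrite [`|_ `^ _|]ger0_norm ?powR_ge0 //; apply.
  by rewrite mulr_ge0 ?powR_ge0.
move=> y c K2y cj; rewrite (DseqC_slice _ _ e01 (KU _ Kx) (K2Om _ K2y)).
have Hz : [set iota p.1 p.2 | p in K `*` K2] (iota x y) by exists (x, y).
by move: c cj (iota x y) Hz; near: e.
Unshelve. all: by end_near. Qed.

End Fixed.

Lemma family_Gmod inf Te kap : Gmod W inf kap ->
  (forall K, compact K -> K `<=` Om -> exists U L, [/\ open U, K `<=` U, U `<=` Om,
     fibred kap U L & functional_net L Te]) ->
  Gmod Om inf (param_family Te kap).
Proof.
move=> [sk mk] H; split=> [e e01|K cK KOm].
  apply: smooth_local => x Ox.
  have [||U [L [oU xU UOm kUL TL]]] := H [set x]; first exact: compact_set1.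
    by move=> _ ->.
  exists U, (param_family Te kap e); last by [].
  by split=> //; [exact: xU | have [] := family_smooth oU UOm sk kUL TL e01].
have [U [L [oU KU UOm kUL TL]]] := H K cK KOm.
have [K2 [j [M [cK2 K2Om HO]]]] := family_Obound oU UOm sk kUL TL.
have := mk _ (compact_image2 cK cK2) (image2_sub KOm K2Om).
case: inf {mk} => [[N1 HN1]|mk].
  exists (M + N1)%N => s; rewrite natrD opprD; exact: HO.
move=> s.
have [|N1 HN1] := @moderate_on_set _ _ false _ kap
   [set map s2 c ++ map s1 s | c in [set c | (size c <= j)%N]] mk.
  right; exists (j + size s)%N => _ [c cj <-].
  by rewrite size_cat !size_map leq_add2r.
exists (M + N1)%N; rewrite natrD opprD; apply: HO => // c cj.
by apply: HN1; exists c.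
Qed.

End ParameterFamily.

(** * Pullbacks along coordinate projections and extension by zero *)

Section Pullback.
Variables (R : realType) (N n : nat).
Variables (pi : 'rV[R]_N -> 'rV[R]_n) (tau : 'I_N -> option 'I_n).
Hypotheses (cpi : continuous pi)
  (spi : forall z k (h : R), pi (z + h *: delta_mx 0 k) =
     if tau k is Some i then pi z + h *: delta_mx 0 i else pi z).

(** [tau] sends a coordinate to its image, or to [None] if [pi] ignores it. An iterated derivative
    of the pullback is therefore zero as soon as one ignored coordinate occurs, and otherwise the
    pullback of a derivative of g. *)
Lemma smooth_pullback (U : set 'rV[R]_n) (g : 'rV[R]_n -> R[i]) : open U ->
  smooth U g -> smooth (pi @^-1` U) (fun z => g (pi z)).
Proof.
move=> oU sg.
have oP : open (pi @^-1` U) by apply: open_comp oU => z _; exact: cpi.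
pose D s z := if all (fun k => tau k : bool) s then DseqC (pmap tau s) g (pi z) else 0.
have der (q : 'rV[R]_n -> R) z k (d : 'I_n -> R) :
    (forall i, is_derive (pi z) (delta_mx 0 i) q (d i)) ->
    is_derive z (delta_mx 0 k) (fun z => q (pi z)) (if tau k is Some i then d i else 0).
  move=> dq; have := spi z k; case: (tau k) => [i|] E.
    have [d1 d2] := dq i.
    have Q : (fun h : R => h^-1 *: (q (pi (h *: delta_mx 0 k + z)) - q (pi z)))
      = (fun h : R => h^-1 *: (q (h *: delta_mx 0 i + pi z) - q (pi z))).
      by apply/funext => h; rewrite [_ + z]addrC E [_ + pi z]addrC.
    by apply: DeriveDef; rewrite /derivable /derive Q.
  apply: is_derive_approx => e e0; near=> h.
  by rewrite E subrr mulr0 subr0 normr0 mulr_ge0 // ltW.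
have [||sD _] := @smooth_family R N (pi @^-1` U) D oP.
- move=> s z Uz; rewrite /D; case: (all _ s); last by split; exact: cst_continuous.
  have c1 := @continuous_comp _ _ _ pi (Dseq (pmap tau s) (@complex.Re R \o g)) z
    (@cpi z) (smoothR_continuous sg.1 Uz).
  have c2 := @continuous_comp _ _ _ pi (Dseq (pmap tau s) (@complex.Im R \o g)) z
    (@cpi z) (smoothR_continuous sg.2 Uz).
  by split; [exact: c1 | exact: c2].
- move=> s k z Uz; rewrite /D /=; case: (all _ s) => /=; last first.
    rewrite andbF; split; exact: is_derive_cst.
  rewrite andbT; split.
    have := der _ z k _ (fun i => smoothR_is_derive (pmap tau s) i sg.1 Uz).
    by case: (tau k).
  have := der _ z k _ (fun i => smoothR_is_derive (pmap tau s) i sg.2 Uz).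
  by case: (tau k).
- have E (z : 'rV[R]_N) : (pi @^-1` U) z -> D [::] z = g (pi z).
    by rewrite /D /= DseqC_nil.
  exact: (smooth_congr oP E sD).1.
Unshelve. all: by end_near. Qed.

End Pullback.

Section Patch.
Variable R : realType.

Definition tau_left p n (k : 'I_(p + n)) : option 'I_p :=
  if fintype.split k is inl i then Some i else None.
Definition tau_right p n (k : 'I_(p + n)) : option 'I_n :=
  if fintype.split k is inr i then Some i else None.

Lemma smooth_lsub p n (U : set 'rV[R]_p) g : open U -> smooth U g ->
  smooth [set z : 'rV[R]_(p + n) | U (lsubmx z)] (fun z => g (lsubmx z)).
Proof.
move=> oU sg; apply: (smooth_pullback (tau := @tau_left p n) _ _ oU sg).
  exact: continuous_lsubmx.
move=> z k h; rewrite /tau_left; case: (split_ordP k) => i ->.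
  by rewrite lsub_shift.
by rewrite lsub_rshift.
Qed.

Lemma smooth_rsub p n (U : set 'rV[R]_n) g : open U -> smooth U g ->
  smooth [set z : 'rV[R]_(p + n) | U (rsubmx z)] (fun z => g (rsubmx z)).
Proof.
move=> oU sg; apply: (smooth_pullback (tau := @tau_right p n) _ _ oU sg).
  exact: continuous_rsubmx.
move=> z k h; rewrite /tau_right; case: (split_ordP k) => i ->.
  by rewrite rsub_lshift.
by rewrite rsub_shift.
Qed.

(** Every point of W has a neighbourhood on which the extension is f (inside U) or 0 (outside the
    closed set C). *)
Lemma smooth_patch n (U W C : set 'rV[R]_n) (f : 'rV[R]_n -> R[i]) :
  open U -> closed C -> (forall x, W x -> U x \/ ~ C x) ->
  (forall x, U x -> ~ C x -> f x = 0) -> smooth U f ->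
  smooth W (patch (fun=> 0) U f).
Proof.
move=> oU cC WUC f0 sf; apply: smooth_local => x /WUC [Ux|nCx].
  exists U, f => // y Uy; rewrite patchT //; exact/mem_set.
exists (~` C), (fun=> 0); first by split=> //; [exact: closed_openC | apply: smooth0; exact: closed_openC].
move=> y nCy; rewrite /patch; case: ifPn => // /set_mem Uy; exact: f0.
Qed.

Lemma compact_closed_rV n (K : set 'rV[R]_n) : compact K -> closed K.
Proof. by apply: compact_closed; exact: norm_hausdorff. Qed.

Lemma compact_box_sub n (K : set 'rV[R]_n) : compact K ->
  exists2 M : R, 0 < M & K `<=` box M.
Proof.
move=> /compact_bounded /ex_strict_bound_gt0 [M M0 KM]; exists M => // x Kx i.
apply: (@le_trans _ _ `|x|); last exact: ltW (KM x Kx).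
rewrite /Num.Def.normr /= mx_normrE.
by apply: (@le_bigmax _ _ _ 0 (fun ij => `|x ij.1 ij.2|) (0, i)).
Qed.

Lemma smooth_bounded n (U K : set 'rV[R]_n) (f : 'rV[R]_n -> R[i]) s :
  smooth U f -> compact K -> K `<=` U ->
  exists2 B : R, 0 < B & forall x, K x -> normc (DseqC s f x) <= B.
Proof.
move=> [s1 s2] cK KU.
have bd (g : 'rV[R]_n -> R) : (forall x, K x -> {for x, continuous g}) ->
    exists2 B : R, 0 < B & forall x, K x -> `|g x| <= B.
  move=> cg; have cw : {within K, continuous g}.
    by apply: continuous_in_subspaceT => x /set_mem; exact: cg.
  have [B B0 HB] := ex_strict_bound_gt0 (compact_bounded (continuous_compact cw cK)).
  by exists B => // x Kx; apply/ltW/HB; exists x.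
have [B1 B10 H1] := bd _ (fun x Kx => smoothR_continuous s1 (KU _ Kx) : {for x, continuous (Dseq s _)}).
have [B2 B20 H2] := bd _ (fun x Kx => smoothR_continuous s2 (KU _ Kx) : {for x, continuous (Dseq s _)}).
exists (B1 + B2); first exact: addr_gt0.
by move=> x Kx; rewrite (le_trans (normc_le_ReIm _)) // lerD //; [exact: H1|exact: H2].
Qed.

Lemma Cclass_eq (z w : R -> R[i]) : Cmoderate z -> Cmoderate w ->
  Cnegligible (fun e => z e - w e) -> Cclass z = Cclass w.
Proof.
move=> mz mw nzw; rewrite /Cclass; apply/eqP; rewrite -Quotient.idealrBE.
apply/asboolP; move: nzw; congr Cnegligible.
by rewrite /= !insubdK //; apply/asboolP.
Qed.

Lemma Cmoderate_near (z w : R -> R[i]) : (\forall e \near (0 : R)^'+, z e = w e) ->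
  Cmoderate z -> Cmoderate w.
Proof.
move=> zw [N H]; exists N; apply: bigOpow_le H.
by apply: filterS zw => e ->.
Qed.

Lemma Cclass_near (z w : R -> R[i]) : Cmoderate z ->
  (\forall e \near (0 : R)^'+, z e = w e) -> Cclass z = Cclass w.
Proof.
move=> mz zw; apply: Cclass_eq => //; first exact: Cmoderate_near zw mz.
move=> q; exists 0; apply: filterS zw => e ->.
by rewrite subrr normc0 mul0r.
Qed.

End Patch.

Section FunctionalNets.
Variables (R : realType) (n : nat) (Om : openset R n).
Implicit Types (K L : set 'rV[R]_n) (v : R -> 'rV[R]_n -> R[i])
  (Te : R -> ('rV[R]_n -> R[i]) -> R[i]).

Definition vanishes_off L v : Prop := forall e y, 0 < e <= 1 ->
  openset_val Om y -> ~ L y -> v e y = 0.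

Lemma testK_net L v e : smooth_net Om v -> vanishes_off L v -> 0 < e <= 1 ->
  testK Om L (v e).
Proof. by move=> sv v0 e01; split; [exact: sv | move=> y; exact: v0]. Qed.

Lemma functional_net_apply L Te : functional_net Om L Te ->
  exists K j (M : nat), [/\ compact K, K `<=` Om &
    forall v (b : R), smooth_net Om v -> vanishes_off L v ->
     (forall c, (size c <= j)%N -> Obound K c v b) ->
     bigOpow (fun e => (normc (Te e (v e)))%:E) (- M%:R + b)].
Proof.
move=> [_ [K [j [M [cK KOm HT]]]]]; exists K, j, M; split=> // v b sv v0 H.
have [C C0 HC] := @Obound_seq R n n K v b id j H.
exists C; near=> e; have e01 : 0 < e <= 1 by near: e; exact: near_unit.
have e0 : e != 0 by apply: lt0r_neq0; case/andP: e01.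
have bT : bounded_functional Om L K j (e `^ (- M%:R)) (Te e) by near: e.
rewrite lee_fin powRD ?e0 ?implybT // mulrCA.
have := bounded_functional_le bT (testK_net sv v0 e01).
move=> /(_ (C * e `^ b)); rewrite [`|_ `^ _|]ger0_norm ?powR_ge0 //; apply.
  by rewrite mulr_ge0 ?powR_ge0.
by move=> x s Kx sj; move: s sj x Kx; near: e.
Unshelve. all: by end_near. Qed.

Lemma functional_net_moderate L Te v : functional_net Om L Te ->
  Gmoderate Om v -> vanishes_off L v -> Cmoderate (fun e => Te e (v e)).
Proof.
move=> HT mv v0; have [K [j [M [cK KOm H]]]] := functional_net_apply HT.
have [||N HN] := @moderate_on_set _ _ false K v [set c | (size c <= j)%N].
- by move=> s; exact: Gmoderate_Obound mv cK KOm.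
- by right; exists j.
exists (M + N)%N; rewrite natrD opprD; apply: H => //.
exact: Gmoderate_smooth mv.
Qed.

Lemma functional_net_negligible L Te v : functional_net Om L Te ->
  smooth_net Om v -> vanishes_off L v -> Gnegligible Om v ->
  Cnegligible (fun e => Te e (v e)).
Proof.
move=> HT sv v0 nv q; have [K [j [M [cK KOm H]]]] := functional_net_apply HT.
rewrite -[q%:R](addKr M%:R); apply: H => // c cj.
exact: (Gnegligible_Obound c (M%:R + q%:R) (fun x => id) sv nv cK KOm).
Qed.

End FunctionalNets.

(** * Kernels acting on functionals *)

Lemma smooth_netB (R : realType) n (Om : openset R n) v w :
  smooth_net Om v -> smooth_net Om w -> smooth_net Om (fun e x => v e x - w e x).
Proof.
move=> sv sw e e01; have := smooth_lin (-1) (opensetP Om) (sw e e01) (sv e e01).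
by congr smooth; apply/funext => x; rewrite mulN1r addrC.
Qed.

Section Kernels.
Variables (R : realType) (n : nat) (Om : openset R n).
Implicit Types (K L : set 'rV[R]_n) (v : R -> 'rV[R]_n -> R[i])
  (kap : R -> 'rV[R]_(n + n) -> R[i]) (Te : R -> ('rV[R]_n -> R[i]) -> R[i])
  (T : G Om -> Cgen R) (u : G Om).

Definition pairxy (x y : 'rV[R]_n) : 'rV[R]_(n + n) := row_mx x y.
(** The same point as [pairxy x y] with the second variable as parameter: the reading for the
    transpose. *)
Definition pairyx (y x : 'rV[R]_n) : 'rV[R]_(n + n) := row_mx x y.

Lemma Omsq_row_mx x y : openset_val Om x -> openset_val Om y ->
  openset_val (Omsq Om) (row_mx x y).
Proof. by move=> Ox Oy; split; rewrite ?row_mxKl ?row_mxKr. Qed.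

Lemma pairxy_coord : coord_pairing pairxy (@lshift n n) (@rshift n n).
Proof. exact: coord_pairing_row_mx. Qed.

Lemma pairyx_coord : coord_pairing pairyx (@rshift n n) (@lshift n n).
Proof. exact: coord_pairing_swap. Qed.

Lemma pairxy_Omsq x y : openset_val Om x -> openset_val Om y ->
  openset_val (Omsq Om) (pairxy x y).
Proof. exact: Omsq_row_mx. Qed.

Lemma pairyx_Omsq y x : openset_val Om y -> openset_val Om x ->
  openset_val (Omsq Om) (pairyx y x).
Proof. by move=> Oy Ox; exact: Omsq_row_mx. Qed.

Definition integral_against v e (f : 'rV[R]_n -> R[i]) : R[i] :=
  integral_on Om (fun x => f x * v e x).

Lemma integral_on0 (f : 'rV[R]_n -> R[i]) :
  (forall x, openset_val Om x -> f x = 0) -> integral_on Om f = 0.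
Proof.
move=> f0; rewrite -[RHS](@integralC0 R n) /integral_on /integralC.
rewrite (_ : patch _ Om f = fun=> 0) //.
by apply/funext => x; rewrite /patch; case: ifPn => // /set_mem /f0.
Qed.

(** As [v e] is supported in the compact set K, the product with f extends by 0 to a test function
    in a box of the whole space. *)
Lemma bounded_integral_against v e K (M V : R) : compact K -> K `<=` Om ->
  0 < M -> K `<=` box M -> smooth Om (v e) ->
  (forall x, openset_val Om x -> ~ K x -> v e x = 0) ->
  0 < V -> (forall x, K x -> normc (v e x) <= V) ->
  bounded_functional Om Om K 0 ((4 * M) ^+ n * V) (integral_against v e).
Proof.
move=> cK KOm M0 KM sv v0 V0 vV.
have tP f : smooth Om f ->
    testK (whole R n) (box M) (patch (fun=> 0) Om (fun x => f x * v e x)).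
  move=> sf; split.
    apply: (@smooth_patch _ _ Om setT K); first exact: opensetP.
    - exact: compact_closed_rV.
    - by move=> x _; have [Ox|nOx] := pselect (openset_val Om x); [left|right => /KOm].
    - by move=> x Ox Kx; rewrite v0 // mulr0.
    - by have [] := smoothM (opensetP Om) sf sv.
  move=> x _ xM; rewrite /patch; case: ifPn => // /set_mem Ox.
  by rewrite v0 ?mulr0 // => /KM.
have bI := bounded_integralC n M0.
have M4 : 0 < (4 * M) ^+ n by rewrite exprn_gt0 // mulr_gt0.
apply: bounded_functional_intro => //; first by rewrite mulr_gt0.
- move=> c f g [sf _] [sg _]; rewrite /integral_against.
  have := bI.1 c _ _ (tP _ sf) (tP _ sg); rewrite /integralC /integral_on => <-.
  set p := patch _ _ _; set q := fun x => _ + _.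
  have -> : p = q; last by [].
  apply/funext => x; rewrite /p /q /patch; case: ifP => _; last by rewrite mulr0 addr0.
  by rewrite mulrDl mulrA.
- move=> f B [sf _] B0 H.
  have -> : (4 * M) ^+ n * V * B = `|(4 * M) ^+ n| * (B * V).
    by rewrite (ger0_norm (ltW M4)); ring.
  apply: (bounded_functional_le bI (tP _ sf)); first by rewrite mulr_ge0 // ltW.
  move=> x [|//] _ _; rewrite DseqC_nil /patch.
  case: ifPn => [/set_mem Ox|_]; last by rewrite normc0 mulr_ge0 // ltW.
  have [Kx|nKx] := pselect (K x); last by rewrite v0 // mulr0 normc0 mulr_ge0 // ltW.
  rewrite normcM ler_pM ?normc_ge0 //; last exact: vV.
  by rewrite -[f x]DseqC_nil; exact: H.
Qed.

Lemma bounded_functional_weak L K j (C C' : R) (S : _ -> R[i]) : C <= C' ->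
  bounded_functional Om L K j C S -> bounded_functional Om L K j C' S.
Proof.
move=> CC' [lT bT]; split=> // f tf; rewrite (le_trans (bT f tf)) //.
by rewrite lee_wpmul2r ?lee_fin //; exact: nnsup_ge0.
Qed.

Lemma integral_against_net v K : Gmoderate Om v -> compact K -> K `<=` Om ->
  vanishes_off Om K v -> functional_net Om Om (integral_against v).
Proof.
move=> mv cK KOm v0; have sv := Gmoderate_smooth mv.
have [M M0 KM] := compact_box_sub cK; split.
  move=> e e01; have [B B0 HB] := smooth_bounded [::] (sv e e01) cK KOm.
  exists K, 0%N, ((4 * M) ^+ n * B); split=> //.
  apply: bounded_integral_against => //; [exact: sv | by move=> x; exact: v0 |].
  by move=> x Kx; rewrite -DseqC_nil; exact: HB.
have [N /Obound_pos [C C0 HC]] := Gmoderate_Obound [::] mv cK KOm.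
have M4 : 0 < (4 * M) ^+ n by rewrite exprn_gt0 // mulr_gt0.
have D0 : 0 < (4 * M) ^+ n * (C + 1) by rewrite mulr_gt0 // ltr_wpDl.
(* The additional power e^-1 absorbs the constant (4 M)^n (C + 1) for small e. *)
exists K, 0%N, N.+1; split=> //; near=> e.
have e01 : 0 < e <= 1 by near: e; exact: near_unit.
have e0 : 0 < e by case/andP: e01.
have P0 : 0 < e `^ (- N%:R) by exact: powR_gt0.
apply: (@bounded_functional_weak _ _ _ ((4 * M) ^+ n * ((C + 1) * e `^ (- N%:R)))).
  have -> : - N.+1%:R = - N%:R + -1 :> R by rewrite -natr1 opprD.
  have en0 : e != 0 by rewrite gt_eqF.
  rewrite powRD ?en0 ?implybT // mulrA mulrC ler_wpM2l ?powR_ge0 //.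
  rewrite (powR_inv1 (ltW e0)).
  rewrite -[X in X <= _]invrK lef_pV2 ?posrE ?invr_gt0 //.
  by near: e; apply: nbhs_right_le; rewrite invr_gt0.
apply: bounded_integral_against => //.
- exact: sv.
- by move=> x; exact: v0.
- by rewrite mulr_gt0 // ltr_wpDl.
- move=> x Kx; rewrite -DseqC_nil.
  apply: (@le_trans _ _ (C * e `^ (- N%:R))); first by move: x Kx; near: e.
  by rewrite ler_wpM2r ?powR_ge0 // lerDl.
Unshelve. all: by end_near. Qed.

Definition represents T Te L : Prop := functional_net Om L Te /\
  forall v, Gmoderate Om v -> vanishes_off Om L v ->
    T (Gclass Om v) = Cclass (fun e => Te e (v e)).

(* Near every compact set of parameters, the slices of the kernel are test
   functions on which Te represents T. *)
Definition acts_on T Te kap : Prop :=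
  forall K, compact K -> K `<=` Om -> exists U L,
    [/\ open U, K `<=` U, U `<=` Om, fibred pairxy Om kap U L & represents T Te L].

Lemma fibred_all kap : fibred pairyx Om kap Om Om.
Proof. by move=> e x y e01 Ux Oy /(_ Oy). Qed.

Lemma transpose_Gmod inf v K kap : Gmoderate Om v -> compact K -> K `<=` Om ->
  vanishes_off Om K v -> Gmod (Omsq Om) inf kap ->
  Gmod Om inf (param_family pairyx (integral_against v) kap).
Proof.
move=> mv cK KOm v0 mk.
apply: (family_Gmod pairyx_coord pairyx_Omsq mk) => K' cK' K'Om.
exists Om, Om; split; [exact: opensetP | by [] | by [] | exact: fibred_all |].
exact: integral_against_net v0.
Qed.

Variables (kap : R -> 'rV[R]_(n + n) -> R[i]) (T : G Om -> Cgen R)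
  (Te : R -> ('rV[R]_n -> R[i]) -> R[i]).
Hypotheses (mk : Gmoderate (Omsq Om) kap) (act : acts_on T Te kap).

Let w := param_family pairxy Te kap.

Lemma acts_on_Gmod inf kap' : Gmod (Omsq Om) inf kap' ->
  acts_on T Te kap' -> Gmod Om inf (param_family pairxy Te kap').
Proof.
move=> mk' act'; apply: (family_Gmod pairxy_coord pairxy_Omsq mk') => K cK KOm.
by have [U [L [oU KU UOm kUL [TL _]]]] := act' K cK KOm; exists U, L.
Qed.

Lemma fubini_kernel v K e : 0 < e <= 1 -> Gmoderate Om v -> compact K ->
  K `<=` Om -> vanishes_off Om K v ->
  Te e (param_family pairyx (integral_against v) kap e) =
  integral_against v e (w e).
Proof.
move=> e01 mv cK KOm v0.
have sv := Gmoderate_smooth mv e01; have sk := Gmoderate_smooth mk e01.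
have [U [L [oU KU UOm kUL [TL TR]]]] := act cK KOm.
have [K2 [j [C [cK2 K2Om bT]]]] := TL.1 e e01.
have [M M0 KM] := compact_box_sub cK.
(* Extended by zero in x, the integrand is smooth for all x in R^n and y in Om, as
   [fubini_functional] requires. *)
pose f := patch (fun=> 0) (Omsq Om) (fun z => kap e z * v e (lsubmx z)).
have fE x y : openset_val Om x -> openset_val Om y ->
    f (row_mx x y) = kap e (row_mx x y) * v e x.
  move=> Ox Oy; rewrite /f patchT; last by apply/mem_set; exact: Omsq_row_mx.
  by rewrite row_mxKl.
have f0 x y : ~ K x -> f (row_mx x y) = 0.
  move=> nKx; rewrite /f /patch; case: ifPn => // /set_mem [].
  by rewrite row_mxKl => Ox _; rewrite v0 ?mulr0.
have fO x y : ~ openset_val Om x -> f (row_mx x y) = 0.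
  by move=> nOx; apply: f0 => /KOm.
have fL x y : openset_val Om y -> ~ L y -> f (row_mx x y) = 0.
  move=> Oy Ly; have [Kx|] := pselect (K x); last exact: f0.
  rewrite fE //; last exact: KOm.
  by rewrite (kUL e x y e01 (KU _ Kx) Oy Ly) mul0r.
have svl : smooth (Omsq Om) (fun z => v e (lsubmx z)).
  apply: (@smooth_sub R (n + n) [set z | openset_val Om (lsubmx z)] (Omsq Om) _ (fun z H => H.1)).
  exact: (@smooth_lsub R n n _ _ (opensetP Om) sv).
have sf : smooth (@cylinder R n Om n) f.
  apply: (@smooth_patch _ _ (Omsq Om) _ [set z | K (lsubmx z)]).
  - exact: opensetP.
  - rewrite -[X in closed X]setCK; apply: open_closedC.
    have : open (~` K) by apply: closed_openC; exact: compact_closed_rV.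
    by move=> oK; apply: open_comp oK => z _; exact: continuous_lsubmx.
  - move=> z Oz; have [Oz1|nO] := pselect (openset_val Om (lsubmx z)); first by left.
    by right => /KOm.
  - by move=> z [Oz1 Oz2] nK; rewrite v0 ?mulr0.
  - by have [] := smoothM (opensetP (Omsq Om)) sk svl.
have fub := fubini_functional cK2 K2Om bT M0 sf
  (fun x y xM => f0 x y (fun Kx => xM (KM _ Kx))) fL.
have zE y : openset_val Om y ->
    integralC (fun x : 'rV[R]_n => f (row_mx x y)) =
    param_family pairyx (integral_against v) kap e y.
  move=> Oy; rewrite /param_family /integral_against /integral_on /integralC.
  rewrite (_ : (fun x => f _) = patch (fun=> 0) Om (fun x => kap e (pairyx y x) * v e x)) //.
  apply/funext => x; rewrite /patch; case: ifPn => [/set_mem Ox|nOx]; first exact: fE.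
  by apply: fO => Ox; move/negP: nOx; apply; exact: mem_set.
have tz : testK Om L (param_family pairyx (integral_against v) kap e).
  split.
    have [] := transpose_Gmod mv cK KOm v0 ((Gmod_false _ _).2 mk).
    by move=> sz _; exact: sz.
  move=> y Oy Ly; apply: integral_on0 => x Ox; have [Kx|nKx] := pselect (K x).
    by rewrite /pairyx (kUL e x y e01 (KU _ Kx) Oy Ly) mul0r.
  by rewrite v0 ?mulr0.
transitivity (Te e (fun y => integralC (fun x : 'rV[R]_n => f (row_mx x y)))).
  apply: (bounded_functional_congr K2Om bT tz) => [|y Oy]; last by rewrite zE.
  have [sz' _] := smooth_congr (opensetP Om) (fun y Oy => esym (zE y Oy)) tz.1.
  by split=> // y Oy Ly; rewrite zE //; exact: tz.2.
rewrite fub /integral_against /integral_on -/(integralC _).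
congr integralC; apply/funext => x; rewrite /patch; case: ifPn => [/set_mem Ox|nOx]; last first.
  rewrite -[RHS](functional0 bT); congr (Te e _); apply/funext => y; apply: fO => Ox.
  by move/negP: nOx; apply; exact: mem_set.
have t0 : testK Om L (fun=> 0) by split; [exact: smooth0 (opensetP Om) | by []].
have [Kx|nKx] := pselect (K x); last first.
  rewrite v0 // mulr0 -[RHS](functional0 bT); congr (Te e _).
  by apply/funext => y; exact: f0.
have tk : testK Om L (fun y => kap e (pairxy x y)).
  have := slice_testK pairxy_coord pairxy_Omsq oU UOm (Gmoderate_smooth mk) kUL [::] e01 (KU _ Kx).
  by congr testK; apply/funext => y; exact: DseqC_nil.
have tvk : testK Om L (fun y => v e x * kap e (pairxy x y) + 0) by exact: testK_lin tk t0.
transitivity (Te e (fun y => v e x * kap e (pairxy x y) + 0)); last first.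
  by rewrite bT.1 // (functional0 bT) addr0 mulrC.
have Efx y : openset_val Om y -> v e x * kap e (pairxy x y) + 0 = f (row_mx x y).
  by move=> Oy; rewrite addr0 mulrC fE.
apply: (bounded_functional_congr K2Om bT _ tvk) => [|y Oy]; last by rewrite Efx.
have [sfx _] := smooth_congr (opensetP Om) Efx tvk.1.
by split=> // y Oy; exact: fL.
Qed.

(** Both sides are defined with chosen representatives. On the left the chosen kernel net is
    replaced by [kap], at the cost of a negligible net; then [fubini_kernel] applies for each e; on
    the right the chosen representative is replaced by w. *)
Lemma pairing_identity u : Gc u ->
  T (kernel_transpose (Gclass (Omsq Om) kap) u) = pairing (Gclass Om w) u.
Proof.
move=> Gu; pose v := Gc_choose u.
have [mv vu [K [cK KOm v0]]] : Gc_repr u v by exact: xgetPex Gu.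
have v0' : vanishes_off Om K v by [].
have mk' := Gmoderate_repr (Gclass (Omsq Om) kap).
pose z := param_family pairyx (integral_against v) kap.
pose z' := param_family pairyx (integral_against v) (Grepr (Gclass (Omsq Om) kap)).
have mz : Gmoderate Om z.
  exact: Gmod_moderate (transpose_Gmod mv cK KOm v0 ((Gmod_false _ _).2 mk)).
have mz' : Gmoderate Om z'.
  exact: Gmod_moderate (transpose_Gmod mv cK KOm v0 ((Gmod_false _ _).2 mk')).
have -> : kernel_transpose (Gclass (Omsq Om) kap) u = Gclass Om z.
  rewrite -[LHS]/(Gclass Om z'); apply: Gclass_eq => //.
  have sd := smooth_netB (Gmoderate_smooth mk') (Gmoderate_smooth mk).
  have nd := GclassP mk.
  have [K2 [j [M [cK2 K2Om HO]]]] := family_Obound pairyx_coord pairyx_Omsq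
    (opensetP Om) (fun x => id) sd (@fibred_all _) (integral_against_net mv cK KOm v0).
  apply: Gnegligible_intro => K' cK' K'Om s q.
  (* The difference of the kernel nets is small to every order, in particular to the order M + q
     that survives the loss M. *)
  have := HO K' s (M%:R + q%:R) K'Om; rewrite addKr => H.
  apply: (@Obound_near _ _ Om _ _ (param_family pairyx (integral_against v)
    (fun e x => Grepr (Gclass (Omsq Om) kap) e x - kap e x))); first exact: K'Om.
  - move=> e e01; have [] := family_smooth pairyx_coord pairyx_Omsq (opensetP Om)
      (fun x => id) sd (@fibred_all _) (integral_against_net mv cK KOm v0) e01.
    by [].
  - near=> e => y Oy; have e01 : 0 < e <= 1 by near: e; exact: near_unit.
    have [K3 [j3 [C3 [_ _ bI]]]] := (integral_against_net mv cK KOm v0).1 e e01.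
    have ts k : Gmoderate (Omsq Om) k -> testK Om Om (fun x => k e (pairyx y x)).
      move=> smk; have := slice_testK pairyx_coord pairyx_Omsq (opensetP Om) (fun x => id)
        (Gmoderate_smooth smk) (@fibred_all k) [::] e01 Oy.
      by congr testK; apply/funext => x; exact: DseqC_nil.
    exact: (bounded_functionalB bI (ts _ mk') (ts _ mk)).
  - apply: H => c cj; apply: (Gnegligible_Obound _ _ (fun x => id) sd nd).
      exact: (compact_image2 pairyx_coord).
    exact: (image2_sub pairyx_Omsq).
have [U [L [oU KU UOm kUL [TL TR]]]] := act cK KOm.
rewrite TR //; last first.
  move=> e y e01 Oy Ly; apply: integral_on0 => x Ox; have [Kx|nKx] := pselect (K x).
    by rewrite /pairyx (kUL e x y e01 (KU _ Kx) Oy Ly) mul0r.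
  by rewrite v0 ?mulr0.
have nI := integral_against_net mv cK KOm v0.
have mw : Gmoderate Om w.
  exact: Gmod_moderate (acts_on_Gmod ((Gmod_false _ _).2 mk) act).
have van x : vanishes_off Om Om x by move=> e y e01 Oy /(_ Oy).
have mr := Gmoderate_repr (Gclass Om w).
rewrite /pairing -/v.
transitivity (Cclass (fun e => integral_against v e (w e))).
  apply: Cclass_near.
    apply: (functional_net_moderate TL mz) => e y e01 Oy Ly.
    apply: integral_on0 => x Ox; have [Kx|nKx] := pselect (K x).
      by rewrite /pairyx (kUL e x y e01 (KU _ Kx) Oy Ly) mul0r.
    by rewrite v0 ?mulr0.
  near=> e; apply: (fubini_kernel _ mv cK KOm v0).
  by near: e; exact: near_unit.
apply/esym; rewrite -[LHS]/(Cclass (fun e => integral_against v e (Grepr (Gclass Om w) e))).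
apply: Cclass_eq.
- exact: functional_net_moderate nI mr (van _).
- exact: functional_net_moderate nI mw (van _).
have sd := smooth_netB (Gmoderate_smooth mr) (Gmoderate_smooth mw).
move=> q; have := functional_net_negligible nI sd (van _) (GclassP mw) q.
apply: bigOpow_le; near=> e.
have e01 : 0 < e <= 1 by near: e; exact: near_unit.
have [K3 [j3 [C3 [_ _ bI]]]] := nI.1 e e01.
rewrite (bounded_functionalB bI) //; apply: testK_net => //.
- exact: Gmoderate_smooth mr.
- exact: Gmoderate_smooth mw.
Unshelve. all: by end_near. Qed.

End Kernels.

(** * Seminorms and continuity *)

Section Valuations.
Variable R : realType.

Lemma ereal_le_real (x z : \bar R) :
  (forall b : R, (b%:E < z)%E -> (b%:E <= x)%E) -> (z <= x)%E.
Proof.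
case: x z => [x| |] [z| |] H; rewrite ?leey ?leNye //.
- rewrite lee_fin leNgt; apply/negP => xz.
  have := H ((x + z) / 2); rewrite lte_fin lee_fin; lra.
- by have := H (x + 1) (ltry _); rewrite lee_fin gerDl ler10.
- by have := H (z - 1); rewrite lte_fin ltrBlDr ltrDl ltr01 => /(_ isT).
- by have := H 0 (ltry _).
Qed.

Definition expsup (S : set R) : \bar R := expeR (- ereal_sup [set b%:E | b in S]).

(** The strict inequality is enough, since a supremum is reached by the reals strictly below it. *)
Lemma expsup_le (S : set R) (r : \bar R) : (0 <= r)%E ->
  (forall b : R, (r < (expR (- b))%:E)%E -> S b) -> (expsup S <= r)%E.
Proof.
move=> /expeR_total [y <-] H; rewrite /expsup lee_expeR leeNl.
apply: ereal_le_real => b by_; apply: ereal_sup_ubound; exists b => //; apply: H.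
by rewrite -[(expR _)%:E]/(expeR (- b)%:E) lte_expeR EFinN lteNr.
Qed.

Lemma expsup_ge (S : set R) (r : R) : (forall b b', S b -> b' <= b -> S b') ->
  (expsup S < (expR (- r))%:E)%E -> S r.
Proof.
move=> dS; rewrite /expsup -[(expR _)%:E]/(expeR (- r)%:E) lte_expeR EFinN lteN2.
move=> /ereal_sup_gt [_ [b Sb <-]]; rewrite lte_fin => /ltW; exact: dS.
Qed.

Lemma expsup_ub (S : set R) (r : R) : S r -> (expsup S <= (expR (- r))%:E)%E.
Proof.
move=> Sr; rewrite /expsup -[(expR _)%:E]/(expeR (- r)%:E) lee_expeR EFinN leeN2.
by apply: ereal_sup_ubound; exists r.
Qed.

Lemma nat_ge (b : R) : exists q : nat, b <= q%:R.
Proof.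
by exists (Num.truncn `|b|).+1; rewrite (le_trans (ler_norm _)) // ltW // truncnS_gt.
Qed.

Lemma bigOpow_normc_sub (z w : R -> R[i]) b : Cnegligible (fun e => z e - w e) ->
  bigOpow (fun e => (normc (w e))%:E) b -> bigOpow (fun e => (normc (z e))%:E) b.
Proof.
move=> nzw hw; have [q bq] := nat_ge b.
apply: (bigOpowD (bigOpow_weak bq (nzw q)) hw).
near=> e; rewrite -EFinD lee_fin (le_trans _ (le_normcD _ _)) //.
by rewrite subrK.
Unshelve. all: by end_near. Qed.

Lemma Cabs_class (z : R -> R[i]) : Cmoderate z ->
  Cabs (Cclass z) = expsup [set b | bigOpow (fun e => (normc (z e))%:E) b].
Proof.
move=> mz; rewrite /Cabs /valuation /expsup; congr (expeR (- ereal_sup (image _ _))).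
have nz := CclassP mz.
apply/seteqP; split=> b /=; first apply: bigOpow_normc_sub; last exact: bigOpow_normc_sub.
move=> q; have := nz q; apply: bigOpow_le; apply: nearW => e.
by rewrite normcB.
Qed.

Lemma CmoderateB (z w : R -> R[i]) : Cmoderate z -> Cmoderate w ->
  Cmoderate (fun e => z e - w e).
Proof.
move=> mz mw; have zm : z \in @Cmoderate_pred R by apply/asboolP.
have wm : w \in @Cmoderate_pred R by apply/asboolP.
by have /asboolP := rpredB zm wm.
Qed.

Lemma CclassB (z w : R -> R[i]) : Cmoderate z -> Cmoderate w ->
  Cclass (fun e => z e - w e) = Cclass z - Cclass w.
Proof.
move=> mz mw; apply/eqP; rewrite -subr_eq opprK -CclassD //; last exact: CmoderateB.
by apply/eqP; congr Cclass; apply/funext => e; rewrite subrK.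
Qed.

End Valuations.

Section Seminorms.
Variables (R : realType) (n : nat) (Om : openset R n).
Implicit Types (K : set 'rV[R]_n) (A : set (seq 'I_n)) (u : G Om)
  (v : R -> 'rV[R]_n -> R[i]).

Definition Nsem K A u : \bar R :=
  expsup [set b | forall s, A s -> Obound K s (Grepr u) b].

Lemma Nsem_class K A v : Gmoderate Om v -> compact K -> K `<=` Om ->
  Nsem K A (Gclass Om v) = expsup [set b | forall s, A s -> Obound K s v b].
Proof.
move=> mv cK KOm; congr expsup; apply/seteqP.
by split=> b H s As; apply/(Obound_rep s b mv cK KOm); exact: H.
Qed.

Lemma Gseminorm_Nsem K j : compact K -> K `<=` Om ->
  Gseminorm K j = Nsem K [set s | (size s <= j)%N].
Proof.
move=> cK KOm; apply/funext => u; congr (expeR (- ereal_sup (image _ _))).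
have sr := Gmoderate_smooth (Gmoderate_repr u).
apply/seteqP; split=> b /=.
  move=> [C HC] s sj; exists C; apply: filterS2 HC (near_unit R) => e He e01 x Kx.
  rewrite -lee_fin (le_trans _ He) //.
  exact: supDle_ub (opensetP Om) KOm (sr e e01) Kx sj.
move=> H; have [C C0 HC] := @Obound_seq R n n K (Grepr u) b id j H.
exists C; apply: filterS HC => e He; apply: supDle_le.
  by rewrite mulr_ge0 ?powR_ge0.
by move=> x s Kx sj; exact: He.
Qed.

Lemma Ginf_seminorm_Nsem K : compact K -> K `<=` Om ->
  Ginf_seminorm K = Nsem K setT.
Proof.
move=> cK KOm; apply/funext => u; congr (expeR (- ereal_sup (image _ _))).
have sr := Gmoderate_smooth (Gmoderate_repr u).
apply/seteqP; split=> b /= H.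
  move=> s _; have /Obound_supD := H (mcount s); apply: (Obound_perm KOm sr).
  by rewrite perm_sym; exact: perm_mseq.
by move=> a; apply/Obound_supD; exact: H.
Qed.

Definition lcsG (inf : bool) : lcs R (G Om) :=
  Lcs (if inf then @Ginf R n Om else setT)
    [set P | exists K A, [/\ compact K, K `<=` Om, admissible inf A & P = Nsem K A]].

Lemma lcsG_false : lcs_G Om = lcsG false.
Proof.
congr Lcs; apply/seteqP; split=> P.
  move=> [K [j [cK KOm ->]]]; exists K, [set s | (size s <= j)%N].
  by split=> //; [exists j | exact: Gseminorm_Nsem].
move=> [K [_ [cK KOm [j ->] ->]]]; exists K, j.
by split=> //; rewrite Gseminorm_Nsem.
Qed.

Lemma lcsG_true : lcs_Ginf Om = lcsG true.
Proof.
congr Lcs; apply/seteqP; split=> P.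
  move=> [K [cK KOm ->]]; exists K, setT.
  by split=> //; exact: Ginf_seminorm_Nsem.
move=> [K [_ [cK KOm -> ->]]]; exists K.
by split=> //; rewrite Ginf_seminorm_Nsem.
Qed.

Lemma GclassB v w : Gmoderate Om v -> Gmoderate Om w ->
  Gclass Om (fun e x => v e x - w e x) = Gclass Om v - Gclass Om w.
Proof.
move=> mv mw.
have mvw : Gmoderate Om (fun e x => v e x - w e x).
  have := Gmoderate_lin (CmoderateN1 R) mw mv; congr Gmoderate.
  by apply/funext => e; apply/funext => x; rewrite mulN1r addrC.
apply/eqP; rewrite -subr_eq opprK -GclassD //.
by apply/eqP; congr (Gclass Om _); apply/funext => e; apply/funext => x; rewrite subrK.
Qed.

End Seminorms.

(** Stated for pairs of points because the maps T |-> RT are built from chosen nets, so they are not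
    additive by construction. *)
Lemma lcs_continuous_lipschitz (R : realType) (M M' : zmodType) (E : lcs R M)
    (S : set M') (F : set (M' -> \bar R)) (f : M -> M') :
  (forall a, lcs_set E a -> S (f a)) ->
  (forall P (r : R), F P -> 0 < r -> exists Q (r' : R), [/\ lcs_fam E Q, 0 < r' &
     forall a b, lcs_set E a -> lcs_set E b -> (Q (b - a)%R < r'%:E)%E ->
       (P (f b - f a)%R < r%:E)%E]) ->
  lcs_continuous E (Lcs S F) f.
Proof.
move=> fS H; apply: lcs_continuous_sup => // P FP; split=> // u Eu A [s [r [sF r0 sA]]].
have [Q [r' [EQ r'0 HQ]]] := H P r FP r0.
exists [:: Q], r'; split=> // [Q'|v [Ev vlt]]; first by rewrite inE => /eqP ->.
apply: sA; split; first exact: fS.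
by move=> P' /sF ->; apply: HQ => //; apply: vlt; rewrite inE.
Qed.

Section Differences.
Variables (R : realType) (n : nat) (Om : openset R n).
Implicit Types (K L : set 'rV[R]_n) (S : ('rV[R]_n -> R[i]) -> R[i])
  (Te : R -> ('rV[R]_n -> R[i]) -> R[i]) (T : G Om -> Cgen R).

Lemma supDle_sub K K' j j' f : K `<=` K' -> (j <= j')%N ->
  (supDle K j f <= supDle K' j' f)%E.
Proof.
move=> KK' jj'; apply: nnsup_le => [|_ [[x a] [/= Kx aj] <-]]; first exact: nnsup_ge0.
apply: nnsup_ub; exists (x, a) => //; split=> /=; first exact: KK'.
exact: leq_trans aj jj'.
Qed.

Lemma bounded_functional_sub L L' K K' j j' (C C' : R) S : L' `<=` L -> K `<=` K' ->
  (j <= j')%N -> C <= C' -> bounded_functional Om L K j C S ->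
  bounded_functional Om L' K' j' `|C'| S.
Proof.
move=> LL' KK' jj' CC' [lS bS].
have tL f : testK Om L' f -> testK Om L f.
  by move=> [sf f0]; split=> // x Ox nL; apply: f0 => // /LL'.
split=> [c f g tf tg|f tf]; first by apply: lS; exact: tL.
rewrite (le_trans (bS f (tL _ tf))) //.
apply: (@le_trans _ _ (`|C'|%:E * supDle K j f)%E).
  apply: lee_wpmul2r; first exact: nnsup_ge0.
  by rewrite lee_fin (le_trans CC') // ler_norm.
by apply: lee_wpmul2l; rewrite ?lee_fin //; exact: supDle_sub.
Qed.

Lemma bounded_functional_diff L K j (C C' : R) S S' : 0 <= C -> 0 <= C' ->
  bounded_functional Om L K j C S -> bounded_functional Om L K j C' S' ->
  bounded_functional Om L K j (C + C') (fun f => S f - S' f).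
Proof.
move=> C0 C'0 [lS bS] [lS' bS']; split=> [c f g tf tg|f tf].
  by rewrite lS // lS' // mulrBr opprD addrACA.
apply: (@le_trans _ _ ((normc (S f))%:E + (normc (S' f))%:E)%E).
  by rewrite -EFinD lee_fin (le_trans (le_normcD _ _)) // normcN.
rewrite EFinD ge0_muleDl ?lee_fin //.
by apply: leeD; [exact: bS | exact: bS'].
Qed.

Lemma functional_net_sub L L' Te : L' `<=` L -> functional_net Om L Te ->
  functional_net Om L' Te.
Proof.
move=> LL' [H1 [K [j [M [cK KOm H2]]]]]; split.
  move=> e /H1 [K' [j' [C [cK' K'Om bT]]]]; exists K', j', `|C|; split=> //.
  exact: bounded_functional_sub bT.
exists K, j, M; split=> //; apply: filterS H2 => e bT.
rewrite -[e `^ _]ger0_norm ?powR_ge0 //.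
exact: bounded_functional_sub bT.
Qed.

Lemma functional_net_diff L Te Te' : functional_net Om L Te ->
  functional_net Om L Te' -> functional_net Om L (fun e f => Te e f - Te' e f).
Proof.
move=> [H1 [K [j [M [cK KOm H2]]]]] [H1' [K' [j' [M' [cK' K'Om H2']]]]]; split.
  move=> e e01; have [K1 [j1 [C1 [cK1 K1Om b1]]]] := H1 e e01.
  have [K2 [j2 [C2 [cK2 K2Om b2]]]] := H1' e e01.
  exists (K1 `|` K2), (maxn j1 j2), (`|C1| + `|C2|); split.
  - exact: compactU.
  - by move=> x [/K1Om|/K2Om].
  - apply: bounded_functional_diff => //.
      by apply: (bounded_functional_sub _ _ _ _ b1); [by [] | exact: subsetUl | exact: leq_maxl | exact: lexx].
    by apply: (bounded_functional_sub _ _ _ _ b2); [by [] | exact: subsetUr | exact: leq_maxr | exact: lexx].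
(* Both constants are at most e^-(M + M'), and the remaining factor 2 is absorbed by e^-1 as soon as
   e <= 1/2. *)
exists (K `|` K'), (maxn j j'), (M + M').+1; split.
- exact: compactU.
- by move=> x [/KOm|/K'Om].
near=> e; have e01 : 0 < e <= 1 by near: e; exact: near_unit.
have e0 : 0 < e by case/andP: e01.
have e2 : e <= 2^-1 by near: e; apply: nbhs_right_le; rewrite invr_gt0.
have b1 : bounded_functional Om L K j (e `^ (- M%:R)) (Te e) by near: e.
have b2 : bounded_functional Om L K' j' (e `^ (- M'%:R)) (Te' e) by near: e.
apply: (@bounded_functional_weak _ _ _ _ _ _ (`|e `^ (- M%:R)| + `|e `^ (- M'%:R)|)).
  rewrite !ger0_norm ?powR_ge0 //.
  have -> : - (M + M').+1%:R = -1 + - (M + M')%:R :> R.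
    by rewrite -natr1 opprD addrC.
  have en0 : e != 0 by rewrite gt_eqF.
  rewrite powRD ?en0 ?implybT // (powR_inv1 (ltW e0)).
  have h1 : e `^ (- M%:R) <= e `^ (- (M + M')%:R).
    by rewrite ger_powR // lerN2 ler_nat leq_addr.
  have h2 : e `^ (- M'%:R) <= e `^ (- (M + M')%:R).
    by rewrite ger_powR // lerN2 ler_nat leq_addl.
  have h3 : 2 <= e^-1 by rewrite -[2]invrK lef_pV2 ?posrE ?invr_gt0.
  have := powR_ge0 e (- (M + M')%:R); nra.
apply: bounded_functional_diff => //.
  by apply: (bounded_functional_sub _ _ _ _ b1); [by [] | exact: subsetUl | exact: leq_maxl | exact: lexx].
by apply: (bounded_functional_sub _ _ _ _ b2); [by [] | exact: subsetUr | exact: leq_maxr | exact: lexx].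
Unshelve. all: by end_near. Qed.

(** Continuity is tested on T - T' with the difference of the two chosen nets, so that the resulting
    function is exactly the difference of the two images. *)
Lemma represents_diff L L' T T' Te Te' : represents T Te L -> represents T' Te' L' ->
  represents (T - T') (fun e f => Te e f - Te' e f) (L `&` L').
Proof.
move=> [H1 H2] [H1' H2'].
have n1 : functional_net Om (L `&` L') Te by apply: functional_net_sub H1 => x [].
have n2 : functional_net Om (L `&` L') Te' by apply: functional_net_sub H1' => x [].
split; first exact: functional_net_diff.
move=> v mv v0.
have v1 : vanishes_off Om L v by move=> e y e01 Oy nL; apply: v0 => // -[].
have v2 : vanishes_off Om L' v by move=> e y e01 Oy nL; apply: v0 => // -[].
rewrite -[LHS]/(T (Gclass Om v) - T' (Gclass Om v)) H2 // H2' // CclassB //.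
  exact: functional_net_moderate n1 mv v0.
exact: functional_net_moderate n2 mv v0.
Qed.

Lemma acts_on_diff T T' Te Te' kap : acts_on T Te kap -> acts_on T' Te' kap ->
  acts_on (T - T') (fun e f => Te e f - Te' e f) kap.
Proof.
move=> H H' K cK KOm.
have [U [L [oU KU UOm kUL rT]]] := H K cK KOm.
have [U' [L' [oU' KU' U'Om kUL' rT']]] := H' K cK KOm.
exists (U `&` U'), (L `&` L'); split.
- exact: openI.
- by move=> x Kx; split; [exact: KU | exact: KU'].
- by move=> x [/UOm].
- move=> e x y e01 [Ux U'x] Oy nL; have [Ly|] := pselect (L y).
    by apply: (kUL' e x y) => // L'y; apply: nL.
  exact: (kUL e x y).
- exact: represents_diff.
Qed.

End Differences.

(** * Slices of a kernel and the seminorms of the image *)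

Section Slices.
Variables (R : realType) (n : nat) (Om : openset R n).
Implicit Types (K : set 'rV[R]_n) (A : set (seq 'I_n)) (T : G Om -> Cgen R)
  (Te : R -> ('rV[R]_n -> R[i]) -> R[i]) (kap : R -> 'rV[R]_(n + n) -> R[i]).

(** The base point moves with e, so that it can follow the points where a derivative is nearly
    maximal. *)
Definition slice_net kap s (x : R -> 'rV[R]_n) (e : R) : 'rV[R]_n -> R[i] :=
  slice (@pairxy R n) (@lshift n n) kap s (x e) e.

Definition slices kap K A : set (G Om) := [set u | exists s x,
  [/\ A s, forall e, K (x e) & u = Gclass Om (slice_net kap s x)]].

Lemma slice_net_smooth kap s x : smooth_net (Omsq Om) kap ->
  (forall e, openset_val Om (x e)) -> smooth_net Om (slice_net kap s x).
Proof.
move=> sk Ox e e01.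
have [H _] := @DseqC_right R n n (n + n) _ _ _ (@pairxy_coord R n) Om Om (Omsq Om)
  (kap e) (@pairxy_Omsq R n Om) (sk e e01) s [::] (x e) (Ox e).
exact: H.
Qed.

Lemma slice_net_Obound kap K K2 s c x b : smooth_net (Omsq Om) kap ->
  K `<=` Om -> K2 `<=` Om -> (forall e, K (x e)) ->
  Obound [set pairxy p.1 p.2 | p in K `*` K2] (map (@rshift n n) c ++ map (@lshift n n) s) kap b ->
  Obound K2 c (slice_net kap s x) b.
Proof.
move=> sk KOm K2Om Kx [C HC]; exists C.
apply: filterS2 HC (near_unit R) => e He e01 y K2y.
have [_ E] := @DseqC_right R n n (n + n) _ _ _ (@pairxy_coord R n) Om Om (Omsq Om)
  (kap e) (@pairxy_Omsq R n Om) (sk e e01) s c (x e) (KOm _ (Kx e)).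
have := E y (K2Om _ K2y); rewrite /slice_net /slice => ->.
by apply: He; exists (x e, y) => //; split=> //=; exact: Kx.
Qed.

(** The exponent is independent of the moving points: it comes from bounds on the compact product of
    K and K2. Hence the slices form bounded sets. *)
Lemma slices_Obound inf kap K K2 A j : Gmod (Omsq Om) inf kap -> admissible inf A ->
  compact K -> K `<=` Om -> compact K2 -> K2 `<=` Om ->
  exists N : nat, forall s x c, A s -> (forall e, K (x e)) -> (size c <= j)%N ->
    Obound K2 c (slice_net kap s x) (- N%:R).
Proof.
move=> [sk mk] adA cK KOm cK2 K2Om.
have cKK := compact_image2 (@pairxy_coord R n) cK cK2.
have KKO := image2_sub (@pairxy_Omsq R n Om) KOm K2Om.
have [|N HN] := @moderate_on_set _ _ inf _ kap
  [set s | exists a c, [/\ A a, (size c <= j)%N & s = map (@rshift n n) c ++ map (@lshift n n) a]]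
  (mk _ cKK KKO).
  case: inf adA {mk} => [_|[j' ->]]; [by left | right].
  exists (j + j')%N => _ [a [c [aj cj ->]]].
  by rewrite size_cat !size_map leq_add.
exists N => s x c As Kx cj.
by apply: (slice_net_Obound sk KOm K2Om Kx); apply: HN; exists s, c.
Qed.

Lemma slice_net_moderate kap K s x : Gmoderate (Omsq Om) kap -> compact K ->
  K `<=` Om -> (forall e, K (x e)) -> Gmoderate Om (slice_net kap s x).
Proof.
move=> /Gmod_false mk cK KOm Kx; apply: Gmoderate_intro.
  by apply: slice_net_smooth mk.1 _ => e; exact: KOm.
move=> K2 cK2 K2Om c.
have [|N HN] := @slices_Obound false kap K K2 [set a | (size a <= size s)%N] (size c) mk _
  cK KOm cK2 K2Om; first by exists (size s).
by exists N; apply: HN => //=.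
Qed.

Lemma slice_net_vanishes kap U L s x : smooth_net (Omsq Om) kap -> open U ->
  U `<=` Om -> (forall e, U (x e)) -> fibred (@pairxy R n) Om kap U L ->
  vanishes_off Om L (slice_net kap s x).
Proof.
move=> sk oU UOm Ux kUL e y e01 Oy Ly.
by have [_] := slice_testK (@pairxy_coord R n) (@pairxy_Omsq R n Om) oU UOm sk kUL s e01 (Ux e); exact.
Qed.

(** The continuous function |Re| + |Im| is maximized; it lies between the norm and twice the norm,
    whence the factor 2. *)
Lemma exists_near_max K (f : 'rV[R]_n -> R[i]) (U : set 'rV[R]_n) s :
  compact K -> K `<=` U -> K !=set0 -> smooth U f ->
  exists2 c, K c & forall t, K t -> normc (DseqC s f t) <= 2 * normc (DseqC s f c).
Proof.
move=> cK KU K0 [s1 s2].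
pose g t : R := `|Dseq s (@complex.Re R \o f) t| + `|Dseq s (@complex.Im R \o f) t|.
have cg : {within K, continuous g}.
  apply: continuous_in_subspaceT => t /set_mem Kt.
  have c1 : {for t, continuous (Dseq s (@complex.Re R \o f))}.
    exact: (smoothR_continuous s1 (KU _ Kt)).
  have c2 : {for t, continuous (Dseq s (@complex.Im R \o f))}.
    exact: (smoothR_continuous s2 (KU _ Kt)).
  exact: (cvgD (cvg_norm c1) (cvg_norm c2)).
have [c /set_mem Kc Hc] := compact_EVT_max K0 cK cg.
exists c => // t Kt; apply: (le_trans (normc_le_ReIm _)).
apply: (le_trans (Hc t (mem_set Kt))); rewrite mulr_natl mulr2n /g.
by apply: lerD; [exact: (normc_Re (DseqC s f c)) | exact: (normc_Im (DseqC s f c))].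
Qed.

(* Up to a factor 2, the supremum over K of a derivative of x |-> Te (kap x .)
   is attained at points x_e, hence on a slice of the kernel. *)
Lemma Nsem_dual_le K A T Te kap : compact K -> K `<=` Om ->
  Gmoderate (Omsq Om) kap -> acts_on T Te kap ->
  (Nsem K A (Gclass Om (param_family (@pairxy R n) Te kap)) <=
   nnsup [set Cabs (T u) | u in slices kap K A])%E.
Proof.
move=> cK KOm mk act.
have mw : Gmoderate Om (param_family (@pairxy R n) Te kap).
  exact: Gmod_moderate (acts_on_Gmod ((Gmod_false _ _).2 mk) act).
rewrite Nsem_class //; apply: expsup_le => [|b rb s As]; first exact: nnsup_ge0.
(* If K is empty, every estimate holds and there is no point to choose. *)
have [[k0 Kk0]|K0] := pselect (K !=set0); last first.
  by exists 0; near=> e => x Kx; case: K0; exists x.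
have [U [L [oU KU UOm kUL [TL TR]]]] := act K cK KOm.
have sk := Gmoderate_smooth mk; have sw := Gmoderate_smooth mw.
have /choice [x Hx] : forall e : R, exists c, K c /\ (0 < e <= 1 ->
    forall t, K t -> normc (DseqC s (param_family (@pairxy R n) Te kap e) t) <=
      2 * normc (DseqC s (param_family (@pairxy R n) Te kap e) c)).
  move=> e.
  have [e01|] := boolP (0 < e <= 1); last by exists k0.
  have [c Kc Hc] := exists_near_max s cK KOm (ex_intro _ k0 Kk0) (sw e e01).
  by exists c.
have Kx e : K (x e) by case: (Hx e).
have mu := slice_net_moderate s mk cK KOm Kx.
have vu : vanishes_off Om L (slice_net kap s x).
  exact: (@slice_net_vanishes kap U L s x sk oU UOm (fun e => KU _ (Kx e)) kUL).
have mz := functional_net_moderate TL mu vu.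
have Tu : (Cabs (T (Gclass Om (slice_net kap s x))) < (expR (- b))%:E)%E.
  apply: le_lt_trans rb; apply: nnsup_ub; exists (Gclass Om (slice_net kap s x)) => //.
  by exists s, x.
rewrite TR // Cabs_class // in Tu.
have {Tu} [C HC] : bigOpow (fun e => (normc (Te e (slice_net kap s x e)))%:E) b.
  by apply: expsup_ge Tu => b1 b2 h1 h2; exact: bigOpow_weak h2 h1.
exists (2 * C); apply: filterS2 HC (near_unit R) => e He e01 t Kt.
have [_ E] := family_smooth (@pairxy_coord R n) (@pairxy_Omsq R n Om) oU UOm sk kUL TL e01.
rewrite (le_trans ((Hx e).2 e01 t Kt)) // -mulrA ler_wpM2l //.
by rewrite E -?lee_fin //; exact: KU.
Unshelve. all: by end_near. Qed.

Lemma slices_bounded_G inf kap K A : Gmod (Omsq Om) inf kap -> admissible inf A ->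
  compact K -> K `<=` Om -> lcs_bounded (lcs_G Om) (slices kap K A).
Proof.
move=> mk adA cK KOm; split=> // _ [K2 [j [cK2 K2Om ->]]].
have [N HN] := slices_Obound j mk adA cK KOm cK2 K2Om.
exists (expR (N%:R)) => _ [s [x [As Kx ->]]].
have mu := slice_net_moderate s (Gmod_moderate mk) cK KOm Kx.
rewrite Gseminorm_Nsem // Nsem_class // -[N%:R]opprK; apply: expsup_ub => c cj.
exact: HN.
Qed.

(** Shared by functionals on G and on G_c, which differ only in the choice of nets and in the reason
    why slices are bounded in E. *)
Lemma maps_dual_lcsG (A : kernel_operator Om) (E : lcs R (G Om))
    (S : set (G Om -> Cgen R)) inf kap (Te_of : (G Om -> Cgen R) -> _) :
  Gmod (Omsq Om) inf kap -> Gclass (Omsq Om) kap = op_kernel A ->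
  (forall T, S T -> acts_on T (Te_of T) kap) ->
  (forall K B, compact K -> K `<=` Om -> admissible inf B ->
     lcs_bounded E (slices kap K B)) ->
  maps_dual_continuously A (lcs_dual E S) (lcsG Om inf).
Proof.
move=> mk kA act bd; have mk' := Gmod_moderate mk.
exists (fun T => Gclass Om (param_family (@pairxy R n) (Te_of T) kap)); split.
  move=> T ST u Gu; rewrite /op_dual /op_transpose -kA.
  exact: (pairing_identity mk' (act T ST) Gu).
have mw T : S T -> Gmod Om inf (param_family (@pairxy R n) (Te_of T) kap).
  by move=> ST; exact: acts_on_Gmod mk (act T ST).
apply: lcs_continuous_lipschitz => [T ST|_ r [K [B [cK KOm adB ->]]] r0].
  case: inf mk {bd} mw => // mk mw; exact: Gmod_Ginf (mw T ST).
exists (fun T => nnsup [set Cabs (T u) | u in slices kap K B]), r; split=> //.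
  by exists (slices kap K B); split=> //; exact: bd.
move=> T T' ST ST'; apply: le_lt_trans.
have m1 := Gmod_moderate (mw T ST); have m2 := Gmod_moderate (mw T' ST').
rewrite -GclassB //.
exact: (Nsem_dual_le B cK KOm mk' (acts_on_diff (act T' ST') (act T ST))).
Qed.

End Slices.

(** * Basic functionals and their nets *)

Section BasicFunctionals.
Variables (R : realType) (n : nat) (Om : openset R n).
Implicit Types (T : G Om -> Cgen R) (Te : R -> ('rV[R]_n -> R[i]) -> R[i]).

Definition basic_net_G T Te : Prop :=
  [/\ forall e, 0 < e <= 1 -> distr_compact Om (Te e),
      exists K (j N : nat) (eta : R),
        [/\ compact K, K `<=` Om, 0 < eta <= 1 &
            forall f e, smooth Om f -> 0 < e <= eta ->
            ((normc (Te e f))%:E <= (e `^ (- N%:R))%:E * supDle K j f)%E] &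
      forall v, Gmoderate Om v ->
        T (Gclass Om v) = Cclass (fun e => Te e (v e))].

Definition basic_net_Gc T Te : Prop :=
  [/\ forall e, 0 < e <= 1 -> distr Om (Te e),
      forall K, compact K -> K `<=` Om -> exists (j N : nat) (eta : R),
        0 < eta <= 1 /\
        forall f e, testK Om K f -> 0 < e <= eta ->
          ((normc (Te e f))%:E <= (e `^ (- N%:R))%:E * supDle K j f)%E &
      forall u v, Gc_repr u v -> T u = Cclass (fun e => Te e (v e))].

Lemma near_le_eta (eta : R) : 0 < eta <= 1 -> \forall e \near (0 : R)^'+, 0 < e <= eta.
Proof.
move=> /andP[eta0 _]; near=> e; apply/andP; split; near: e.
  exact: nbhs_right_gt.
exact: nbhs_right_le.
Unshelve. all: by end_near. Qed.

Lemma basic_net_G_represents T Te : basic_net_G T Te -> represents T Te Om.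
Proof.
move=> [H1 [K [j [N [eta [cK KOm eta01 H2]]]]] H3]; split; last by move=> v mv _; exact: H3.
have lin e : 0 < e <= 1 -> forall c f g, testK Om Om f -> testK Om Om g ->
    Te e (fun x => c * f x + g x) = c * Te e f + Te e g.
  by move=> e01 c f g [sf _] [sg _]; exact: (H1 e e01).1.
split.
  move=> e e01; have [_ [K' [j' [C [cK' K'Om bT]]]]] := H1 e e01.
  exists K', j', C; split=> //; split; first exact: lin.
  by move=> f [sf _]; exact: bT.
exists K, j, N; split=> //; near=> e; split.
  by apply: lin; near: e; exact: near_unit.
move=> f [sf _]; apply: H2 => //; near: e; exact: near_le_eta.
Unshelve. all: by end_near. Qed.

Lemma basic_net_Gc_represents T Te L : compact L -> L `<=` Om ->
  basic_net_Gc T Te -> represents T Te L.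
Proof.
move=> cL LOm [H1 H2 H3]; split; last first.
  by move=> v mv v0; apply: H3; split=> //; exists L; split=> // e x; exact: v0.
split.
  move=> e e01; have [lT [j [C bT]]] := H1 e e01 L cL LOm.
  by exists L, j, C.
have [j [N [eta [eta01 bT]]]] := H2 L cL LOm.
exists L, j, N; split=> //; near=> e; split.
  have e01 : 0 < e <= 1 by near: e; exact: near_unit.
  exact: (H1 e e01 L cL LOm).1.
move=> f tf; apply: bT => //; near: e; exact: near_le_eta.
Unshelve. all: by end_near. Qed.

Definition net_of_G T := xget (fun _ _ => 0) [set Te | basic_net_G T Te].
Definition net_of_Gc T := xget (fun _ _ => 0) [set Te | basic_net_Gc T Te].

Lemma net_of_GP T : basic_G T -> basic_net_G T (net_of_G T).
Proof. by move=> [_ [Te H]]; exact: (xgetPex _ (ex_intro _ Te H)). Qed.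

Lemma net_of_GcP T : basic_Gc T -> basic_net_Gc T (net_of_Gc T).
Proof. by move=> [_ [Te H]]; exact: (xgetPex _ (ex_intro _ Te H)). Qed.

Lemma represents_acts_on T Te kap : represents T Te Om -> acts_on T Te kap.
Proof.
move=> rT K cK KOm; exists Om, Om; split=> //; exact: opensetP.
Qed.

Lemma Lb_G_maps (A : kernel_operator Om) inf kap : Gmod (Omsq Om) inf kap ->
  Gclass (Omsq Om) kap = op_kernel A ->
  maps_dual_continuously A (Lb_G Om) (lcsG Om inf).
Proof.
move=> mk kA; apply: (maps_dual_lcsG mk kA (fun T bT =>
  represents_acts_on kap (basic_net_G_represents (net_of_GP bT)))).
by move=> K B cK KOm adB; exact: slices_bounded_G mk adB cK KOm.
Qed.

End BasicFunctionals.

(** * Cutoff functions *)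

Section Plateau.
Variable R : realType.
Implicit Types (t : R) (f : R -> R).

(** The powers of 1/t make the family stable: the derivative of a member is a combination of two
    others. *)
Definition flat (k : nat) t : R := if 0 < t then t^-1 ^+ k * expR (- t^-1) else 0.

(** The exponential of 1/t dominates its Taylor term of degree k + 2. The resulting quadratic bound
    gives derivative 0 at the origin. *)
Lemma flat_le k : exists2 C : R, 0 < C & forall t, `|flat k t| <= C * t ^+ 2.
Proof.
exists (k.+2)`!%:R; first by rewrite ltr0n fact_gt0.
move=> t; rewrite /flat; case: ifPn => t0; last first.
  by rewrite normr0 mulr_ge0 // sqr_ge0.
have s0 : 0 < t^-1 by rewrite invr_gt0.
have F0 : 0 < (k.+2)`!%:R :> R by rewrite ltr0n fact_gt0.
rewrite ger0_norm ?mulr_ge0 ?exprn_ge0 ?expR_ge0 ?(ltW s0) // expRN.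
have H := expR_ge1Dxn k.+1 (ltW s0).
have {}H : t^-1 ^+ k.+2 / (k.+2)`!%:R <= expR t^-1 by rewrite (le_trans _ H) // lerDr.
rewrite ler_pdivrMr ?expR_gt0 //.
apply: le_trans (ler_wpM2l _ H); last by rewrite mulr_ge0 ?sqr_ge0 // ltW.
rewrite mulrC mulrA.
have -> : t^-1 ^+ k.+2 / (k.+2)`!%:R * (k.+2)`!%:R * t ^+ 2 = t^-1 ^+ k.
  by rewrite mulfVK ?gt_eqF // !exprS expr0; field; rewrite gt_eqF.
by [].
Qed.

Lemma flat_is_derive k t : is_derive t 1 (flat k) (- k%:R * flat k.+1 t + flat k.+2 t).
Proof.
case: (ltgtP t 0) => [t0|t0|->].
- have -> : - k%:R * flat k.+1 t + flat k.+2 t = 0.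
    by rewrite /flat ltNge (ltW t0) /= mulr0 addr0.
  apply: (near_eq_is_derive _ (is_derive_cst (0 : R) t 1)).
  near=> s; rewrite /flat ltNge ifF //; apply/negbF; apply/ltW.
  by near: s; exact: lt_nbhsl.
- have tn0 : t != 0 by rewrite gt_eqF.
  pose q (s : R) := s ^+ k * expR (- s).
  have dq : is_derive t^-1 1 q (t^-1 ^+ k * (- expR (- t^-1)) +
      expR (- t^-1) * (k%:R * t^-1 ^+ k.-1)).
    have d1 : is_derive t^-1 1 (fun s : R => s ^+ k) (k%:R * t^-1 ^+ k.-1).
      have := @is_deriveX R _ (@id R) k t^-1 1 1 (is_derive_id _ _).
      by rewrite exprfctE [X in is_derive _ _ _ X]mulr1.
    have d2 : is_derive t^-1 1 (fun s : R => expR (- s)) (- expR (- t^-1)).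
      have d3 : is_derive t^-1 1 (fun s : R => - s) (-1).
        exact: (@is_deriveN R _ _ (@id R) t^-1 1 1 (is_derive_id _ _)).
      have := @is_derive1_comp R expR (fun s => - s) t^-1 _ _ (is_derive_expR _) d3.
      by rewrite mulrN1.
    exact: is_deriveM d1 d2.
  have di : is_derive t 1 (fun s : R => s^-1) (- t ^- 2).
    have := @is_deriveV R (@id R) t 1 1 tn0 (is_derive_id _ _).
    by rewrite /GRing.scale /= mulr1.
  have := is_derive1_comp dq di.
  have -> : (t^-1 ^+ k * (- expR (- t^-1)) + expR (- t^-1) * (k%:R * t^-1 ^+ k.-1)) *
     (- t ^- 2) = - k%:R * flat k.+1 t + flat k.+2 t.
    rewrite /flat t0 -exprVn; case: k {q dq} => [|k] /=; first by rewrite !exprS expr0; ring.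
    by rewrite !exprS expr0; ring.
  apply: near_eq_is_derive; near=> s; rewrite /flat /q /= ifT //.
  by near: s; exact: lt_nbhsr.
- have -> : - k%:R * flat k.+1 0 + flat k.+2 0 = 0 by rewrite /flat ltxx mulr0 addr0.
  apply: is_derive_approx => eps eps0; have [C C0 HC] := flat_le k.
  near=> h; rewrite add0r mulr0 subr0 [X in _ - X]/flat ltxx subr0.
  rewrite (le_trans (HC _)) // /GRing.scale /= mulr1 -real_normK ?num_real //.
  rewrite expr2 mulrA ler_wpM2r // mulrC -ler_pdivlMr //.
  have : ball (0 : R) (eps / C) h.
    by near: h; apply: nbhsx_ballx; rewrite divr_gt0.
  by rewrite /ball /= sub0r normrN => /ltW.
Unshelve. all: by end_near. Qed.

(* A class of functions closed under differentiation, containing the plateau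
   function flat 0 t / (flat 0 t + flat 0 (1 - t)). *)
Inductive flat_class : (R -> R) -> Prop :=
| flat_class_flat k : flat_class (flat k)
| flat_class_flip k : flat_class (fun t => flat k (1 - t))
| flat_class_inv : flat_class (fun t => (flat 0 t + flat 0 (1 - t))^-1)
| flat_class_cst c : flat_class (cst c)
| flat_classD f g : flat_class f -> flat_class g -> flat_class (fun t => f t + g t)
| flat_classM f g : flat_class f -> flat_class g -> flat_class (fun t => f t * g t).

Lemma flat_gt0 t : 0 < t -> 0 < flat 0 t.
Proof. by move=> t0; rewrite /flat t0 expr0 mul1r expR_gt0. Qed.

Lemma flat_ge0 t : 0 <= flat 0 t.
Proof. by rewrite /flat; case: ifP => // _; rewrite expr0 mul1r expR_ge0. Qed.

Lemma flat_flip_gt0 t : 0 < flat 0 t + flat 0 (1 - t).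
Proof.
have [t0|t0] := ltP 0 t; first by rewrite ltr_wpDr ?flat_ge0 ?flat_gt0.
by rewrite ltr_wpDl ?flat_ge0 ?flat_gt0 // subr_gt0 (le_lt_trans t0).
Qed.

Lemma flat_flip_is_derive k t : is_derive t 1 (fun t => flat k (1 - t))
  (k%:R * flat k.+1 (1 - t) + -1 * flat k.+2 (1 - t)).
Proof.
have d : is_derive t 1 (fun t : R => 1 - t) (-1).
  have := is_deriveB (is_derive_cst (1 : R) t 1) (is_derive_id t (1 : R)).
  by rewrite sub0r.
have := @is_derive1_comp R (flat k) (fun t => 1 - t) t _ _ (flat_is_derive k (1 - t)) d.
congr is_derive; ring.
Qed.

Lemma flat_class_derive f : flat_class f ->
  exists2 f', flat_class f' & forall t, is_derive t 1 f (f' t).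
Proof.
elim=> {f} [k|k||c|f g _ [f' cf df] _ [g' cg dg]|f g cf0 [f' cf df] cg0 [g' cg dg]].
- exists (fun t => cst (- k%:R) t * flat k.+1 t + flat k.+2 t).
    by repeat constructor.
  exact: flat_is_derive.
- exists (fun t => cst k%:R t * flat k.+1 (1 - t) + cst (-1) t * flat k.+2 (1 - t)).
    by do !constructor.
  exact: flat_flip_is_derive.
- pose I t := (flat 0 t + flat 0 (1 - t))^-1.
  exists (fun t => cst (-1) t * (I t * I t) * (flat 2 t + cst (-1) t * flat 2 (1 - t))).
    by do !constructor.
  move=> t.
  have d := is_deriveD (flat_is_derive 0 t) (flat_flip_is_derive 0 t).
  have := @is_deriveV R (fun t => flat 0 t + flat 0 (1 - t)) t _ 1
    (lt0r_neq0 (flat_flip_gt0 t)) d.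
  congr is_derive; rewrite /I /cst /GRing.scale /= -exprVn; ring.
- by exists (cst 0) => [|t]; [exact: flat_class_cst | exact: is_derive_cst].
- exists (fun t => f' t + g' t); first exact: flat_classD.
  by move=> t; exact: is_deriveD.
- exists (fun t => f t * g' t + g t * f' t).
    by apply: flat_classD; exact: flat_classM.
  by move=> t; exact: is_deriveM.
Qed.

Lemma plateau : exists phi : nat -> R -> R,
  [/\ forall k t, is_derive t 1 (phi k) (phi k.+1 t),
      forall t, t <= 0 -> phi 0%N t = 0 & forall t, 1 <= t -> phi 0%N t = 1].
Proof.
have /choice [next Hnext] : forall f : R -> R, exists f', flat_class f ->
    flat_class f' /\ forall t, is_derive t 1 f (f' t).
  move=> f; have [/flat_class_derive [f' cf df]|nf] := pselect (flat_class f).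
    by exists f'.
  by exists f.
pose phi0 t := flat 0 t * (flat 0 t + flat 0 (1 - t))^-1.
have c0 : flat_class phi0 by do !constructor.
have c k : flat_class (iter k next phi0) by elim: k => //= k /Hnext [].
exists (fun k => iter k next phi0); split.
- by move=> k t; have [_] := Hnext _ (c k); exact.
- by move=> t t0 /=; rewrite /phi0 /flat ltNge t0 /= mul0r.
- move=> t t1 /=; have f1 : flat 0 (1 - t) = 0 by rewrite /flat subr_gt0 ltNge t1.
  by rewrite /phi0 f1 addr0 divff // gt_eqF // flat_gt0 // (lt_le_trans ltr01).
Qed.

End Plateau.

(** Compactness as an induction principle: near-covering is applied to the filter of all families of
    sets that contain every superset of some A satisfying P. *)
Lemma compact_induction (T : topologicalType) (P : set T -> Prop) (K : set T) :
  P set0 -> (forall A B, P A -> P B -> P (A `|` B)) ->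
  (forall A B, A `<=` B -> P B -> P A) -> compact K ->
  (forall x, K x -> exists2 U, nbhs x U & P (U `&` K)) -> P K.
Proof.
move=> P0 PU Psub /compact_near_coveringP cK H.
pose F : set_system (set T) := [set Q | exists2 A, P A & forall B, A `<=` B -> Q B].
have FF : Filter F.
  split; first by exists set0.
    move=> Q1 Q2 [A1 PA1 H1] [A2 PA2 H2]; exists (A1 `|` A2); first exact: PU.
    by move=> B AB; split; [apply: H1 | apply: H2] => x Ax; apply: AB; [left|right].
  by move=> Q1 Q2 Q12 [A PA H1]; exists A => // B /H1 /Q12.
have [|A PA HA] := cK _ F (fun B x => K x -> B x) FF.
  move=> x Kx; have [U Ux PUK] := H x Kx.
  exists (U, [set B | U `&` K `<=` B]); first by split=> //; exists (U `&` K).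
  by move=> [y B] /= [Uy UB] Ky; exact: UB.
by apply: Psub PA => x Kx; exact: (HA A (fun x => id) x Kx).
Qed.

Section Cutoffs.
Variables (R : realType) (n : nat).
Implicit Types (K U W : set 'rV[R]_n) (x y : 'rV[R]_n) (f g : 'rV[R]_n -> R[i]).

Lemma norm_coord x i : `|x 0 i| <= `|x|.
Proof.
rewrite [X in _ <= X]/Num.Def.normr /= mx_normrE.
by apply: (@le_bigmax _ _ _ 0 (fun ij => `|x ij.1 ij.2|) (0, i)).
Qed.

Lemma norm_le_coord x (M : R) : 0 <= M -> (forall i, `|x 0 i| <= M) -> `|x| <= M.
Proof.
move=> M0 H; rewrite [X in X <= _]/Num.Def.normr /= mx_normrE.
by apply: bigmax_le => // -[a b] _ /=; rewrite (ord1 a).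
Qed.

Definition cball x (r : R) : set 'rV[R]_n := [set y | `|y - x| <= r].

Lemma compact_cball x r : compact (cball x r).
Proof.
apply: bounded_closed_compact.
  apply: (@filterS _ _ _ [set M | `|x| + r <= M]); last first.
    by exists (`|x| + r); split; [exact: num_real | move=> M /ltW].
  move=> M /= HM y /= yr; apply: le_trans HM; rewrite -[y](subrK x) addrC.
  by rewrite (le_trans (ler_normD _ _)) // lerD2l.
have -> : cball x r = (fun y => `|y - x|) @^-1` [set t | t <= r] by [].
apply: closed_comp; last exact: closed_le.
move=> y _; apply: continuous_comp; last exact: norm_continuous.
by apply: continuousB; [exact: cvg_id | exact: cst_continuous].
Qed.

Lemma open_cball U x : open U -> U x -> exists2 r : R, 0 < r & cball x r `<=` U.
Proof.
move=> oU Ux; have /nbhs_ballP [r r0 rU] : nbhs x U by exact: open_nbhs_nbhs.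
exists (r / 2); first by rewrite divr_gt0.
move=> y xy; apply: rU; rewrite -ball_normE /= distrC (le_lt_trans xy) //.
by rewrite ltr_pdivrMr // mulr_natr mulr2n ltrDl.
Qed.

Lemma is_derive_coord (q : R -> R) x i j (d : R) : is_derive (x 0 i) 1 q d ->
  is_derive x (delta_mx 0 j) (fun x => q (x 0 i)) (if j == i then d else 0).
Proof.
case: eqP => [->|/eqP ji] H.
  move: H => [d1 d2].
  have Q : (fun h : R => h^-1 *: (q ((h *: delta_mx 0 i + x) 0 i) - q (x 0 i)))
      = (fun h : R => h^-1 *: (q (h *: 1 + x 0 i) - q (x 0 i))).
    by apply/funext => h; rewrite !mxE !eqxx.
  by apply: DeriveDef; rewrite /derivable /derive Q.
apply: is_derive_approx => e e0; near=> h.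
rewrite !mxE [i == j]eq_sym (negbTE ji) andbF mulr0n !mulr0 addr0 subrr subr0 normr0.
by rewrite mulr_ge0 // ltW.
Unshelve. all: by end_near. Qed.

Variable phi : nat -> R -> R.
Hypothesis dphi : forall k (t : R), is_derive t 1 (phi k) (phi k.+1 t).

Lemma smooth_coord i (a b : R) : smooth setT (fun x => (phi 0 (a * x 0 i + b))%:C).
Proof.
pose q k t := a ^+ k * phi k (a * t + b).
have dq k (t : R) : is_derive t 1 (q k) (q k.+1 t).
  have d1 : is_derive t 1 (fun t => a * t + b) a.
    have := is_deriveD (is_deriveZ a (is_derive_id t (1 : R))) (is_derive_cst b t 1).
    by rewrite addr0 [X in is_derive _ _ _ X]mulr1.
  have := is_deriveZ (a ^+ k) (@is_derive1_comp R (phi k) _ t _ _ (dphi k _) d1).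
  by congr is_derive; rewrite /q exprSr /GRing.scale /=; ring.
have cq k (t : R) : {for t, continuous (q k)}.
  by apply: differentiable_continuous; apply/derivable1_diffP; case: (dq k t).
pose D s x : R[i] := (if all (eq_op^~ i) s then q (size s) (x 0 i) else 0)%:C.
have [||sD _] := @smooth_family R n setT D openT.
- move=> s x _; split; last exact: cst_continuous.
  rewrite /D; case: (all _ s); last exact: cst_continuous.
  apply: (@continuous_comp _ _ _ (fun x => x 0 i) (q (size s)) x); last exact: cq.
  exact: coord_continuous.
- move=> s j x _; split; last exact: is_derive_cst.
  rewrite /D /=; case: (all _ s) => /=; last by rewrite andbF; exact: is_derive_cst.
  by rewrite andbT; apply: is_derive_coord; exact: dq.
- by move: sD; congr smooth; apply/funext => x; rewrite /D /q /= expr0 mul1r.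
Qed.

Hypotheses (phi0 : forall t : R, t <= 0 -> phi 0%N t = 0)
  (phi1 : forall t : R, 1 <= t -> phi 0%N t = 1).

Lemma smooth1 U : smooth U (fun=> 1 : R[i]).
Proof.
apply: (@smooth_sub R n setT) => //.
have [||sD _] := @smooth_family R n setT (fun s _ => if s is [::] then 1 else 0 : R[i]) openT.
- by move=> s x _; split; exact: cst_continuous.
- by move=> s j x _; split; case: s => *; exact: is_derive_cst.
- exact: sD.
Qed.

Lemma bump x (r : R) : 0 < r -> exists f, [/\ smooth setT f,
  forall y, `|y - x| <= r / 2 -> f y = 1 & forall y, ~ cball x r y -> f y = 0].
Proof.
move=> r0.
(* The two arguments are 2 - (2/r) (y - x)_i and 2 + (2/r) (y - x)_i: both are at least 1 when |(y -
   x)_i| <= r/2, and one is at most 0 when |(y - x)_i| >= r. The norm being a maximum over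
   coordinates, a product of such factors suffices. *)
pose p i y : R[i] := (phi 0 (- (2 / r) * y 0 i + (2 + 2 / r * x 0 i)))%:C *
  (phi 0 (2 / r * y 0 i + (2 - 2 / r * x 0 i)))%:C.
have E1 i y : - (2 / r) * y 0 i + (2 + 2 / r * x 0 i) = 2 - 2 / r * (y - x) 0 i.
  by rewrite !mxE; ring.
have E2 i y : 2 / r * y 0 i + (2 - 2 / r * x 0 i) = 2 + 2 / r * (y - x) 0 i.
  by rewrite !mxE; ring.
exists (fun y => \prod_(i <- enum 'I_n) p i y); split.
- elim: (enum _) => [|i s IH].
    by rewrite (_ : (fun y => _) = fun=> 1); [exact: smooth1 | apply/funext => y; rewrite big_nil].
  have [sp _] := smoothM openT (smooth_coord i (- (2 / r)) (2 + 2 / r * x 0 i))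
    (smooth_coord i (2 / r) (2 - 2 / r * x 0 i)).
  have [sM _] := smoothM openT sp IH.
  by move: sM; congr smooth; apply/funext => y; rewrite big_cons.
- move=> y yx; apply: big1 => i _; rewrite /p E1 E2.
  have : `|(y - x) 0 i| <= r / 2 by exact: le_trans (norm_coord _ _) yx.
  rewrite ler_norml => /andP[h1 h2].
  have h3 : 2 / r * (y - x) 0 i <= 1.
    by rewrite mulrAC ler_pdivrMr // mul1r mulrC -ler_pdivlMr.
  have h4 : -1 <= 2 / r * (y - x) 0 i.
    by rewrite mulrAC ler_pdivlMr // mulN1r mulrC -ler_pdivrMr // mulNr.
  by rewrite !phi1 ?mulr1 //; lra.
- move=> y nyx.
  have [i Hi] : exists i, r < `|(y - x) 0 i|.
    apply: contrapT => H; apply: nyx; apply: norm_le_coord => [|i]; first exact: ltW.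
    by rewrite leNgt; apply/negP => h; apply: H; exists i.
  rewrite (big_rem i) ?mem_enum //= /p E1 E2.
  move: Hi; rewrite lter_normr => /orP[h|h].
    by rewrite phi0 ?mul0r // subr_le0 mulrAC ler_pdivlMr // ler_pM2l // ltW.
  rewrite (@phi0 (2 + 2 / r * (y - x) 0 i)) ?mulr0 ?mul0r //.
  rewrite -lerBrDl sub0r mulrAC ler_pdivrMr // mulNr -mulrN ler_pM2l //; lra.
Qed.

Lemma cutoff K U : compact K -> open U -> K `<=` U -> exists f W K',
  [/\ smooth setT f, open W /\ K `<=` W, forall y, W y -> f y = 1,
      compact K' /\ K' `<=` U & forall y, ~ K' y -> f y = 0].
Proof.
move=> cK oU KU.
apply: (compact_induction (P := fun K => exists f W K', [/\ smooth setT f,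
  open W /\ K `<=` W, forall y, W y -> f y = 1,
      compact K' /\ K' `<=` U & forall y, ~ K' y -> f y = 0])) => //.
- exists (fun=> 0), set0, set0; split=> //; first exact: (smooth0 openT).
    by split=> //; exact: open0.
  by split=> //; exact: compact0.
- move=> A B [f [W [K1 [sf [oW AW] f1 [cK1 K1U] f0]]]].
  move=> [g [W' [K2 [sg [oW' BW'] g1 [cK2 K2U] g0]]]].
  (* This is 1 - (1 - f)(1 - g), equal to 1 where f or g is 1 and to 0 where both vanish. *)
  exists (fun y => -1 * ((-1 * f y + 1) * (-1 * g y + 1)) + 1), (W `|` W'), (K1 `|` K2); split.
  + have h1 := smooth_lin (-1) openT sf (smooth1 setT).
    have h2 := smooth_lin (-1) openT sg (smooth1 setT).
    exact: (smooth_lin (-1) openT (smoothM openT h1 h2).1 (smooth1 setT)).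
  + split; first exact: openU.
    by move=> x [/AW|/BW']; [left | right].
  + by move=> y [/f1 ->|/g1 ->]; ring.
  + split; first exact: compactU.
    by move=> x [/K1U|/K2U].
  + move=> y nK; rewrite f0 ?g0; last 2 first.
    * by move=> K2y; apply: nK; right.
    * by move=> K1y; apply: nK; left.
    ring.
- move=> A B AB [f [W [K1 [sf [oW BW] f1 H f0]]]]; exists f, W, K1; split=> //.
  by split=> // x /AB /BW.
- move=> x Kx; have [r r0 rU] := open_cball oU (KU _ Kx).
  have [f [sf f1 f0]] := bump x r0.
  exists (ball x (r / 2)); first by apply: nbhsx_ballx; rewrite divr_gt0.
  exists f, (ball x (r / 2)), (cball x r); split=> //.
  + by split; [exact: ball_open | move=> y []].
  + by move=> y; rewrite -ball_normE /= distrC => /ltW; exact: f1.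
  + by split=> //; exact: compact_cball.
Qed.

End Cutoffs.

Lemma exists_cutoff (R : realType) n (K U : set 'rV[R]_n) : compact K -> open U ->
  K `<=` U -> exists f W K',
  [/\ smooth setT f, open W /\ K `<=` W, forall y, W y -> f y = 1,
      compact K' /\ K' `<=` U & forall y, ~ K' y -> f y = 0].
Proof. by move=> cK oU KU; have [phi [d p0 p1]] := plateau R; exact: (cutoff d p0 p1). Qed.

(** * Exhaustion by compact sets and a partition of unity *)

Section Exhaustion.
Variables (R : realType) (n : nat) (Om : openset R n).
Implicit Types (K L : set 'rV[R]_n) (x y : 'rV[R]_n).

Definition exh (m : nat) : set 'rV[R]_n :=
  cball 0 m%:R `&` [set x | ball x m.+1%:R^-1 `<=` Om].

Lemma exh_compact m : compact (exh m).
Proof.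
apply: compact_closedI; first exact: compact_cball.
rewrite -[X in closed X]setCK; apply: open_closedC.
rewrite openE => x /= nx; have r0 : 0 < m.+1%:R^-1 :> R by rewrite invr_gt0.
have [z xz nOz] : exists2 z, ball x m.+1%:R^-1 z & ~ openset_val Om z.
  by apply: contrapT => H; apply: nx => z xz; apply: contrapT => nOz; apply: H; exists z.
rewrite /interior /=; have : nbhs x (ball z m.+1%:R^-1).
  by apply: open_nbhs_nbhs; split; [exact: ball_open | exact: ball_sym].
by apply: filterS => y zy H; apply: nOz; apply: H; exact: ball_sym.
Qed.

Lemma exh_sub m : exh m `<=` Om.
Proof. by move=> x [_]; apply; apply: ballxx; rewrite invr_gt0. Qed.

Lemma exh_interior m : exh m `<=` (exh m.+1)^°.
Proof.
move=> x [xm xO]; rewrite /interior /=.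
pose d : R := m.+1%:R^-1 - m.+2%:R^-1.
have d0 : 0 < d by rewrite subr_gt0 ltf_pV2 ?posrE // ltr_nat.
have H : nbhs x (ball x (Num.min d 1)) by apply: nbhsx_ballx; rewrite lt_min d0 ltr01.
apply: filterS H => y; rewrite -ball_normE /= lt_min => /andP[yd y1]; split.
  move: xm; rewrite /cball /= !subr0 => xm; rewrite -[y](subrK x) -natr1 [_ + 1]addrC.
  by rewrite (le_trans (ler_normD _ _)) // lerD // distrC ltW.
move=> z; rewrite -ball_normE /= => yz; apply: xO; rewrite -ball_normE /=.
have -> : x - z = (x - y) + (y - z) by rewrite addrA subrK.
by rewrite (le_lt_trans (ler_normD _ _)) // -[ltRHS](subrK m.+2%:R^-1) ltrD.
Qed.

Lemma exh_succ m : exh m `<=` exh m.+1.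
Proof. by move=> x /exh_interior; exact: interior_subset. Qed.

Lemma exh_mono m m' : (m <= m')%N -> exh m `<=` exh m'.
Proof.
move=> /subnK <-; elim: (m' - m)%N => [//|k IH] x /IH; exact: exh_succ.
Qed.

Lemma exh_absorbs K : compact K -> K `<=` Om -> exists m, K `<=` exh m.
Proof.
move=> cK KOm; apply: (compact_induction (P := fun K => exists m, K `<=` exh m)) cK _.
- by exists 0%N.
- move=> A B [m1 H1] [m2 H2]; exists (maxn m1 m2) => x [/H1|/H2]; apply: exh_mono.
    exact: leq_maxl.
  exact: leq_maxr.
- by move=> A B AB [m H]; exists m => x /AB /H.
- move=> x /KOm Ox; have [r r0 rO] := open_cball (opensetP Om) Ox.
  have [m1 Hm1] := nat_ge `|x|; have [m2 Hm2] := nat_ge r^-1.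
  have Hx : exh (maxn m1 m2) x.
    split; first by rewrite /cball /= subr0 (le_trans Hm1) // ler_nat leq_maxl.
    move=> y; rewrite -ball_normE /= => xy; apply: rO; rewrite /cball /= distrC.
    rewrite (le_trans (ltW xy)) // -[r]invrK lef_pV2 ?posrE ?invr_gt0 //.
    by rewrite (le_trans Hm2) // ler_nat (leq_trans (leq_maxr m1 m2)).
  by exists (exh (maxn m1 m2).+1) => [|]; [exact: exh_interior | exists (maxn m1 m2).+1 => y []].
Qed.

Lemma exh_point x : openset_val Om x -> exists m, exh m x.
Proof.
move=> Ox; have c1 : compact [set x] by exact: compact_set1.
by have [_ ->//|m H] := exh_absorbs c1 _; exists m; exact: H.
Qed.

Lemma exh_cutoffs : exists theta : nat -> 'rV[R]_n -> R[i],
  [/\ forall m, smooth setT (theta m),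
      forall m x, exh m x -> theta m x = 1 &
      forall m x, ~ exh m.+1 x -> theta m x = 0].
Proof.
have /choice [theta H] : forall m, exists f : 'rV[R]_n -> R[i], [/\ smooth setT f,
    forall x, exh m x -> f x = 1 & forall x, ~ exh m.+1 x -> f x = 0].
  move=> m.
  have [f [W [K [sf [_ KW] f1 [_ KU] f0]]]] :=
    exists_cutoff (@exh_compact m) (@open_interior _ (exh m.+1)) (@exh_interior m).
  exists f; split=> // [x /KW|x nx]; first exact: f1.
  by apply: f0 => /KU /interior_subset.
by exists theta; split=> [m|m x|m x]; have [h1 h2 h3] := H m; [exact: h1 | exact: h2 | exact: h3].
Qed.

Definition exh_theta := xget (fun _ _ => 0) [set theta : nat -> 'rV[R]_n -> R[i] |
  [/\ forall m, smooth setT (theta m),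
      forall m x, exh m x -> theta m x = 1 &
      forall m x, ~ exh m.+1 x -> theta m x = 0]].

Lemma exh_thetaP : [/\ forall m, smooth setT (exh_theta m),
      forall m x, exh m x -> exh_theta m x = 1 &
      forall m x, ~ exh m.+1 x -> exh_theta m x = 0].
Proof. exact: (xgetPex _ exh_cutoffs). Qed.

(* A locally finite partition of unity; its partial sums telescope to exh_theta. *)
Definition exh_chi m x : R[i] :=
  if m is m'.+1 then exh_theta m x - exh_theta m' x else exh_theta 0 x.

(** Only the interior of the earlier member is removed, so that the shell is compact and still
    contains all points where [exh_chi m] is nonzero. *)
Definition shell m : set 'rV[R]_n :=
  exh m.+1 `\` (if m is m'.+1 then (exh m')^° else set0).

Lemma exh_chi_smooth m : smooth setT (exh_chi m).
Proof.
have [sT _ _] := exh_thetaP; case: m => [|m]; first exact: sT.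
have := smooth_lin (-1) openT (sT m) (sT m.+1).
by congr smooth; apply/funext => x; rewrite mulN1r addrC.
Qed.

Lemma exh_chi_sum M x : \sum_(m < M.+1) exh_chi m x = exh_theta M x.
Proof.
elim: M => [|M IH]; first by rewrite big_ord_recl big_ord0 addr0.
by rewrite big_ord_recr /= IH addrC subrK.
Qed.

Lemma exh_chi_shell m x : ~ shell m x -> exh_chi m x = 0.
Proof.
have [_ t1 t0] := exh_thetaP; case: m => [|m] nS /=.
  by apply: t0 => H; apply: nS; split.
have [xm|nxm] := pselect (exh m x).
  by rewrite t1 ?t1 ?subrr //; exact: exh_succ.
have nx : ~ exh m.+2 x.
  by move=> H; apply: nS; split=> // /interior_subset.
by rewrite !t0 ?subrr // => /exh_succ.
Qed.

Lemma exh_chi_exh M m x : (M < m)%N -> exh M x -> exh_chi m x = 0.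
Proof.
have [_ t1 _] := exh_thetaP; case: m => [//|m] Mm xM /=.
by rewrite !t1 ?subrr //; apply: exh_mono xM => //; exact: leqW.
Qed.

Lemma shell_compact m : compact (shell m).
Proof.
rewrite /shell setDE; apply: compact_closedI; first exact: exh_compact.
apply: open_closedC; case: m => [|m]; [exact: open0 | exact: open_interior].
Qed.

Lemma shell_sub m : shell m `<=` exh m.+1. Proof. by move=> x []. Qed.

Lemma shell_exh m M x : shell m x -> exh M x -> (m <= M.+1)%N.
Proof.
case: m => [//|m] [_ nx] xM; rewrite leqNgt; apply/negP => Mm; apply: nx.
have := exh_interior xM; apply: interiorS; apply: exh_mono; exact: Mm.
Qed.

End Exhaustion.

(** * Properly supported kernels *)

Section ProperCutoff.
Variables (R : realType) (n : nat) (Om : openset R n).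
Implicit Types (K L : set 'rV[R]_n) (x y : 'rV[R]_n) (z : 'rV[R]_(n + n)).
Variable V : set 'rV[R]_(n + n).
Hypothesis pV : proper_subset Om V.

Let X := exh Om.
Let chi := exh_chi Om.

Let fibre m : set 'rV[R]_n := closure (rsubmx @` (V `&` [set z | shell Om m (lsubmx z)])).

Lemma proper_fibre_compact m : compact (fibre m) /\ fibre m `<=` Om.
Proof.
have sO : shell Om m `<=` Om by move=> x /shell_sub /exh_sub.
have [[L [cL LOm VL]] _] := pV (@shell_compact R n Om m) sO.
have fL : fibre m `<=` L.
  by have := closure_subset VL; rewrite -(closure_id L).1 //; exact: compact_closed_rV.
split; last by move=> y /fL /LOm.
exact: (subclosed_compact (@closed_closure _ _) cL fL).
Qed.

(* psi m is 1 near the fibre over the m-th shell and vanishes on the members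
   of the exhaustion, up to the m-th, that do not meet this fibre. *)
Lemma proper_psi : exists psi : nat -> 'rV[R]_n -> R[i],
  [/\ forall m, smooth setT (psi m),
      forall m y, fibre m y -> \forall y' \near y, psi m y' = 1,
      forall m, exists K, [/\ compact K, K `<=` Om & forall y, ~ K y -> psi m y = 0] &
      forall m r y, (r < m)%N -> X r `&` fibre m = set0 -> X r y -> psi m y = 0].
Proof.
suff /choice [psi H] : forall m, exists p : 'rV[R]_n -> R[i], [/\ smooth setT p,
    forall y, fibre m y -> \forall y' \near y, p y' = 1,
    exists K, [/\ compact K, K `<=` Om & forall y, ~ K y -> p y = 0] &
    forall r y, (r < m)%N -> X r `&` fibre m = set0 -> X r y -> p y = 0].
  by exists psi; split=> [m|m y|m|m r y]; have [h1 h2 h3 h4] := H m;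
    [exact: h1 | exact: h2 | exact: h3 | exact: h4].
move=> m; have [cF FOm] := proper_fibre_compact m.
(* The condition r < m makes this a finite union, hence a closed set. *)
pose B := \bigcup_(r in [set r | (r < m)%N /\ X r `&` fibre m = set0]) X r.
have cB : closed B.
  apply: closed_bigcup => [|r _]; last by apply: compact_closed_rV; exact: exh_compact.
  by apply: (sub_finite_set _ (finite_II m)) => r [].
have oU : open (Om `&` ~` B) by apply: openI; [exact: opensetP | exact: closed_openC].
have [|f [W [K [sf [oW FW] f1 [cK KU] f0]]]] := exists_cutoff cF oU.
  move=> y Fy; split; first exact: FOm.
  by move=> [r [_ XF] Xy]; have : (X r `&` fibre m) y by []; rewrite XF.
exists f; split=> //.
- move=> y /FW Wy; have : nbhs y W by exact: open_nbhs_nbhs.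
  by apply: filterS => y' /f1.
- by exists K; split=> // y /KU [].
- by move=> r y rm XF Xy; apply: f0 => /KU [_]; apply; exists r.
Qed.

(** Psi(x, y) is the sum over m of chi_m(x) psi_m(y). It is locally finite in x by the partition of
    unity. For y in a compact set it is also finite in m, because by properness the fibres over
    distant shells miss that compact set and psi_m then vanishes there. *)
Lemma proper_cutoff : exists Psi : 'rV[R]_(n + n) -> R[i],
  [/\ smooth (Omsq Om) Psi,
      forall K, compact K -> K `<=` Om -> exists L, [/\ compact L, L `<=` Om &
        forall x y, K x -> ~ L y -> Psi (row_mx x y) = 0],
      forall K, compact K -> K `<=` Om -> exists L, [/\ compact L, L `<=` Om &
        forall x y, openset_val Om x -> K y -> ~ L x -> Psi (row_mx x y) = 0] &
      forall z, V z -> openset_val (Omsq Om) z -> \forall z' \near z, Psi z' = 1].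
Proof.
have [psi [spsi psi1 psiK psi0]] := proper_psi.
pose F M z := \sum_(m < M.+1) chi m (lsubmx z) * psi m (rsubmx z).
(* Psi is a partial sum whose length depends on x; [FE] shows that any M with x in X M gives the
   same value, which yields local smoothness. *)
pose idx x := xget 0%N [set m | X m x].
pose Psi z := F (idx (lsubmx z)) z.
have FE M z : X M (lsubmx z) -> Psi z = F M z.
  move=> XM.
  have stab M' k : X M' (lsubmx z) -> F (M' + k)%N z = F M' z.
    move=> XM'; elim: k => [|k IH]; first by rewrite addn0.
    rewrite addnS /F big_ord_recr /= -/(F (M' + k)%N z) IH.
    have -> : exh_theta Om (M' + k).+1 (lsubmx z) - exh_theta Om (M' + k)%N (lsubmx z) = 0.
      by apply: (exh_chi_exh (m := (M' + k).+1) _ XM'); rewrite ltnS leq_addr.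
    by rewrite mul0r addr0.
  have XI : X (idx (lsubmx z)) (lsubmx z) by apply: (@xgetPex _ _ [set m | X m (lsubmx z)]); exists M.
  rewrite /Psi; have [h|h] := leqP M (idx (lsubmx z)).
    by rewrite -(subnKC h) stab.
  by rewrite -(subnKC (ltnW h)) stab.
have sF M : smooth setT (F M).
  rewrite /F; elim: M => [|M IH].
    rewrite (_ : (fun z => _) = (fun z => chi 0%N (lsubmx z) * psi 0%N (rsubmx z))).
      exact: (smoothM openT (@smooth_lsub R n n _ _ openT (@exh_chi_smooth _ _ Om 0))
        (@smooth_rsub R n n _ _ openT (spsi 0%N))).1.
    by apply/funext => z; rewrite big_ord1.
  have h := (smoothM openT (@smooth_lsub R n n _ _ openT (@exh_chi_smooth _ _ Om M.+1))
        (@smooth_rsub R n n _ _ openT (spsi M.+1))).1.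
  have := smooth_lin 1 openT IH h.
  by congr smooth; apply/funext => z; rewrite mul1r [RHS]big_ord_recr.
have cl : continuous (@lsubmx R 1 n n) by exact: continuous_lsubmx.
have cr : continuous (@rsubmx R 1 n n) by exact: continuous_rsubmx.
exists Psi; split.
- apply: smooth_local => z [Oz _].
  have [M XM] := exh_point Oz.
  exists [set z | (X M.+1)^° (lsubmx z)], (F M.+1); last first.
    by move=> y /interior_subset; exact: FE.
  split; last exact: (smooth_sub (fun=> fun=> I) (sF M.+1)).
    by apply: open_comp (@open_interior _ (X M.+1)) => y _; exact: cl.
  exact: exh_interior.
- move=> K cK KOm; have [M KM] := exh_absorbs cK KOm.
  have /choice [r Hr] : forall m, exists r, forall y, ~ X r y -> psi m y = 0.
    move=> m; have [K' [cK' K'Om p0]] := psiK m; have [r Kr] := exh_absorbs cK' K'Om.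
    by exists r => y nX; apply: p0 => /Kr.
  exists (X (\max_(m < M.+1) r m)); split; [exact: exh_compact | exact: exh_sub |].
  move=> x y Kx nX; rewrite (FE M) ?row_mxKl; last exact: KM.
  apply: big1 => m _; rewrite row_mxKr Hr ?mulr0 // => Xm; apply: nX.
  by apply: exh_mono Xm; exact: (@leq_bigmax _ (fun m : 'I_M.+1 => r m) m).
- move=> K cK KOm; have [r Kr] := exh_absorbs cK KOm.
  (* If X r met the fibre over shell m, then, the fibre being a closure and X r.+1 a neighbourhood
     of X r, some point of V would lie over shell m with second component in X r.+1. Its first
     component is then in L0, inside X q, which forces m <= q + 1. *)
  have [_ [L0 [cL0 L0Om VL0]]] := pV (@exh_compact R n Om r.+1) (@exh_sub R n Om r.+1).
  have [q L0q] := exh_absorbs cL0 L0Om.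
  exists (X (maxn r q.+1).+1); split; [exact: exh_compact | exact: exh_sub |].
  move=> x y Ox Ky nX.
  have [M XM] := exh_point Ox; rewrite (FE M) ?row_mxKl //.
  apply: big1 => m _; rewrite row_mxKl row_mxKr.
  have [h|h] := leqP m (maxn r q.+1).
    rewrite [chi _ _]exh_chi_shell ?mul0r // => /shell_sub xm; apply: nX.
    exact: exh_mono xm.
  have [rm qm] : (r < m)%N /\ (q.+1 < m)%N by apply/andP; rewrite -gtn_max.
  rewrite (psi0 m r) ?mulr0 //; last exact: Kr.
  apply/seteqP; split=> // y0 [Xy0 Fy0].
  have [_ [[z [Vz sz] <-] Xz]] := Fy0 _ (exh_interior Xy0).
  have /L0q Lz : L0 (lsubmx z) by apply: VL0; exists z.
  by have := shell_exh sz Lz; rewrite leqNgt qm.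
- move=> z Vz [Oz1 Oz2].
  have [M XM] := exh_point Oz1.
  have nX : \forall z' \near z, X M.+1 (lsubmx z').
    by have := cl z _ (exh_interior XM); exact.
  (* Near z each factor psi_m may be replaced by 1: either x is in shell m and psi_m is 1 near y, or
     chi_m vanishes near x. What remains is the sum of the chi_m, that is, 1. *)
  have np : \forall z' \near z, forall m : 'I_M.+2,
      chi m (lsubmx z') * psi m (rsubmx z') = chi m (lsubmx z').
    apply: (@filter_forall _ _ (fun (m : 'I_M.+2) (z' : 'rV[R]_(n + n)) =>
      chi m (lsubmx z') * psi m (rsubmx z') = chi m (lsubmx z')) (nbhs z) (nbhs_filter z)) => m.
    have [sz|nsz] := pselect (shell Om m (lsubmx z)).
      have Fz : fibre m (rsubmx z) by apply: subset_closure; exists z.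
      have H : nbhs z [set z' | psi m (rsubmx z') = 1] := cr z _ (psi1 m _ Fz).
      apply: (@filterS _ _ (nbhs_filter z) _ _ _ H) => z' /= ->.
      by rewrite mulr1.
    have oS : open (~` shell Om m).
      by apply: closed_openC; apply: compact_closed_rV; exact: shell_compact.
    have H : nbhs z [set z' | ~ shell Om m (lsubmx z')] :=
      cl z _ (open_nbhs_nbhs (conj oS nsz)).
    apply: (@filterS _ _ (nbhs_filter z) _ _ _ H) => z' /= nz'.
    by rewrite [chi _ _]exh_chi_shell // mul0r.
  apply: (@filterS2 _ _ (nbhs_filter z) _ _ _ _ nX np) => z' Xz' Hz'; rewrite (FE M.+1) // /F.
  rewrite (eq_bigr (fun m : 'I_M.+2 => chi m (lsubmx z'))) // exh_chi_sum.
  by have [_ t1 _] := exh_thetaP Om; exact: t1.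
Qed.

End ProperCutoff.

(** * Multiplication by a fixed smooth function *)

Section Multiplication.
Variables (R : realType) (n : nat) (Om : openset R n).
Implicit Types (K : set 'rV[R]_n) (f : 'rV[R]_n -> R[i]) (v : R -> 'rV[R]_n -> R[i]).

Lemma Obound_cst f K s : smooth Om f -> compact K -> K `<=` Om ->
  Obound K s (fun=> f) 0.
Proof.
move=> sf cK KOm; have [B B0 HB] := smooth_bounded s sf cK KOm.
by exists B; apply: nearW => e x Kx; rewrite powRr0 mulr1; exact: HB.
Qed.

Lemma Obound_factor f v K s b : smooth Om f -> smooth_net Om v -> compact K ->
  K `<=` Om -> (forall c, (size c <= size s)%N -> Obound K c v b) ->
  Obound K s (fun e x => f x * v e x) b.
Proof.
move=> sf sv cK KOm H; rewrite -[b]add0r.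
apply: (@OboundM R n Om K s (fun=> f) v) => // p ps; first exact: Obound_cst.
by apply: H; rewrite -(size_splits ps) leq_addl.
Qed.

Lemma smooth_net_factor f v : smooth Om f -> smooth_net Om v ->
  smooth_net Om (fun e x => f x * v e x).
Proof. by move=> sf sv e e01; exact: (smoothM (opensetP Om) sf (sv e e01)).1. Qed.

Lemma Gmod_factor inf f v : smooth Om f -> Gmod Om inf v ->
  Gmod Om inf (fun e x => f x * v e x).
Proof.
move=> sf [sv mv]; split; first exact: smooth_net_factor.
move=> K cK KOm; case: inf mv => mv.
  by have [N HN] := mv K cK KOm; exists N => s; exact: Obound_factor.
move=> s.
have [|N HN] := @moderate_on_set _ _ false K v [set c | (size c <= size s)%N] (mv K cK KOm).
  by right; exists (size s).
by exists N; exact: Obound_factor.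
Qed.

Lemma Obound_setU K K' s v b : Obound K s v b -> Obound K' s v b ->
  Obound (K `|` K') s v b.
Proof.
move=> [C H] [C' H']; exists (Num.max C C'); apply: filterS2 H H' => e He H'e.
move=> x [/He|/H'e] /le_trans; apply; apply: ler_wpM2r; rewrite ?powR_ge0 //.
  by rewrite le_max lexx.
by rewrite le_max lexx orbT.
Qed.

(** The net (f - 1) v is zero near the support of the class and negligible near every other point;
    [compact_induction] turns these local estimates into one on K. *)
Lemma Gclass_cutoff f v : smooth Om f -> Gmoderate Om v ->
  (forall x, Gsupp (Gclass Om v) x -> \forall y \near x, f y = 1) ->
  Gclass Om (fun e x => f x * v e x) = Gclass Om v.
Proof.
move=> sf mv f1; have sv := Gmoderate_smooth mv; have oOm := opensetP Om.
have mfv : Gmoderate Om (fun e x => f x * v e x).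
  exact: Gmod_moderate (Gmod_factor sf ((Gmod_false _ _).2 mv)).
apply: Gclass_eq => //; apply: Gnegligible_intro => K cK KOm s q.
set d := fun e x => _; apply: (compact_induction (P := fun A => Obound A s d q%:R)) cK _.
- by exists 0; apply: nearW => e x [].
- by move=> A B; exact: Obound_setU.
- by move=> A B AB; exact: Obound_sub.
move=> x Kx; have [/f1 xf1|nx] := pselect (Gsupp (Gclass Om v) x).
  exists [set y | f y = 1]°; first by exact: nbhs_interior.
  exists 0; apply: nearW => e y [yW _]; rewrite (@DseqC_eq0 _ _ [set y | f y = 1]°) //.
  - by rewrite normc0 mul0r.
  - exact: open_interior.
  - by move=> z /interior_subset /= fz; rewrite /d fz mul1r subrr.
have [U [oU Ux UOm nU]] : exists U, [/\ open U, U x, U `<=` Om &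
    Gnegligible U (Grepr (Gclass Om v))].
  by apply: contrapT => H; apply: nx; split=> //; exact: KOm.
have [r r0 rU] := open_cball oU Ux.
have cb : compact (cball x r) by exact: compact_cball.
have bO : cball x r `<=` Om by move=> y /rU /UOm.
exists (cball x r).
  by apply/nbhs_ballP; exists r => // y; rewrite -ball_normE /cball /= distrC => /ltW.
apply: (@Obound_sub _ _ _ (cball x r)); first by move=> y [].
have sf1 := smooth_lin 1 oOm sf (smooth_lin (-1) oOm (smooth1 Om) (smooth0 oOm)).
have := @Obound_factor _ v (cball x r) s q%:R sf1 sv cb bO.
have -> : (fun e y => (1 * f y + (-1 * 1 + 0)) * v e y) = d.
  by apply/funext => e; apply/funext => y; rewrite /d; ring.
apply=> c _; apply/(Obound_rep c q%:R mv cb bO).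
exact: (Gnegligible_Obound c _ UOm (Gmoderate_smooth (Gmoderate_repr _)) nU cb rU).
Qed.

End Multiplication.

Section ProperKernels.
Variables (R : realType) (n : nat) (Om : openset R n).
Implicit Types (K L : set 'rV[R]_n) (kap : R -> 'rV[R]_(n + n) -> R[i]).

(** Properness of the representative itself, for every e; the support of the class alone gives only
    negligibility off a proper set. *)
Definition proper_net kap : Prop := forall K, compact K -> K `<=` Om ->
  exists L, [/\ compact L, L `<=` Om, fibred (@pairxy R n) Om kap K L &
    fibred (@pairyx R n) Om kap K L].

Lemma exists_proper_net inf kap : Gmod (Omsq Om) inf kap ->
  proper_subset Om (Gsupp (Gclass (Omsq Om) kap)) ->
  exists kap', [/\ Gmod (Omsq Om) inf kap',
    Gclass (Omsq Om) kap' = Gclass (Omsq Om) kap & proper_net kap'].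
Proof.
move=> mk pk; have [Psi [sP P1 P2 P3]] := proper_cutoff pk.
exists (fun e z => Psi z * kap e z); split.
- exact: Gmod_factor.
- apply: Gclass_cutoff => //; first exact: Gmod_moderate mk.
  by move=> z Sz; apply: P3 => //; case: Sz.
- move=> K cK KOm; have [L1 [cL1 L1O H1]] := P1 K cK KOm.
  have [L2 [cL2 L2O H2]] := P2 K cK KOm.
  exists (L1 `|` L2); split; first exact: compactU.
  + by move=> x [/L1O|/L2O].
  + by move=> e x y e01 Kx Oy nL; rewrite H1 ?mul0r // => ?; apply: nL; left.
  + by move=> e y x e01 Ky Ox nL; rewrite [Psi _]H2 ?mul0r // => ?; apply: nL; right.
Qed.

End ProperKernels.

(** * Compact supports and inductive limits *)

Section Scaling.
Variable R : realType.

Definition cpow_net (b : R) (e : R) : R[i] := (e `^ b)%:C.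
(** Invertible scalars for rescaling: multiplication by [cpow b] multiplies a seminorm by at most
    expR (- b). *)
Definition cpow (b : R) : Cgen R := Cclass (cpow_net b).

Lemma normc_cpow_net b (e : R) : normc (cpow_net b e) = e `^ b.
Proof.
rewrite /cpow_net /normc /= expr0n addr0 sqrtr_sqr ger0_norm //; exact: powR_ge0.
Qed.

Lemma bigOpow_cpow_net b : bigOpow (fun e => (normc (cpow_net b e))%:E) b.
Proof. by exists 1; apply: nearW => e; rewrite normc_cpow_net mul1r. Qed.

Lemma cpow_net_moderate b : Cmoderate (cpow_net b).
Proof.
have [N bN] := nat_ge (- b); exists N; apply: bigOpow_weak (bigOpow_cpow_net b).
by rewrite lerNl.
Qed.

Lemma Cabs_cpow b : (Cabs (cpow b) <= (expR (- b))%:E)%E.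
Proof.
rewrite /cpow Cabs_class; last exact: cpow_net_moderate.
by apply: expsup_ub; exact: bigOpow_cpow_net.
Qed.

Lemma cpowK b : cpow b * cpow (- b) = 1.
Proof.
rewrite /cpow -CclassM -?Cclass1; [|exact: cpow_net_moderate|exact: cpow_net_moderate].
apply/esym/Cclass_near; first by exists 0%N; rewrite oppr0; exact: bigOpow_cst.
near=> e.
have e0 : e != 0 by apply: lt0r_neq0; near: e; exact: nbhs_right_gt.
by rewrite /cpow_net -rmorphM -powRD ?e0 ?implybT // subrr powRr0.
Unshelve. all: by end_near. Qed.

Variables (n : nat) (Om : openset R n).
Implicit Types (K L : set 'rV[R]_n) (v : R -> 'rV[R]_n -> R[i]) (u : G Om)
  (A : set (seq 'I_n)).

Lemma Obound_cpow K s v b a : K `<=` Om -> smooth_net Om v ->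
  Obound K s v a -> Obound K s (fun e x => cpow_net b e * v e x) (b + a).
Proof.
move=> KOm sv [C HC]; exists C; near=> e => x Kx.
have e01 : 0 < e <= 1 by near: e; exact: near_unit.
have e0 : e != 0 by apply: lt0r_neq0; case/andP: e01.
have s0 := smooth0 (opensetP Om).
have -> : (fun x => cpow_net b e * v e x) = (fun x => cpow_net b e * v e x + 0).
  by apply/funext => y; rewrite addr0.
rewrite (DseqC_lin _ _ (opensetP Om) (sv e e01) s0 (KOm _ Kx)).
rewrite (@DseqC_eq0 _ _ Om (fun=> 0)) //; [|exact: opensetP|exact: KOm].
rewrite addr0 normcM normc_cpow_net powRD ?e0 ?implybT // mulrCA ler_wpM2l ?powR_ge0 //.
by move: x Kx; near: e.
Unshelve. all: by end_near. Qed.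

Lemma Gclass0 : Gclass Om (fun _ _ => 0) = 0.
Proof.
have mu := Gmoderate_repr (0 : G Om); rewrite -[RHS](subrr (Gclass Om (Grepr (0 : G Om)))).
by rewrite -GclassB //; congr (Gclass Om _); apply/funext => e; apply/funext => x; rewrite subrr.
Qed.

Lemma Gmod0 inf : Gmod Om inf (fun _ _ => 0).
Proof.
have s0 := smooth0 (opensetP Om); split=> // K cK KOm; case: inf.
  by exists 0%N => s; rewrite oppr0; exact: (Obound_cst s s0 cK KOm).
by move=> s; exists 0%N; rewrite oppr0; exact: (Obound_cst s s0 cK KOm).
Qed.

Lemma Gsupp_vanishes L v : Gmoderate Om v -> closed L -> vanishes_off Om L v ->
  Gsupp (Gclass Om v) `<=` L.
Proof.
move=> mv cL v0 x [Ox nx]; apply: contrapT => nL; apply: nx.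
have oU : open (Om `&` ~` L) by apply: openI; [exact: opensetP | exact: closed_openC].
exists (Om `&` ~` L); split; [exact: oU | by split | exact: subIsetl |].
apply: Gnegligible_intro => K cK KU s q.
have KOm : K `<=` Om by move=> y /KU [].
apply/(Obound_rep s _ mv cK KOm); exists 0; near=> e => y Ky.
rewrite (@DseqC_eq0 _ _ (Om `&` ~` L)) ?normc0 ?mul0r //; last exact: KU.
move=> z [Oz nLz]; apply: v0 => //; near: e; exact: near_unit.
Unshelve. all: by end_near. Qed.

Lemma Gsupp_Gc L v : Gmoderate Om v -> compact L -> L `<=` Om ->
  vanishes_off Om L v -> Gc (Gclass Om v).
Proof. by move=> mv cL LOm v0; exists v; split=> //; exists L; split=> // e x; exact: v0. Qed.

(* G_K and G_c ([false]), G^oo_K and G^oo_c ([true]) *)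
Definition Gcset (inf : bool) : set (G Om) := if inf then @Ginfc R n Om else @Gc R n Om.

Definition lcsGK (inf : bool) K : lcs R (G Om) :=
  Lcs [set u | Gcset inf u /\ Gsupp u `<=` K]
    [set P | exists K' A, [/\ compact K', K' `<=` Om, K `<=` interior K' &
       admissible inf A /\ P = Nsem K' A]].

Definition lcsGc (inf : bool) : lcs R (G Om) :=
  lcs_indlim (Gcset inf) [set K | compact K /\ K `<=` Om] (lcsGK inf).

Lemma lcsGc_false : lcs_Gc Om = lcsGc false.
Proof.
rewrite /lcs_Gc /lcsGc; congr lcs_indlim; apply/funext => K.
congr Lcs; apply/seteqP; split=> P.
  move=> [K' [j [cK KOm KK' ->]]]; exists K', [set s | (size s <= j)%N].
  by split=> //; split; [exists j | exact: Gseminorm_Nsem].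
move=> [K' [_ [cK KOm KK' [[j ->] ->]]]]; exists K', j.
by split=> //; rewrite Gseminorm_Nsem.
Qed.

Lemma lcsGc_true : lcs_Ginfc Om = lcsGc true.
Proof.
rewrite /lcs_Ginfc /lcsGc; congr lcs_indlim; apply/funext => K.
congr Lcs; apply/seteqP; split=> P.
  move=> [K' [cK KOm KK' ->]]; exists K', setT.
  by split=> //; split=> //; exact: Ginf_seminorm_Nsem.
move=> [K' [_ [cK KOm KK' [-> ->]]]]; exists K'.
by split=> //; rewrite Ginf_seminorm_Nsem.
Qed.

Lemma Gcset_class inf L v : Gmod Om inf v -> compact L -> L `<=` Om ->
  vanishes_off Om L v -> Gcset inf (Gclass Om v).
Proof.
move=> mv cL LOm v0; have Gv := Gsupp_Gc (Gmod_moderate mv) cL LOm v0.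
by case: inf mv => // mv; split=> //; exact: Gmod_Ginf.
Qed.

(** Continuity at 0 of the inclusion of G_L, unfolded. The finite list of seminorms and the radius
    depend on L. *)
Lemma lcsGc_small inf (P : G Om -> \bar R) L (r : R) : lcs_fam (lcsGc inf) P ->
  compact L -> L `<=` Om -> 0 < r ->
  exists (s : seq (set 'rV[R]_n * set (seq 'I_n))) (r' : R),
    [/\ forall q, q \in s -> [/\ compact q.1, q.1 `<=` Om & admissible inf q.2],
        0 < r' & forall u, Gcset inf u -> Gsupp u `<=` L ->
          (forall q, q \in s -> (Nsem q.1 q.2 u < r'%:E)%E) -> (P u < r%:E)%E].
Proof.
move=> [uP cP] cL LOm r0; have [_ c0] := cP L (conj cL LOm).
have v0 : vanishes_off Om set0 (fun _ _ => 0) by [].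
have m0 := Gmod_moderate (Gmod0 false).
have E0 : lcs_set (lcsGK inf L) 0.
  rewrite -Gclass0; split.
    by apply: (Gcset_class (Gmod0 inf)) v0; [exact: compact0 | move=> x []].
  by move=> x /(Gsupp_vanishes m0 (@closed0 _) v0).
have : lcs_nbhs (Lcs (Gcset inf) [set P]) 0 [set v | (P v < r%:E)%E].
  exists [:: P], r; split=> // [Q|v [_ vlt]]; first by rewrite inE => /eqP ->.
  by have := vlt P (mem_head _ _); rewrite subr0.
move=> /(c0 0 E0) [s [r' [sE r'0 H]]].
have /choice [f Hf] : forall Q, exists q : set 'rV[R]_n * set (seq 'I_n), Q \in s ->
    [/\ compact q.1, q.1 `<=` Om & admissible inf q.2 /\ Q = Nsem q.1 q.2].
  move=> Q; have [Qs|nQ] := boolP (Q \in s); last by exists (set0, set0).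
  by have [K' [A [h1 h2 _ h3]]] := sE Q Qs; exists (K', A).
exists (map f s), r'; split=> // [q /mapP [Q Qs ->]|v Gv Lv Hv].
  by have [h1 h2 [h3 _]] := Hf Q Qs.
apply: H; split=> // Q Qs; rewrite subr0; have [_ _ [_ QE]] := Hf Q Qs.
by rewrite QE; apply: Hv; exact: map_f.
Qed.

End Scaling.

(** * Functionals on G_c *)

Section DualOfGc.
Variables (R : realType) (n : nat) (Om : openset R n).
Implicit Types (K L : set 'rV[R]_n) (T : G Om -> Cgen R) (B : set (seq 'I_n))
  (kap : R -> 'rV[R]_(n + n) -> R[i]) (v : R -> 'rV[R]_n -> R[i]).

Lemma cpow_class b v : Gmoderate Om v ->
  Gmoderate Om (fun e x => cpow_net b e * v e x) /\
  cpow b *: Gclass Om v = Gclass Om (fun e x => cpow_net b e * v e x).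
Proof.
move=> mv; split; first exact: Gmoderate_scale (cpow_net_moderate b) mv.
exact: (scaleGE (cpow_net_moderate b) mv).
Qed.

Lemma expR_small (r : R) : 0 < r -> exists b : R, expR (- b) < r.
Proof.
move=> r0; exists (1 - ln r); rewrite opprB expRD lnK ?posrE //.
by rewrite gtr_pMr // -expR0 ltr_expR oppr_lt0.
Qed.

Lemma proper_net_fibred kap K : proper_net Om kap -> compact K -> K `<=` Om ->
  exists U L, [/\ open U /\ K `<=` U, U `<=` Om, compact L /\ L `<=` Om,
    fibred (@pairxy R n) Om kap U L & fibred (@pairyx R n) Om kap U L].
Proof.
move=> pk cK KOm; have [M KM] := exh_absorbs cK KOm.
have [L [cL LOm f1 f2]] := pk _ (@exh_compact R n Om M.+1) (@exh_sub R n Om M.+1).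
exists ((exh Om M.+1)^°), L; split=> //.
- split; first exact: open_interior.
  by move=> x /KM; exact: exh_interior.
- by move=> x /interior_subset; exact: exh_sub.
- by move=> e x y e01 /interior_subset; exact: f1.
- by move=> e x y e01 /interior_subset; exact: f2.
Qed.

(** All slices are supported in one compact set L. Multiplying by [cpow b] with b large brings the
    finitely many relevant seminorms below the radius, so P is less than 1 there; multiplying back
    bounds P by expR b on the slices. *)
Lemma slices_bounded_Gc inf kap K B : Gmod (Omsq Om) inf kap -> proper_net Om kap ->
  admissible inf B -> compact K -> K `<=` Om ->
  lcs_bounded (lcs_Gc Om) (slices kap K B).
Proof.
move=> mk pk adB cK KOm; rewrite lcsGc_false.
have [U [L [[oU KU] UOm [cL LOm] kUL _]]] := proper_net_fibred pk cK KOm.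
have sm s x : (forall e, K (x e)) -> Gmoderate Om (slice_net kap s x).
  by move=> Kx; exact: (@slice_net_moderate R n Om kap K s x (Gmod_moderate mk) cK KOm Kx).
have sv s x : (forall e, K (x e)) -> vanishes_off Om L (slice_net kap s x).
  by move=> Kx; exact: (@slice_net_vanishes _ _ _ kap U L s x mk.1 oU UOm (fun e => KU _ (Kx e)) kUL).
split=> [_ [s [x [_ Kx ->]]]|P FP]; first exact: Gsupp_Gc (sm s x Kx) cL LOm (sv s x Kx).
have [s0 [r [H0 r0 HP]]] := lcsGc_small FP cL LOm ltr01.
have /choice [N HN] : forall q : set 'rV[R]_n * set (seq 'I_n), exists N : nat,
    q \in s0 -> forall s x c, B s -> (forall e, K (x e)) -> q.2 c ->
      Obound q.1 c (slice_net kap s x) (- N%:R).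
  move=> q; have [/H0 [c1 c2 [j ->]]|] := boolP (q \in s0); last by exists 0%N.
  by have [N HN] := slices_Obound j mk adB cK KOm c1 c2; exists N => _.
pose N0 := (\sum_(q <- s0) N q)%N.
(* N0 compensates the growth exponents of the slices and b0 brings the seminorms below the radius
   r. *)
have [b0 Hb0] := expR_small r0; pose b := N0%:R + b0.
exists (expR b) => _ [s [x [Bs Kx ->]]]; set v := slice_net kap s x.
have mv : Gmoderate Om v := sm s x Kx.
have v0 : vanishes_off Om L v := sv s x Kx.
have [mbv bvE] := cpow_class b mv.
have bv0 : vanishes_off Om L (fun e x => cpow_net b e * v e x).
  by move=> e y e01 Oy nL; rewrite v0 ?mulr0.
have Gbv := Gsupp_Gc mbv cL LOm bv0.
have {HP} Pbv : (P (cpow b *: Gclass Om v) < 1%:E)%E.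
  rewrite bvE; apply: HP => //.
    by apply: Gsupp_vanishes => //; exact: compact_closed_rV.
  move=> q qs; have [c1 c2 _] := H0 q qs; rewrite Nsem_class //.
  apply: (@le_lt_trans _ _ (expR (- b0))%:E); last by rewrite lte_fin.
  apply: expsup_ub => c qc.
  apply: (@Obound_weak _ _ _ _ _ (b + - (N q)%:R)).
    rewrite /b addrAC lerDr subr_ge0 ler_nat /N0 (big_rem q) //=; exact: leq_addr.
  exact: (Obound_cpow b c2 (Gmoderate_smooth mv) (HN q qs s x c Bs Kx qc)).
have [[_ P0 PZ _] _] := FP.
have -> : Gclass Om v = cpow (- b) *: (cpow b *: Gclass Om v).
  by rewrite scalerA mulrC cpowK scale1r.
rewrite bvE in Pbv *; apply: (le_trans (PZ _ _ Gbv)).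
apply: (@le_trans _ _ ((expR b)%:E * 1%:E)%E); last by rewrite mule1.
apply: lee_pmul => //; last exact: ltW.
- exact: expeR_ge0.
- by case/andP: (P0 _ Gbv).
- by have := Cabs_cpow (- b); rewrite opprK.
Qed.

Lemma basic_Gc_acts_on T kap : basic_Gc T -> proper_net Om kap ->
  acts_on T (net_of_Gc T) kap.
Proof.
move=> bT pk K cK KOm.
have [U [L [[oU KU] UOm [cL LOm] kUL _]]] := proper_net_fibred pk cK KOm.
by exists U, L; split=> //; exact: (basic_net_Gc_represents cL LOm (net_of_GcP bT)).
Qed.

Lemma Lb_Gc_maps (A : kernel_operator Om) inf kap : Gmod (Omsq Om) inf kap ->
  Gclass (Omsq Om) kap = op_kernel A -> proper_net Om kap ->
  maps_dual_continuously A (Lb_Gc Om) (lcsG Om inf).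
Proof.
move=> mk kA pk.
apply: (maps_dual_lcsG mk kA (fun T bT => basic_Gc_acts_on bT pk)).
by move=> K B cK KOm adB; exact: slices_bounded_Gc mk pk adB cK KOm.
Qed.

End DualOfGc.

(** * Compactly supported images and their decomposition *)

Section SupportedNets.
Variables (R : realType) (n : nat) (Om : openset R n).
Implicit Types (K L : set 'rV[R]_n) (T : G Om -> Cgen R)
  (Te : R -> ('rV[R]_n -> R[i]) -> R[i])
  (kap : R -> 'rV[R]_(n + n) -> R[i]) (v : R -> 'rV[R]_n -> R[i]).

Definition net_supported Te K : Prop := forall e f U, 0 < e <= 1 -> smooth Om f ->
  open U -> K `<=` U -> (forall y, U y -> f y = 0) -> Te e f = 0.

Lemma vanishes_off_all v : vanishes_off Om Om v.
Proof. by move=> e y _ Oy /(_ Oy). Qed.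

(* Only small e matter, so the net may be set to 0 where the estimate with a
   fixed compact set does not hold. *)
Lemma basic_G_supported T : basic_G T -> exists Te, basic_net_G T Te /\
  exists K, [/\ compact K, K `<=` Om & net_supported Te K].
Proof.
move=> [_ [Te0 bT0]]; have [Tf0 _] := basic_net_G_represents bT0.
have [H1 [K [j [N [eta [cK KOm eta01 H2]]]]] H3] := bT0.
pose Te (e : R) f := if e <= eta then Te0 e f else 0.
exists Te; split; last first.
  exists K; split=> // e f U e01 sf oU KU f0; rewrite /Te; case: ifP => // ee.
  have e0 : 0 < e by case/andP: e01.
  have S0 : (supDle K j f <= 0%:E)%E.
    apply: supDle_le => // y s Ky _.
    by rewrite (DseqC_eq0 s oU f0) ?normc0 //; exact: KU.
  have ee01 : 0 < e <= eta by rewrite e0 ee.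
  have := H2 f e sf ee01.
  have : ((e `^ (- N%:R))%:E * supDle K j f <= (e `^ (- N%:R))%:E * 0)%E.
    by rewrite lee_wpmul2l // lee_fin powR_ge0.
  rewrite mule0 => h1 h2; have := le_trans h2 h1; rewrite lee_fin => h.
  by apply: (@eq0_normc R); apply/eqP; rewrite eq_le h normc_ge0.
split.
- move=> e e01; rewrite /Te; case: (e <= eta).
    exact: H1.
  split=> [c f g _ _|]; first by rewrite mulr0 addr0.
  by exists K, 0%N, 0; split=> // f _; rewrite normc0 mul0e.
- exists K, j, N, eta; split=> // f e sf /andP[e0 ee]; rewrite /Te ee.
  by apply: H2 => //; rewrite e0.
- move=> v mv; rewrite H3 //; apply: Cclass_near.
    exact: (functional_net_moderate Tf0 mv (@vanishes_off_all v)).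
  by apply: filterS (near_le_eta eta01) => e /andP[_ ee]; rewrite /Te ee.
Qed.

Definition supp_net T := xget (fun _ _ => 0) [set Te | basic_net_G T Te /\
  exists K, [/\ compact K, K `<=` Om & net_supported Te K]].

Lemma supp_netP T : basic_G T -> basic_net_G T (supp_net T) /\
  exists K, [/\ compact K, K `<=` Om & net_supported (supp_net T) K].
Proof. by move=> bT; exact: (xgetPex _ (basic_G_supported bT)). Qed.

Lemma slice_smooth kap e x : smooth_net (Omsq Om) kap -> 0 < e <= 1 ->
  openset_val Om x -> testK Om Om (fun y => kap e (pairxy x y)).
Proof.
move=> sk e01 Ox.
have fib : fibred (@pairxy R n) Om kap Om Om by move=> e' x' y _ _ Oy /(_ Oy).
have := slice_testK (@pairxy_coord R n) (@pairxy_Omsq R n Om) (opensetP Om) (fun x => id)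
  sk fib [::] e01 Ox.
by congr testK; apply/funext => y; exact: DseqC_nil.
Qed.

(** For x off L the slice vanishes near K, by properness in the second variable, and the functional
    kills it. *)
Lemma supported_param_family Te K kap : smooth_net (Omsq Om) kap ->
  proper_net Om kap -> compact K -> K `<=` Om -> net_supported Te K ->
  exists L, [/\ compact L, L `<=` Om &
    vanishes_off Om L (param_family (@pairxy R n) Te kap)].
Proof.
move=> sk pk cK KOm sT; have [U [L [[oU KU] UOm [cL LOm] _ kUL]]] := proper_net_fibred pk cK KOm.
exists L; split=> // e x e01 Ox nL.
apply: (sT e _ U e01 _ oU KU); first by case: (slice_smooth sk e01 Ox).
by move=> y Uy; exact: (kUL e y x).
Qed.

Lemma Gclass_near_unit v w : Gmoderate Om v -> Gmoderate Om w ->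
  (forall e x, 0 < e <= 1 -> openset_val Om x -> v e x = w e x) ->
  Gclass Om v = Gclass Om w.
Proof.
move=> mv mw vw; apply: Gclass_near => //.
by apply: filterS (near_unit R) => e e01 x; exact: vw.
Qed.

Lemma exh_chi_smooth_Om m : smooth Om (exh_chi Om m).
Proof. exact: smooth_sub (@exh_chi_smooth R n Om m). Qed.

Lemma exh_theta_smooth_Om m : smooth Om (exh_theta Om m).
Proof. by have [sT _ _] := exh_thetaP Om; exact: smooth_sub (sT m). Qed.

Definition chi_net m v : R -> 'rV[R]_n -> R[i] := fun e x => exh_chi Om m x * v e x.

Lemma vanishes_off_factor L f v : vanishes_off Om L v ->
  vanishes_off Om L (fun e x => f x * v e x).
Proof. by move=> v0 e x e01 Ox nL; rewrite v0 ?mulr0. Qed.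

(** The partial sums of the pieces are the products of v with [exh_theta m], which are eventually v
    since v has compact support. The ultrametric inequality carries the strict bound along these
    sums. *)
Lemma seminorm_partition inf (P : G Om -> \bar R) (r : \bar R) v L :
  ultra_pseudo_seminorm (Gcset inf) P -> Gmod Om inf v -> compact L -> L `<=` Om ->
  vanishes_off Om L v -> (forall m, (P (Gclass Om (chi_net m v)) < r)%E) ->
  (P (Gclass Om v) < r)%E.
Proof.
move=> [_ _ _ PD] mv cL LOm v0 H; have [M LM] := exh_absorbs cL LOm.
pose th m : R -> 'rV[R]_n -> R[i] := fun e x => exh_theta Om m x * v e x.
have mth m : Gmod Om inf (th m) by exact: Gmod_factor (exh_theta_smooth_Om m) mv.
have mch m : Gmod Om inf (chi_net m v) by exact: Gmod_factor (exh_chi_smooth_Om m) mv.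
have E m : (P (Gclass Om (th m)) < r)%E.
  elim: m => [|m IH]; first exact: H 0%N.
  have -> : th m.+1 = (fun e x => th m e x + chi_net m.+1 v e x)%R.
    by apply/funext => e; apply/funext => x; rewrite /th /chi_net /=; ring.
  rewrite GclassD; [|exact: Gmod_moderate (mth m)|exact: Gmod_moderate (mch m.+1)].
  apply: (@le_lt_trans _ _ _ _ _ (PD _ _ _ _)).
  - exact: (Gcset_class (mth m) cL LOm (vanishes_off_factor _ v0)).
  - exact: (Gcset_class (mch m.+1) cL LOm (vanishes_off_factor _ v0)).
  - by rewrite gt_max IH H.
suff -> : Gclass Om v = Gclass Om (th M) by exact: E.
apply: Gclass_near_unit; [exact: Gmod_moderate mv | exact: Gmod_moderate (mth M) |].
move=> e x e01 Ox; rewrite /th; have [Lx|nL] := pselect (L x); last by rewrite v0 ?mulr0.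
by have [_ t1 _] := exh_thetaP Om; rewrite t1 ?mul1r //; exact: LM.
Qed.

Definition chi_kernel m kap : R -> 'rV[R]_(n + n) -> R[i] :=
  fun e z => exh_chi Om m (lsubmx z) * kap e z.

Lemma chi_kernel_Gmod inf m kap : Gmod (Omsq Om) inf kap ->
  Gmod (Omsq Om) inf (chi_kernel m kap).
Proof.
apply: Gmod_factor.
exact: (smooth_sub (fun=> fun=> I)
  (@smooth_lsub R n n _ _ openT (@exh_chi_smooth R n Om m))).
Qed.

Lemma chi_kernel_param_family m Te kap e x : functional_net Om Om Te ->
  smooth_net (Omsq Om) kap -> 0 < e <= 1 -> openset_val Om x ->
  chi_net m (param_family (@pairxy R n) Te kap) e x =
  param_family (@pairxy R n) Te (chi_kernel m kap) e x.
Proof.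
move=> TF sk e01 Ox; have [K [j [C [_ _ bT]]]] := TF.1 e e01.
have t0 : testK Om Om (fun=> 0) by split=> //; exact: smooth0 (opensetP Om).
rewrite /chi_net /param_family /chi_kernel.
have := bT.1 (exh_chi Om m x) _ _ (slice_smooth sk e01 Ox) t0.
rewrite (functional0 bT) addr0 => <-; congr (Te e _); apply/funext => y.
by rewrite addr0 /pairxy row_mxKl.
Qed.

Lemma slice_net_eq0 kap U s x e y : open U -> U `<=` Om ->
  smooth_net (Omsq Om) kap -> (forall e, openset_val Om (x e)) -> 0 < e <= 1 ->
  (forall x y, openset_val Om x -> U y -> kap e (row_mx x y) = 0) -> U y ->
  slice_net kap s x e y = 0.
Proof.
move=> oU UOm sk Ox e01 k0 Uy; rewrite /slice_net /slice.
have oW : open [set z : 'rV[R]_(n + n) | openset_val Om (lsubmx z) /\ U (rsubmx z)].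
  apply: openI.
    by apply: open_comp (opensetP Om) => z _; exact: continuous_lsubmx.
  by apply: open_comp oU => z _; exact: continuous_rsubmx.
apply: (DseqC_eq0 _ oW); last by rewrite /pairxy /= row_mxKl row_mxKr; split.
by move=> z [Oz Uz]; rewrite -[z]hsubmxK; exact: k0.
Qed.

End SupportedNets.

(** * Continuity into the inductive limit *)

Section IntoCompactSupport.
Variables (R : realType) (n : nat) (Om : openset R n).
Implicit Types (K L : set 'rV[R]_n) (T : G Om -> Cgen R)
  (Te : R -> ('rV[R]_n -> R[i]) -> R[i]).

Lemma Cabs_cpowM (b : R) (z : Cgen R) : (Cabs z < 1%:E)%E ->
  (Cabs (cpow b * z)%R <= (expR (- b))%:E)%E.
Proof.
move=> z1; have mz := Cmoderate_repr z; have mb := cpow_net_moderate b.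
have : bigOpow (fun e => (normc (Crepr z e))%:E) 0.
  rewrite -(CreprK z) Cabs_class // in z1.
  apply: (expsup_ge _ (r := 0)) => [b1 b2 h1 h2|]; first exact: bigOpow_weak h2 h1.
  by rewrite oppr0 expR0.
rewrite -[in X in _ -> X](CreprK z) -CclassM // => Hz; rewrite Cabs_class; last first.
  have zm : Crepr z \in @Cmoderate_pred R by apply/asboolP.
  have bm : cpow_net b \in @Cmoderate_pred R by apply/asboolP.
  by have /asboolP := rpredM bm zm.
apply: expsup_ub; rewrite -[b]addr0.
apply: (bigOpowM (bigOpow_cpow_net b) Hz) => [e|]; first exact: normc_ge0.
by apply: nearW => e; rewrite addr0 normcM EFinM.
Qed.

Lemma dual_scale T (c : Cgen R) u : dual (lcs_G Om) T -> T (c *: u) = c * T u.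
Proof.
move=> [lT _]; have T0 : T 0 = 0.
  have := lT 1 0 0 I I; rewrite scale1r addr0 mul1r => /eqP.
  by rewrite -subr_eq0 opprD addrA subrr sub0r oppr_eq0 => /eqP.
by have := lT c u 0 I I; rewrite !addr0 T0 addr0.
Qed.

Lemma seq_ub (I : eqType) (s : seq I) (F : I -> R) :
  exists C, forall i, i \in s -> F i <= C.
Proof.
elim: s => [|i s [C HC]]; first by exists 0.
exists (Num.max (F i) C) => j; rewrite inE => /orP[/eqP ->|/HC jC].
  by rewrite le_max lexx.
by rewrite le_max jC orbT.
Qed.

Variables (inf : bool) (kap : R -> 'rV[R]_(n + n) -> R[i]).
Hypotheses (mk : Gmod (Omsq Om) inf kap) (pk : proper_net Om kap).

Let index := (set 'rV[R]_n * set (seq 'I_n))%type.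

Let chik m := chi_kernel Om m kap.

Let mchik m : Gmod (Omsq Om) inf (chik m).
Proof. exact: chi_kernel_Gmod. Qed.

(* Only finitely many of the kernels chi_m * kap are nonzero near a given
   compact set of second variables. *)
Lemma chi_kernel_fibred K2 : compact K2 -> K2 `<=` Om -> exists (U : set 'rV[R]_n) Q,
  [/\ open U, K2 `<=` U, U `<=` Om & forall m e x y, (Q < m)%N -> 0 < e <= 1 ->
    openset_val Om x -> U y -> chik m e (row_mx x y) = 0].
Proof.
move=> cK2 K2Om; have [U [L [[oU KU] UOm [cL LOm] _ kUL]]] := proper_net_fibred pk cK2 K2Om.
have [Q LQ] := exh_absorbs cL LOm; exists U, Q; split=> // m e x y Qm e01 Ox Uy.
rewrite /chik /chi_kernel row_mxKl; have [/LQ xQ|nL] := pselect (L x).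
  by rewrite (exh_chi_exh Qm xQ) mul0r.
by have := kUL e y x e01 Uy Ox nL; rewrite /pairyx => ->; rewrite mulr0.
Qed.

(* The factors cpow (- b m) turn a bound by 1 on the union into a bound by
   expR (- b m) on the slices of the m-th kernel. *)
Lemma bounded_union (s : nat -> seq index) (b : nat -> R) :
  (forall m q, q \in s m -> [/\ compact q.1, q.1 `<=` Om & admissible inf q.2]) ->
  lcs_bounded (lcs_G Om) [set u | exists m q u', [/\ q \in s m,
    slices (chik m) q.1 q.2 u' & u = cpow (- b m) *: u']].
Proof.
move=> Hs; rewrite lcsG_false; split=> // P [K2 [A2 [cK2 K2Om adA2 ->]]].
have [U [Q [oU K2U UOm k0]]] := chi_kernel_fibred cK2 K2Om.
have [j jA] := adA2.
have /choice [N HN] : forall mq : nat * index, exists N : nat, mq.2 \in s mq.1 ->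
    forall t x c, mq.2.2 t -> (forall e, mq.2.1 (x e)) -> (size c <= j)%N ->
      Obound K2 c (slice_net (chik mq.1) t x) (- N%:R).
  move=> [m q]; have [/Hs [c1 c2 c3]|] := boolP (q \in s m); last by exists 0%N.
  by have [N HN] := slices_Obound j (mchik m) c3 c1 c2 cK2 K2Om; exists N => _.
(* Only the m at most Q and, for each of them, the finite list [s m] matter; C2 bounds all these
   terms. *)
have /choice [C1 HC1] : forall m, exists C, forall q, q \in s m ->
    expR (- (- b m + - (N (m, q))%:R)) <= C by move=> m; exact: seq_ub.
have [C2 HC2] := seq_ub (iota 0 Q.+1) C1.
exists (Num.max C2 1) => _ [m [q [_ [qs [t [x [qt qx ->]]] ->]]]].
have [c1 c2 c3] := Hs m q qs.
have Ox e : openset_val Om (x e) by exact: c2.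
have sv := slice_net_smooth t (mchik m).1 Ox.
have mv : Gmoderate Om (slice_net (chik m) t x).
  exact: (@slice_net_moderate R n Om (chik m) q.1 t x (Gmod_moderate (mchik m)) c1 c2 qx).
have [mbv ->] := cpow_class (- b m) mv.
rewrite Nsem_class //; have [mQ|Qm] := leqP m Q.
  apply: (@le_trans _ _ (expR (- (- b m + - (N (m, q))%:R)))%:E).
    apply: expsup_ub => c; rewrite jA => cj.
    exact: (Obound_cpow _ K2Om sv (HN (m, q) qs t x c qt qx cj)).
  rewrite lee_fin (le_trans (HC1 m q qs)) // le_max HC2 //.
  by rewrite mem_iota add0n ltnS.
(* For m > Q the slices vanish near K2, whatever the factor [cpow (- b m)]. *)
apply: (@le_trans _ _ 1%:E); last by rewrite lee_fin le_max lexx orbT.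
rewrite -[1 in X in (_ <= X)%E]expR0 -[0 in X in (_ <= X)%E]oppr0.
apply: expsup_ub => c _.
have := @Obound_cpow R n Om K2 c (slice_net (chik m) t x) (- b m) (b m) K2Om sv.
rewrite addNr; apply.
exists 0; near=> e => y K2y; have e01 : 0 < e <= 1 by near: e; exact: near_unit.
rewrite (DseqC_eq0 c oU) ?normc0 ?mul0r //; last exact: K2U.
move=> z Uz; apply: (slice_net_eq0 t oU UOm (mchik m).1 Ox e01 _ Uz).
by move=> x' y' Ox' Uy'; exact: k0.
Unshelve. all: by end_near. Qed.

Let w T := param_family (@pairxy R n) (supp_net T) kap.

Let rep T : basic_G T -> represents T (supp_net T) Om.
Proof. by move=> bT; apply: basic_net_G_represents; exact: (supp_netP bT).1. Qed.

Let mw T : basic_G T -> Gmod Om inf (w T).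
Proof. move=> bT; exact: (acts_on_Gmod mk (represents_acts_on kap (rep bT))). Qed.

Let w_vanishes T : basic_G T -> exists L, [/\ compact L, L `<=` Om & vanishes_off Om L (w T)].
Proof.
move=> bT; have [_ [K [cK KOm sT]]] := supp_netP bT.
exact: supported_param_family mk.1 pk cK KOm sT.
Qed.

(** Each compact set X m.+1 has its own list of seminorms [s m] and radius [r' m], and [b m] is
    chosen with expR (- b m) below this radius. The condition that T - T0 be less than 1 on the
    bounded union B then controls all the pieces of the difference at once. *)
Lemma Lb_G_maps_Gc (A : kernel_operator Om) : Gclass (Omsq Om) kap = op_kernel A ->
  maps_dual_continuously A (Lb_G Om) (lcsGc Om inf).
Proof.
move=> kA; exists (fun T => Gclass Om (w T)); split.
  move=> T bT u Gu; rewrite /op_dual /op_transpose -kA.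
  exact: (pairing_identity (Gmod_moderate mk) (represents_acts_on kap (rep bT)) Gu).
apply: lcs_continuous_lipschitz => [T bT|P r FP r0].
  by have [L [cL LOm v0]] := w_vanishes bT; exact: (Gcset_class (mw bT) cL LOm v0).
have /choice [s Hs] : forall m, exists s : seq index, exists r' : R,
    [/\ forall q, q \in s -> [/\ compact q.1, q.1 `<=` Om & admissible inf q.2],
        0 < r' & forall u, Gcset inf u -> Gsupp u `<=` exh Om m.+1 ->
          (forall q, q \in s -> (Nsem q.1 q.2 u < r'%:E)%E) -> (P u < r%:E)%E].
  by move=> m; exact: lcsGc_small FP (@exh_compact R n Om m.+1) (@exh_sub R n Om m.+1) r0.
have [r' Hr'] := choice Hs.
have /choice [b Hb] : forall m, exists b : R, expR (- b) < r' m.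
  by move=> m; apply: expR_small; have [] := Hr' m.
have Hsq m q : q \in s m -> [/\ compact q.1, q.1 `<=` Om & admissible inf q.2].
  by move=> qs; have [H _ _] := Hr' m; exact: H.
have bB := bounded_union b Hsq; set B := [set u | _] in bB.
exists (fun T => nnsup [set Cabs (T u) | u in B]), 1; split=> //; first by exists B.
move=> T0 T bT0 bT T1.
pose Td := fun e f => supp_net T e f - supp_net T0 e f.
have rT : represents (T - T0) Td Om.
  by have := represents_diff (rep bT) (rep bT0); rewrite setIid.
have [L0 [cL0 L0Om v0]] := w_vanishes bT0; have [L [cL LOm v]] := w_vanishes bT.
pose wd := param_family (@pairxy R n) Td kap.
have mwd : Gmod Om inf wd by exact: acts_on_Gmod mk (represents_acts_on kap rT).
have vd : vanishes_off Om (L `|` L0) wd.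
  move=> e x e01 Ox nL; have E1 : w T e x = 0 by apply: v => // Lx; apply: nL; left.
  have E2 : w T0 e x = 0 by apply: v0 => // Lx; apply: nL; right.
  by rewrite -[LHS]/(w T e x - w T0 e x) E1 E2 subrr.
have cLL : compact (L `|` L0) by exact: compactU.
have LLOm : L `|` L0 `<=` Om by move=> x [/LOm|/L0Om].
have -> : Gclass Om (w T) - Gclass Om (w T0) = Gclass Om wd.
  by rewrite -GclassB //; [exact: Gmod_moderate (mw bT) | exact: Gmod_moderate (mw bT0)].
have [uP _] := FP.
apply: (seminorm_partition uP mwd cLL LLOm vd) => m.
have mch : Gmod Om inf (chi_net Om m wd) by exact: Gmod_factor (exh_chi_smooth_Om Om m) mwd.
have act := represents_acts_on (chik m) rT.
have mp : Gmod Om inf (param_family (@pairxy R n) Td (chik m)).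
  exact: acts_on_Gmod (mchik m) act.
have [_ _ HP] := Hr' m; apply: HP.
- exact: (Gcset_class mch cLL LLOm (vanishes_off_factor _ vd)).
(* The m-th piece is supported in X m.+1 whatever T is, so the radius could be fixed before T. *)
- apply: Gsupp_vanishes; [exact: Gmod_moderate mch | |].
    by apply: compact_closed_rV; exact: exh_compact.
  move=> e x _ _ nx; rewrite /chi_net exh_chi_shell ?mul0r //.
  by move=> /shell_sub.
move=> q qs; have [c1 c2 c3] := Hsq m q qs.
have -> : Gclass Om (chi_net Om m wd) = Gclass Om (param_family (@pairxy R n) Td (chik m)).
  apply: Gclass_near_unit; [exact: Gmod_moderate mch | exact: Gmod_moderate mp |].
  by move=> e x e01 Ox; exact: chi_kernel_param_family rT.1 mk.1 e01 Ox.
apply: le_lt_trans (Nsem_dual_le q.2 c1 c2 (Gmod_moderate (mchik m)) act) _.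
apply: (@le_lt_trans _ _ (expR (- b m))%:E); last by rewrite lte_fin.
apply: nnsup_le => [|_ [u su <-]]; first by rewrite lee_fin expR_ge0.
(* The scaled slice lies in B, where T - T0 is less than 1; scaling back yields the factor expR (- b
   m). *)
have -> : (T - T0) u = cpow (b m) * (T - T0) (cpow (- b m) *: u).
  rewrite -![(T - T0) _]/(T _ - T0 _) (dual_scale _ _ bT.1) (dual_scale _ _ bT0.1).
  by rewrite -mulrBr mulrA cpowK mul1r.
apply: Cabs_cpowM; apply: le_lt_trans T1.
by apply: nnsup_ub; exists (cpow (- b m) *: u) => //; exists m, q, u.
Qed.

End IntoCompactSupport.

Theorem proposition2p7 (R : realType) (n : nat) (Om : openset R n)
    (A : kernel_operator Om) :
  [/\ maps_dual_continuously A (Lb_G Om) (lcs_G Om),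
      properly_supported A ->
        maps_dual_continuously A (Lb_G Om) (lcs_Gc Om) /\
        maps_dual_continuously A (Lb_Gc Om) (lcs_G Om) &
      Ginf (op_kernel A) ->
        maps_dual_continuously A (Lb_G Om) (lcs_Ginf Om) /\
        (properly_supported A ->
           maps_dual_continuously A (Lb_G Om) (lcs_Ginfc Om) /\
           maps_dual_continuously A (Lb_Gc Om) (lcs_Ginf Om))].
Proof.
have [mk kA] : Gmod (Omsq Om) false (Grepr (op_kernel A)) /\
    Gclass (Omsq Om) (Grepr (op_kernel A)) = op_kernel A.
  by split; [apply/Gmod_false; exact: Gmoderate_repr | exact: GreprK].
have proper inf kap : Gmod (Omsq Om) inf kap ->
    Gclass (Omsq Om) kap = op_kernel A -> properly_supported A ->
    maps_dual_continuously A (Lb_G Om) (lcsGc Om inf) /\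
    maps_dual_continuously A (Lb_Gc Om) (lcsG Om inf).
  move=> mkap kapA; rewrite /properly_supported -kapA => pk.
  (* The cutoff changes the net but not its class, so [kap'] still represents the kernel of A. *)
  have [kap' [mk' kE pk']] := exists_proper_net mkap pk; rewrite kapA in kE.
  by split; [exact: Lb_G_maps_Gc mk' pk' A kE | exact: Lb_Gc_maps mk' kE pk'].
split.
- by rewrite lcsG_false; exact: Lb_G_maps mk kA.
- by rewrite lcsG_false lcsGc_false; exact: proper mk kA.
- move=> /Ginf_Gmod [kap mkap kapA]; rewrite lcsG_true lcsGc_true; split.
    exact: Lb_G_maps mkap kapA.
  exact: proper mkap kapA.
Qed.
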